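(* Let $A$ be a PI-Banach algebra (not necessarily unital) with $\tau_\infty$ Hausdorff on $Id(A)$. Then $A$ has spectral synthesis.
   Context: Banach algebras are complex. A PI-Banach algebra is a Banach algebra whose elements satisfy a non-trivial polynomial identity (in non-commuting variables). $Id(A)$ is the set of all closed two-sided ideals of $A$ (including $\{0\}$ and $A$). Topology $\tau_\infty$: for $k\in\mathbf N$ let $S_k(A)$ be the set of algebra (i.e. submultiplicative) seminorms $\rho$ on $A$ with $\rho(a)\le k\|a\|$ for all $a\in A$, with the topology of pointwise convergence (compact Hausdorff). Let $\tau_k$ be the quotient topology on $Id(A)$ of the map $S_k(A)\to Id(A)$, $\rho\mapsto\ker\rho$. Then $\tau_\infty=\bigcap_k\tau_k$. Spectral synthesis: $Prim(A)$ is the set of primitive ideals (kernels of algebraically irreducible representations) with the hull-kernel topology. An ideal is semisimple if it is an intersection of primitive ideals ($A$ itself being the empty intersection). $Prim^s(A)$ is the set of proper semisimple prime ideals with the hull-kernel topology. $A$ has spectral synthesis if: (i)$'$ $Prim^s(A)$ is locally compact (every point has a neighbourhood base of compact sets); (ii)$'$ whenever a net $(P_\alpha)$ in $Prim(A)$ converges to $P\in Prim(A)$ in the hull-kernel topology and $a\in A\setminus P$, then $\liminf_\alpha\|a+P_\alpha\|>0$; (iii)$'$ $I\mapsto\{P\in Prim(A):P\not\supseteq I\}$ is an isomorphism of $Id(A)$ onto the lattice of open subsets of $Prim(A)$; equivalently every proper closed ideal of $A$ is semisimple. *)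

(* Defs.v *)
From HB Require Import structures.
From mathcomp Require Import all_boot all_order all_algebra finmap.
From mathcomp Require Import complex.
From mathcomp Require Import all_classical all_reals all_analysis.

Set Implicit Arguments.
Unset Strict Implicit.
Unset Printing Implicit Defensive.

Import Order.TTheory GRing.Theory Num.Theory.
Import numFieldNormedType.Exports.

Local Open Scope classical_set_scope.
Local Open Scope ring_scope.
Local Open Scope complex_scope.

(* MathComp rings are unital, so the product is added to the Banach space by
   hand; no unit is assumed, and the zero algebra is allowed. *)
HB.mixin Record isBanachAlgebra (R : realType) A
    of CompleteNormedModule R[i] A := {
  bmul : A -> A -> A;
  bmulA : forall x y z : A, bmul x (bmul y z) = bmul (bmul x y) z;
  bmul_linearl : forall (c : R[i]) (x y z : A),
    bmul (c *: x + y) z = c *: bmul x z + bmul y z;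
  bmul_linearr : forall (c : R[i]) (x y z : A),
    bmul z (c *: x + y) = c *: bmul z x + bmul z y;
  ler_bmul : forall x y : A, `|bmul x y| <= `|x| * `|y|
}.

#[short(type="banachAlgType")]
HB.structure Definition BanachAlgebra (R : realType) :=
  {A of CompleteNormedModule R[i] A & isBanachAlgebra R A}.

(* The library norm of a normed space over [R[i]] takes its values in [R[i]]
   (they are nonnegative reals); this is the same norm, valued in [R]. *)
Definition rnorm (R : realType) (V : normedModType R[i]) (x : V) : R :=
  complex.Re `|x|.

Section PolynomialIdentity.
Context {R : realType} (A : banachAlgType R).

Definition word_eval (a : nat -> A) (w : seq nat) : A :=
  if w is i :: w' then foldl (fun x j => bmul x (a j)) (a i) w' else 0.

(* A polynomial in the non-commuting variables X_0, X_1, ... is the finitely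
   supported family of its coefficients, indexed by words.  As A need not have
   a unit, there is no constant term; when A is unital this loses nothing,
   since evaluating an identity at 0 kills the constant term. *)
Definition PI_algebra : Prop :=
  exists f : {fsfun seq nat -> R[i] with 0},
    [/\ f [::] = 0, exists w, f w != 0 &
        forall a : nat -> A, \sum_(w <- finsupp f) f w *: word_eval a w = 0].

End PolynomialIdentity.

Section Ideals.
Context {R : realType} (A : banachAlgType R).

Definition two_sided_ideal (I : set A) : Prop :=
  [/\ I 0,
      forall (c : R[i]) x y, I x -> I y -> I (c *: x + y),
      forall a x, I x -> I (bmul a x) &
      forall a x, I x -> I (bmul x a)].

Record closed_ideal := ClosedIdeal {
  ideal_set :> set A;
  ideal_two_sided : two_sided_ideal ideal_set;
  ideal_closed : closed ideal_set }.

HB.instance Definition _ := gen_eqMixin closed_ideal.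
HB.instance Definition _ := gen_choiceMixin closed_ideal.

Record bseminorm (k : nat) := BSeminorm {
  seminorm_fun :> A -> R;
  seminorm_ge0 : forall a, 0 <= seminorm_fun a;
  seminormD : forall a b,
    seminorm_fun (a + b) <= seminorm_fun a + seminorm_fun b;
  seminormZ : forall (c : R[i]) a,
    seminorm_fun (c *: a) = complex.Re `|c| * seminorm_fun a;
  seminormM : forall a b,
    seminorm_fun (bmul a b) <= seminorm_fun a * seminorm_fun b;
  seminorm_le : forall a, seminorm_fun a <= k%:R * rnorm a }.

HB.instance Definition _ k := gen_eqMixin (bseminorm k).
HB.instance Definition _ k := gen_choiceMixin (bseminorm k).

Definition bseminorm_ptws k (rho : bseminorm k) : {ptws A -> R} := rho.

HB.instance Definition _ k := Topological.copy (bseminorm k)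
  (initial_topology (@bseminorm_ptws k)).

Section Kernel.
Variables (k : nat) (rho : bseminorm k).

Definition seminorm_ker_set : set A := [set a | rho a = 0].

Lemma seminorm_ker_ideal : two_sided_ideal seminorm_ker_set.
Proof.
split; rewrite /seminorm_ker_set /=.
- by rewrite -(scale0r (0 : A)) seminormZ normr0 mul0r.
- move=> c x y x0 y0; apply/eqP; rewrite eq_le seminorm_ge0 andbT.
  by apply: le_trans (seminormD _ _ _) _; rewrite seminormZ x0 y0 mulr0 addr0.
- move=> a x x0; apply/eqP; rewrite eq_le seminorm_ge0 andbT.
  by apply: le_trans (seminormM _ _ _) _; rewrite x0 mulr0.
- move=> a x x0; apply/eqP; rewrite eq_le seminorm_ge0 andbT.
  by apply: le_trans (seminormM _ _ _) _; rewrite x0 mul0r.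
Qed.

Lemma seminorm_ker_closed : closed seminorm_ker_set.
Proof.
move=> x clx; apply/eqP; rewrite eq_le seminorm_ge0 andbT leNgt.
apply/negP => x_gt0.
pose e : R := rho x / k.+1%:R.
have e_gt0 : 0 < e by rewrite divr_gt0 ?ltr0n.
have eC_gt0 : 0 < e%:C by rewrite ltcR.
have [y [y0 xy]] := clx _ (nbhsx_ballx x _ eC_gt0).
move: xy; rewrite -ball_normE /ball_ /= => xy.
have ney : rnorm (x - y) < e.
  by rewrite -ltcR /rnorm RRe_real // ger0_real.
have : rho x <= k%:R * rnorm (x - y).
  rewrite -{1}(subrK y x) (le_trans (seminormD _ _ _))//.
  by rewrite y0 addr0 seminorm_le.
have /le_lt_trans : k%:R * rnorm (x - y) <= k%:R * e.
  by rewrite ler_wpM2l// ltW.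
move=> /(_ (k.+1%:R * e)); rewrite ltr_pM2r// ltr_nat ltnSn => /(_ isT) h1 h2.
have := le_lt_trans h2 h1.
by rewrite mulrC divfK ?pnatr_eq0// ltxx.
Qed.

Definition seminorm_ker : closed_ideal :=
  ClosedIdeal seminorm_ker_ideal seminorm_ker_closed.

End Kernel.

(* A topology on Id(A) is represented by its collection of open sets. *)
Definition tau (k : nat) : set (set closed_ideal) :=
  [set U | open (@seminorm_ker k @^-1` U)].

(* k = 0 is left out: S_0(A) = {0} does not map onto Id(A), and its final
   topology is discrete, so it would not change the intersection. *)
Definition tau_infty : set (set closed_ideal) :=
  \bigcap_(k in [set k | (0 < k)%N]) tau k.

Lemma tau_inftyT : tau_infty setT.
Proof. by move=> k _; rewrite /tau /= preimage_setT; exact: openT. Qed.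

Lemma tau_inftyI : setI_closed tau_infty.
Proof.
move=> U V oU oV k k0; rewrite /tau /= preimage_setI.
by apply: openI; [exact: oU|exact: oV].
Qed.

Lemma tau_infty_bigU (I : Type) (f : I -> set closed_ideal) :
  (forall i, tau_infty (f i)) -> tau_infty (\bigcup_i f i).
Proof.
move=> of_ k k0; rewrite /tau /= preimage_bigcup.
by apply: bigcup_open => i _; exact: of_.
Qed.

(* From here on [open], [nbhs] and [hausdorff_space] on [closed_ideal] refer
   to tau_infty. *)
HB.instance Definition _ :=
  isOpenTopological.Build closed_ideal tau_inftyT tau_inftyI tau_infty_bigU.

End Ideals.

Section Primitive.
Context {R : realType} (A : banachAlgType R).

Definition representation (V : lmodType R[i]) (pi : A -> {linear V -> V}) :=
  (forall (c : R[i]) a b v, pi (c *: a + b) v = c *: pi a v + pi b v) /\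
  (forall a b v, pi (bmul a b) v = pi a (pi b v)).

Definition invariant_subspace (V : lmodType R[i]) (pi : A -> {linear V -> V})
    (W : set V) :=
  [/\ W 0, forall (c : R[i]) v w, W v -> W w -> W (c *: v + w) &
      forall a v, W v -> W (pi a v)].

(* The first clause (AV <> 0) excludes V = 0 and the null action of A on a
   line. *)
Definition irreducible (V : lmodType R[i]) (pi : A -> {linear V -> V}) :=
  (exists a v, pi a v != 0) /\
  forall W, invariant_subspace pi W -> W = [set 0] \/ W = setT.

Definition primitive_ideal (P : set A) : Prop :=
  exists (V : lmodType R[i]) (pi : A -> {linear V -> V}),
    [/\ representation pi, irreducible pi &
        P = [set a | forall v, pi a v = 0]].

Definition semisimple_ideal (I : set A) : Prop :=
  exists2 S : set (set A), S `<=` primitive_ideal & I = \bigcap_(P in S) P.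

Definition prime_ideal (P : set A) : Prop :=
  two_sided_ideal P /\
  forall I J : set A, two_sided_ideal I -> two_sided_ideal J ->
    (forall x y, I x -> J y -> P (bmul x y)) -> I `<=` P \/ J `<=` P.

Lemma primitive_proper (P : set A) : primitive_ideal P -> P <> setT.
Proof.
move=> [V [pi [_ [[a [v /eqP piav]] _] ->]]] PT; apply: piav.
by have : setT a by []; rewrite -PT; exact.
Qed.

Lemma primitive_prime (P : set A) : primitive_ideal P -> prime_ideal P.
Proof.
move=> [V [pi [[piL piM] [_ pi_irr] ->]]].
have pi0 v : pi 0 v = 0.
  by have := piL (-1) 0 0 v; rewrite scaler0 addr0 scaleN1r addNr.
split.
  split => /=.
  - by move=> v; rewrite pi0.
  - by move=> c x y x0 y0 v; rewrite piL x0 y0 scaler0 addr0.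
  - by move=> a x x0 v; rewrite piM x0 linear0.
  - by move=> a x x0 v; rewrite piM x0.
move=> I J [I0 IL Il Ir] [J0 JL Jl Jr] IJ.
have [|/existsNP[y /not_implyP[Jy /existsNP[v yv]]]] :=
  pselect (J `<=` [set a | forall v, pi a v = 0]); [by right|left].
pose W := [set w | exists2 z, J z & w = pi z v].
have Winv : invariant_subspace pi W.
  split.
  - by exists 0 => //; rewrite pi0.
  - move=> c _ _ [z Jz ->] [z' Jz' ->].
    by exists (c *: z + z'); [exact: JL|rewrite piL].
  - move=> a _ [z Jz ->].
    by exists (bmul a z); [exact: Jl|rewrite piM].
have [W0|WT] := pi_irr _ Winv.
  by have : W (pi y v) by [exists y]; rewrite W0.
move=> x Ix w; have : W w by rewrite WT.
by move=> [z Jz ->]; rewrite -piM; exact: IJ.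
Qed.

Lemma bigcap_ideal (T : Type) (S : set T) (f : T -> set A) :
  (forall t, two_sided_ideal (f t)) -> two_sided_ideal (\bigcap_(t in S) f t).
Proof.
move=> fI; split.
- by move=> t _; have [] := fI t.
- by move=> c x y xS yS t St; have [_ + _ _] := fI t; apply;
    [exact: xS|exact: yS].
- by move=> a x xS t St; have [_ _ + _] := fI t; apply; exact: xS.
- by move=> a x xS t St; have [_ _ _ +] := fI t; apply; exact: xS.
Qed.

Section HullKernel.
Variables (T : Type) (f : T -> set A).

Definition kernel (S : set T) : set A := \bigcap_(t in S) f t.

Definition hull (I : set A) : set T := [set t | I `<=` f t].

Definition hk_open (U : set T) : Prop := hull (kernel (~` U)) `<=` ~` U.

Hypothesis f_proper : forall t, f t <> setT.
Hypothesis f_prime : forall t, prime_ideal (f t).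

Lemma hk_openT : hk_open setT.
Proof.
move=> t; rewrite /hull /kernel setCT bigcap_set0 /= => ft.
by case: (f_proper (t := t)); apply/seteqP; split.
Qed.

Lemma hk_openI : setI_closed hk_open.
Proof.
move=> U V oU oV t; rewrite /hull /kernel setCI bigcap_setU /= => UVt.
have fI s : two_sided_ideal (f s) by have [] := f_prime s.
have kI S : two_sided_ideal (kernel S) by exact: bigcap_ideal.
have [_ ft] := f_prime t.
have [Ut|Vt] : kernel (~` U) `<=` f t \/ kernel (~` V) `<=` f t.
- apply: ft => // x y Ux Vy; apply: UVt; split.
    by have [_ _ _] := kI (~` U); exact.
  by have [_ _ + _] := kI (~` V); exact.
- by left; exact: oU.
- by right; exact: oV.
Qed.

Lemma hk_open_bigU (I : Type) (F : I -> set T) :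
  (forall i, hk_open (F i)) -> hk_open (\bigcup_i F i).
Proof.
move=> oF t ht [i _ Fit]; apply: (oF i t) => // x kx; apply: ht => s Fs.
by apply: kx => Fis; apply: Fs; exists i.
Qed.

End HullKernel.

Record Prim := MkPrim {
  prim_set :> set A;
  prim_primitive : primitive_ideal prim_set }.

Record Prims := MkPrims {
  prims_set :> set A;
  prims_proper : prims_set <> setT;
  prims_semisimple : semisimple_ideal prims_set;
  prims_prime : prime_ideal prims_set }.

HB.instance Definition _ := gen_eqMixin Prim.
HB.instance Definition _ := gen_choiceMixin Prim.
HB.instance Definition _ := gen_eqMixin Prims.
HB.instance Definition _ := gen_choiceMixin Prims.

Let prim_proper (P : Prim) : (P : set A) <> setT :=
  primitive_proper (prim_primitive P).
Let prim_prime (P : Prim) : prime_ideal P :=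
  primitive_prime (prim_primitive P).

HB.instance Definition _ := isOpenTopological.Build Prim
  (hk_openT prim_proper) (hk_openI prim_prime) (@hk_open_bigU _ prim_set).
HB.instance Definition _ := isOpenTopological.Build Prims
  (hk_openT prims_proper) (hk_openI prims_prime) (@hk_open_bigU _ prims_set).

End Primitive.

Section Nets.

Definition directed_preorder (D : Type) (le : D -> D -> Prop) : Prop :=
  [/\ inhabited D, forall d, le d d,
      forall d e f, le d e -> le e f -> le d f &
      forall d e, exists f, le d f /\ le e f].

(* The section filter of a net. *)
Definition tails (D : Type) (le : D -> D -> Prop) : set_system D :=
  [set S | exists d, forall e, le d e -> S e].

Definition net_liminf {R : realType} (D : Type) (le : D -> D -> Prop)
    (u : D -> \bar R) : \bar R :=
  ereal_sup [set ereal_inf [set u e | e in [set e | le d e]] | d in setT].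

End Nets.

Section SpectralSynthesis.
Context {R : realType} (A : banachAlgType R).

Definition quotient_norm (a : A) (P : set A) : R :=
  inf [set rnorm (a + p) | p in P].

(* Written out because the library's [locally_compact] asks for a single
   compact closed neighbourhood, which is different in non-Hausdorff spaces. *)
Definition has_compact_nbhs_bases (X : topologicalType) : Prop :=
  forall (x : X) (U : set X), nbhs x U ->
    exists K : set X, [/\ nbhs x K, compact K & K `<=` U].

Definition lower_bounded_nets : Prop :=
  forall (D : Type) (le : D -> D -> Prop) (P_ : D -> Prim A) (P : Prim A)
      (a : A),
    directed_preorder le -> P_ @ tails le --> P -> ~ (P : set A) a ->
    (0 < net_liminf le (fun d => (quotient_norm a (P_ d))%:E))%E.

Definition prim_support (I : closed_ideal A) : set (Prim A) :=
  [set P : Prim A | ~ (I `<=` P)].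

(* An isomorphism of lattices is an order isomorphism; both sides are ordered
   by inclusion. *)
Definition prim_support_lattice_iso : Prop :=
  set_bij setT (@open (Prim A)) prim_support /\
  forall I J : closed_ideal A,
    I `<=` J <-> prim_support I `<=` prim_support J.

Definition spectral_synthesis : Prop :=
  [/\ has_compact_nbhs_bases (Prims A), lower_bounded_nets &
      prim_support_lattice_iso].

End SpectralSynthesis.

(* Main.v *)
(* The kernel map is continuous on each compact space of seminorms, so when
   tau_infty is Hausdorff, two sequences of uniformly bounded seminorms with
   pairwise equal kernels tend to 0 at the same elements.  Comparing suitable
   norms with the quotient norm of the common kernel gives everything.

   - The supremum of the quotient norms modulo some closed ideals against the
     quotient norm modulo their intersection: (ii)' follows, and also that
     Id(A) is a continuous lattice.
   - A norm inf_n (q(x - n) + t q(n)), with n in an ideal D such that D^2 is in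
     I, against the quotient norm q modulo I as t tends to 0: closed ideals are
     semiprime.
   - Let J be the intersection of the primitive ideals containing I, modulo I,
     inside the unitization of A/I.  It is semiprime, and since A is PI it
     satisfies a Capelli identity of some order.  If the Capelli polynomial of
     order m+2 vanishes on J, an exchange argument gives, on J,
     t(x) v c(x') = c(x) v t(x'), where c is the polynomial of order m+1 and
     t(x) = sum_i c(.., a x_i b, ..).  Elements a of J are quasi-nilpotent, so
     after an equivalent renorming x |-> a x b has arbitrarily small norm, hence
     so has multiplication by t(x) on the values of c, and the comparison of
     seminorms shows that it is 0.  Then c vanishes on J too; once the order has
     come down to 1 this says J = 0, that is, I is semisimple, which is (iii)'.

   For (i)', interpolation of the way-below relation between closed ideals
   yields a decreasing chain ... << I_1 << I_0, and the set of semisimple primes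
   containing no I_n is compact: an ideal maximal among those containing no I_n
   is closed and prime, because closed ideals are semiprime. *)

Require Import Defs.
From mathcomp Require Import all_boot all_algebra all_classical all_reals all_analysis.
From HB Require Import structures.
From mathcomp Require Import all_order fingroup perm finmap complex ring lra.

Set Implicit Arguments.
Unset Strict Implicit.
Unset Printing Implicit Defensive.

Import Order.TTheory GRing.Theory Num.Theory.
Import numFieldNormedType.Exports.

Local Open Scope classical_set_scope.
Local Open Scope ring_scope.
Local Open Scope complex_scope.

(** * Capelli polynomials *)

(** Semisimplicity meets one main obstacle. The comparison of seminorms needs the uniform bound
    [rho a <= k * rnorm a], whereas the renormings that make [x |-> a x b] small are equivalent to
    the norm with constants that blow up. So the renormed size enters only through an operator norm,
    on both sides of an inequality: the resulting seminorms stay below the original norm and share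
    one kernel. What gets small in them is the trace t(x), because t(x) v c(x') = c(x) v t(x') moves
    the operator onto the argument x', whose size is the one measured by the new weights.

    The Capelli identity of a semiprime ideal is built from scratch. Adjoining a central
    indeterminate turns a non-nilpotent element into a proper left ideal, hence into an irreducible
    module; density over a field of commuting endomorphisms then bounds the dimension of that module
    by the degree of the identity.

    Quasi-nilpotence starts from the invertibility of every 1 - l z. Instead of contour integrals,
    averages of resolvents over roots of -1 control the powers of z. *)

Lemma sum_perm_lift (V : nmodType) m (j0 : 'I_m.+1) (F : 'S_m.+1 -> V) :
  \sum_s F s = \sum_k \sum_(t : 'S_m) F (lift_perm j0 j0 t * tperm j0 k)%g.
Proof.
rewrite pair_big /=.
pose h (p : 'I_m.+1 * 'S_m) := (lift_perm j0 j0 p.2 * tperm j0 p.1)%g.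
have h_bij : bijective h.
  apply: inj_card_bij; last by rewrite card_prod card_ord !card_Sn factS.
  move=> [k t] [k' t'] /= e.
  have ek : k = k'.
    by have := congr1 (fun s : 'S_m.+1 => s j0) e; rewrite /h !permM !lift_perm_id !tpermL.
  subst k'.
  move: e => /mulIg e; congr (_, _); apply/permP => i.
  have := congr1 (fun s : 'S_m.+1 => s (lift j0 i)) e.
  by rewrite !lift_perm_lift => /lift_inj.
by rewrite (reindex h) //; exact: onW_bij.
Qed.

Definition two_ideal (U : nzRingType) (J : set U) : Prop :=
  [/\ J 0, forall x y, J x -> J y -> J (x + y),
      forall u x, J x -> J (u * x) & forall u x, J x -> J (x * u)].

Section Capelli.
Variable U : nzRingType.

(** No slot precedes the first [x]: each nonempty monomial ends in some [y i], so the values lie in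
    [J] as soon as the [y i] do. *)
Definition capelli m (x y : 'I_m -> U) : U :=
  \sum_(s : 'S_m) (-1) ^+ s * \prod_(i < m) (x (s i) * y i).

Definition upd m (x : 'I_m -> U) (i : 'I_m) (z : U) : 'I_m -> U :=
  fun k => if k == i then z else x k.

Lemma updE m (x : 'I_m -> U) i z k :
  upd x i z k = if k == i then z else x k.
Proof. by []. Qed.

Lemma upd_id m (x : 'I_m -> U) i : upd x i (x i) = x.
Proof. by apply/funext => k; rewrite updE; case: eqP => [->|]. Qed.

Lemma capelli_eq0 m (x y : 'I_m -> U) i j :
  i != j -> x i = x j -> capelli x y = 0.
Proof.
move=> ij xij; rewrite /capelli (bigID (fun s : 'S_m => odd_perm s)) /=.
rewrite [X in _ + X](reindex_inj (mulIg (tperm i j))) /=.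
rewrite [X in _ + X](eq_bigl (fun s : 'S_m => odd_perm s)); last first.
  by move=> s; rewrite odd_permM odd_tperm ij addbT negbK.
rewrite -big_split /=; apply: big1 => s os.
rewrite odd_permM odd_tperm ij os /= expr1 mulN1r expr0 mul1r.
apply/eqP; rewrite addrC subr_eq0; apply/eqP; apply: eq_bigr => k _.
by rewrite permM; case: tpermP => [->|->|//]; rewrite xij.
Qed.

Lemma capelli_upd_eq0 m (x y : 'I_m -> U) i k :
  k != i -> capelli (upd x i (x k)) y = 0.
Proof.
by move=> ki; apply: (@capelli_eq0 _ _ _ k i ki); rewrite !updE eqxx (negPf ki).
Qed.

Section Ideal.
Variables (J : set U) (J_ideal : two_ideal J).

Lemma idealMl u x : J x -> J (u * x). Proof. by have [_ _ + _] := J_ideal; apply. Qed.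
Lemma idealMr u x : J x -> J (x * u). Proof. by have [_ _ _] := J_ideal; apply. Qed.

Lemma ideal_sum (I : Type) (r : seq I) (P : pred I) (F : I -> U) :
  (forall i, P i -> J (F i)) -> J (\sum_(i <- r | P i) F i).
Proof. by have [J0 JD _ _] := J_ideal; move=> JF; apply: big_ind. Qed.

Lemma upd_ideal m (x : 'I_m -> U) i z :
  (forall k, J (x k)) -> J z -> forall k, J (upd x i z k).
Proof. by move=> Jx Jz k; rewrite updE; case: ifP. Qed.

(** [x i] fills exactly one slot of each monomial. The factor [b] starts with the [y] that follows
    it, hence lies in [J], as the exchange lemmas require. *)
Lemma mono_upd m (x y : 'I_m -> U) (i : 'I_m) (s : 'S_m) :
  (forall k, J (y k)) ->
  exists a b, J b /\
    forall z, \prod_(l < m) (upd x i z (s l) * y l) = a * z * b.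
Proof.
move=> Jy; pose j := (s^-1)%g i; have sj : s j = i by rewrite permKV.
have jr : j \in index_enum 'I_m by rewrite mem_index_enum.
have ur : uniq (index_enum 'I_m) by rewrite index_enum_uniq.
case/splitPr: jr ur => r1 r2; rewrite cat_uniq /= => /and4P[_ + jr2 _].
rewrite negb_or => /andP[jr1 _].
have nj r z : j \notin r ->
    \prod_(l <- r) (upd x i z (s l) * y l) = \prod_(l <- r) (x (s l) * y l).
  move=> jr; rewrite big_seq [RHS]big_seq; apply: eq_bigr => l lr.
  rewrite updE -sj (inj_eq perm_inj); case: eqP => // lj.
  by rewrite lj in lr; rewrite lr in jr.
exists (\prod_(l <- r1) (x (s l) * y l)).
exists (y j * \prod_(l <- r2) (x (s l) * y l)); split; first exact: idealMr.
move=> z; rewrite big_cat big_cons /= !nj //.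
by rewrite updE sj eqxx !mulrA.
Qed.

Definition capelli_identity m :=
  forall x y : 'I_m -> U,
    (forall i, J (x i)) -> (forall i, J (y i)) -> capelli x y = 0.

Lemma capelli_ideal m (x y : 'I_m.+1 -> U) :
  (forall i, J (y i)) -> J (capelli x y).
Proof.
move=> Jy; apply: ideal_sum => s _; apply: idealMl.
by rewrite big_ord_recr /=; apply/idealMl/idealMl.
Qed.

Let snoc m (x : 'I_m -> U) (z : U) (k : 'I_m.+1) :=
  if unlift ord_max k is Some j then x j else z.
Let consf m (x : 'I_m -> U) (z : U) (k : 'I_m.+1) :=
  if unlift ord0 k is Some j then x j else z.

(* The alternating sum over [S_(m+2)] of the identity of order m+2, grouped by
   the variable that occupies the last slot. *)
Lemma capelli_exchange_right m (x y : 'I_m.+1 -> U) z h h' :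
  capelli_identity m.+2 ->
  (forall i, J (x i)) -> (forall i, J (y i)) -> J z -> J h' ->
  capelli x y * h * z * h' = \sum_i capelli (upd x i z) y * h * x i * h'.
Proof.
move=> C Jx Jy Jz Jh'.
pose X := snoc x z.
(* [h] is absorbed into the last [y], so it may be any element of [U]: the product stays in [J]. *)
pose y' k := if k == ord_max then y k * h else y k.
pose Y := snoc y' h'.
have Xm : X ord_max = z by rewrite /X /snoc unlift_none.
have Xl j : X (lift ord_max j) = x j by rewrite /X /snoc liftK.
have Ym : Y ord_max = h' by rewrite /Y /snoc unlift_none.
have Yl j : Y (lift ord_max j) = y' j by rewrite /Y /snoc liftK.
have wl n (j : 'I_n) : widen_ord (leqnSn n) j = lift ord_max j.
  by apply: val_inj; rewrite [RHS]lift_max.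
have prodY (F : 'I_m.+1 -> U) :
    \prod_(i < m.+1) (F i * y' i) = (\prod_(i < m.+1) (F i * y i)) * h.
  rewrite big_ord_recr [in RHS]big_ord_recr /= /y' eqxx !mulrA.
  congr (_ * _ * _ * _); apply: eq_bigr => i _.
  by rewrite wl eq_sym (negPf (neq_lift _ _)).
have : capelli X Y = 0.
  apply: C => i; rewrite /X /Y /snoc; case: unliftP => // j _.
  by rewrite /y'; case: ifP => _ //; exact: idealMr.
rewrite /capelli (sum_perm_lift ord_max) big_ord_recr /= => /eqP.
rewrite addr_eq0 => /eqP E.
have T1 (k : 'I_m.+2) : \sum_(t : 'S_m.+1) (-1) ^+ (lift_perm ord_max ord_max t * tperm ord_max k)%g *
      \prod_(i < m.+2) (X ((lift_perm ord_max ord_max t * tperm ord_max k)%g i) * Y i) =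
    \sum_(t : 'S_m.+1) (-1) ^+ (t (+) (k != ord_max))  *
      (\prod_(i < m.+1) (X (tperm ord_max k (lift ord_max (t i))) * y i) * h * X k * h').
  apply: eq_bigr => t _; rewrite odd_permM odd_lift_perm !addbb addFb odd_tperm eq_sym.
  congr (_ * _); rewrite big_ord_recr /= permM lift_perm_id tpermL Ym !mulrA.
  congr (_ * _ * _); rewrite -prodY; apply: eq_bigr => i _.
  by rewrite wl permM lift_perm_lift Yl.
rewrite T1 eqxx /= tperm1 Xm in E.
have -> : capelli x y * h * z * h' = - \sum_(k < m.+1)
   \sum_(t : 'S_m.+1)
   (-1) ^+ (lift_perm ord_max ord_max t *
            tperm ord_max (widen_ord (leqnSn m.+1) k))%g *
   \prod_(i < m.+2)
      (X
         ((lift_perm ord_max ord_max t *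
           tperm ord_max (widen_ord (leqnSn m.+1) k))%g i) *
       Y i).
  rewrite E opprK /capelli !mulr_suml; apply: eq_bigr => t _.
  rewrite addbF !mulrA; congr (_ * _ * _ * _ * _).
  by apply: eq_bigr => i _; rewrite perm1 Xl.
rewrite -sumrN; apply: eq_bigr => k _; rewrite T1 wl eq_sym neq_lift Xl.
rewrite -sumrN /capelli !mulr_suml; apply: eq_bigr => t _.
rewrite addbT signrN mulNr opprK !mulrA; congr (_ * _ * _ * _ * _).
apply: eq_bigr => i _; congr (_ * _); rewrite updE.
have [->|tk] := eqVneq (t i) k; first by rewrite tpermR Xm.
by rewrite tpermD ?Xl // ?neq_lift // (inj_eq lift_inj) eq_sym.
Qed.

(** Mirror image of the exchange on the right, grouping permutations by the variable in the first
    slot. Here [h] is a slot of its own and so has to lie in [J]. *)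
Lemma capelli_exchange_left m (x y : 'I_m -> U) z h :
  capelli_identity m.+1 ->
  (forall i, J (x i)) -> (forall i, J (y i)) -> J z -> J h ->
  z * h * capelli x y = \sum_i x i * h * capelli (upd x i z) y.
Proof.
move=> C Jx Jy Jz Jh.
pose X := consf x z; pose Y := consf y h.
have X0 : X ord0 = z by rewrite /X /consf unlift_none.
have Xl j : X (lift ord0 j) = x j by rewrite /X /consf liftK.
have Y0 : Y ord0 = h by rewrite /Y /consf unlift_none.
have Yl j : Y (lift ord0 j) = y j by rewrite /Y /consf liftK.
have : capelli X Y = 0.
  by apply: C => i; rewrite /X /Y /consf; case: unliftP.
have T1 (k : 'I_m.+1) : \sum_(t : 'S_m) (-1) ^+ (lift_perm ord0 ord0 t * tperm ord0 k)%g *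
      \prod_(i < m.+1) (X ((lift_perm ord0 ord0 t * tperm ord0 k)%g i) * Y i) =
    \sum_(t : 'S_m) (-1) ^+ (t (+) (k != ord0))  *
      (X k * h * \prod_(i < m) (X (tperm ord0 k (lift ord0 (t i))) * y i)).
  apply: eq_bigr => t _; rewrite odd_permM odd_lift_perm !addbb addFb odd_tperm eq_sym.
  congr (_ * _); rewrite big_ord_recl /= permM lift_perm_id tpermL Y0 -?mulrA; congr (_ * (_ * _)).
  apply: eq_bigr => i _.
  by rewrite permM lift_perm_lift Yl.
rewrite /capelli (sum_perm_lift ord0) big_ord_recl T1 eqxx /= tperm1 X0.
move/eqP; rewrite addr_eq0 => /eqP E.
transitivity (\sum_(t : 'S_m)
      (-1) ^+ (t (+) false) * (z * h * (\prod_i (X ((1 : 'S_m.+1)%g (lift ord0 (t i))) * y i)))).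
  rewrite mulr_sumr; apply: eq_bigr => t _.
  rewrite addbF mulrA (commr_sign (z * h) t) -[LHS]mulrA; congr (_ * (_ * _)).
  by apply: eq_bigr => i _; rewrite perm1 Xl.
rewrite E -sumrN; apply: eq_bigr => k _; rewrite T1 Xl.
rewrite -sumrN mulr_sumr; apply: eq_bigr => t _.
rewrite eq_sym neq_lift addbT signrN mulNr opprK [RHS]mulrA.
rewrite (commr_sign (x k * h) t) -[RHS]mulrA; congr (_ * (_ * _)).
apply: eq_bigr => i _; congr (_ * _); rewrite updE.
have [->|tk] := eqVneq (t i) k; first by rewrite tpermR X0.
by rewrite tpermD ?Xl // ?neq_lift // (inj_eq lift_inj) eq_sym.
Qed.

End Ideal.
End Capelli.

(** * Lowering the order of a Capelli identity *)

Section CapelliDescent.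
Variables (U : nzRingType) (J : set U) (J_ideal : two_ideal J).

Lemma capelli_upd_sum m (x y : 'I_m -> U) i (I : Type) (r : seq I) (F : I -> U) :
  (forall k, J (y k)) ->
  capelli (upd x i (\sum_(j <- r) F j)) y =
  \sum_(j <- r) capelli (upd x i (F j)) y.
Proof.
move=> Jy; rewrite [RHS]exchange_big /=; apply: eq_bigr => s _.
have [p [q [_ pq]]] := mono_upd J_ideal x i s Jy.
under [RHS]eq_bigr => j _ do rewrite pq.
by rewrite pq mulr_sumr mulr_suml mulr_sumr.
Qed.

(** For an alternating form of top degree, applying a linear operator to each argument in turn and
    adding up multiplies the form by the trace of the operator; here the operator is
    [z |-> a * z * b]. *)
Definition capelli_trace m (x y : 'I_m -> U) (a b : U) : U :=
  \sum_i capelli (upd x i (a * x i * b)) y.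

(** Both sides equal the double sum over [i], [k] in which [x' k] replaces [x i] and [a * x i * b]
    replaces [x' k]: one side by exchange on the left, the other by exchange on the right. *)
Lemma capelli_traceC m (x x' y : 'I_m.+1 -> U) (a b v : U) :
  capelli_identity J m.+2 ->
  (forall i, J (x i)) -> (forall i, J (x' i)) -> (forall i, J (y i)) ->
  capelli_trace x y a b * v * capelli x' y =
  capelli x y * v * capelli_trace x' y a b.
Proof.
move=> C Jx Jx' Jy.
have Jaxb z : J z -> J (a * z * b).
  by move=> Jz; apply/(idealMr J_ideal)/(idealMl J_ideal).
transitivity (\sum_i \sum_k
    capelli (upd x i (x' k)) y * v * capelli (upd x' k (a * x i * b)) y).
- rewrite /capelli_trace !mulr_suml; apply: eq_bigr => i _.
  under [RHS]eq_bigr => k _ do rewrite /capelli !mulr_suml.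
  rewrite exchange_big /= {1}/capelli !mulr_suml; apply: eq_bigr => s _.
  have [p [q [Jq pq]]] := mono_upd J_ideal x i s Jy.
  rewrite pq; under [RHS]eq_bigr => k _ do rewrite pq -!mulrA.
  have -> : (-1) ^+ s * (p * (a * x i * b) * q) * v * capelli x' y =
      (-1) ^+ s * (p * ((a * x i * b) * (q * v) * capelli x' y)).
    by rewrite !mulrA.
  rewrite (capelli_exchange_left C) //; first last.
  + exact: (idealMr J_ideal).
  + exact: Jaxb.
  + by rewrite !mulr_sumr; apply: eq_bigr => k _; rewrite -!mulrA.
- rewrite exchange_big /= /capelli_trace mulr_sumr; apply: eq_bigr => k _.
  have D w z : w * v * capelli (upd x' k z) y = \sum_(s : 'S_m.+1)
      w * v * ((-1) ^+ s * \prod_(l < m.+1) (upd x' k z (s l) * y l)).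
    by rewrite /capelli mulr_sumr.
  under eq_bigr => i _ do rewrite D.
  rewrite D exchange_big /=; apply: eq_bigr => s _.
  have [p [q [Jq pq]]] := mono_upd J_ideal x' k s Jy.
  rewrite pq; under eq_bigr => i _ do rewrite pq.
  have E w z : w * v * ((-1) ^+ s * (p * (a * z * b) * q)) =
     (-1) ^+ s * (w * (v * p * a) * z * (b * q)).
    by rewrite !mulrA commr_sign -!mulrA.
  under eq_bigr => i _ do rewrite E.
  rewrite E (capelli_exchange_right J_ideal _ C) //; last exact: (idealMl J_ideal).
  by rewrite mulr_sumr.
Qed.

Hypothesis J_semiprime : forall e, J e -> (forall u, e * u * e = 0) -> e = 0.

(** The trace hypothesis kills every [capelli (upd x i (b * c)) y * v * c]. Exchanging [b * c] with
    the entries of [x] turns this into [c * u * b * c * v * c = 0] for [b], [v] in [J], and three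
    uses of semiprimeness give [c = 0]. *)
Lemma capelli_descent m :
  capelli_identity J m.+2 ->
  (forall (x x' y : 'I_m.+1 -> U) (a b v : U),
     (forall i, J (x i)) -> (forall i, J (x' i)) -> (forall i, J (y i)) ->
     J a -> capelli_trace x y a b * v * capelli x' y = 0) ->
  capelli_identity J m.+1.
Proof.
move=> C Z x y Jx Jy; set c := capelli x y.
have Jc : J c by exact: (capelli_ideal J_ideal).
(* [z |-> b * capelli (x with x_i := z)] is a sum of maps [z |-> p z q], and
   it kills every [x k] with [k != i]. *)
have Kc i (b v : U) : J b ->
    capelli (upd x i (b * c)) y * v * c = 0.
  move=> Jb.
  have -> : capelli (upd x i (b * c)) y =
      \sum_k capelli (upd x k (b * capelli (upd x i (x k)) y)) y.
    rewrite (bigD1 i) //= upd_id big1 ?addr0 // => k ki.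
    rewrite capelli_upd_eq0 // mulr0.
    apply: big1 => s _; have [p [q [_ ->]]] := mono_upd J_ideal x k s Jy.
    by rewrite mulr0 mul0r mulr0.
  have E (s : 'S_m.+1) : exists p q, J p /\ forall z,
      b * ((-1) ^+ s * \prod_(l < m.+1) (upd x i z (s l) * y l)) = p * z * q.
    have [p [q [_ pq]]] := mono_upd J_ideal x i s Jy.
    exists (b * ((-1) ^+ s * p)), q.
    by split=> [|z]; [exact: (idealMr J_ideal) | rewrite pq !mulrA].
  have -> : \sum_k capelli (upd x k (b * capelli (upd x i (x k)) y)) y =
      \sum_(s : 'S_m.+1) \sum_k capelli (upd x k
         (b * ((-1) ^+ s * \prod_(l < m.+1) (upd x i (x k) (s l) * y l)))) y.
    rewrite [RHS]exchange_big /=; apply: eq_bigr => k _.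
    by rewrite -capelli_upd_sum // -mulr_sumr.
  rewrite !mulr_suml; apply: big1 => s _.
  have [p [q [Jp pq]]] := E s.
  by under eq_bigr => k _ do rewrite pq; exact: Z.
have cubc u b v : J b -> J v -> c * u * b * c * v * c = 0.
  move=> Jb Jv.
  have -> : c * u * b * c * v * c = c * u * (b * c) * v * c by rewrite !mulrA.
  rewrite (capelli_exchange_right J_ideal _ C) //; last exact: (idealMl J_ideal).
  rewrite mulr_suml; apply: big1 => i _.
  by rewrite -(mulrA _ u) -(mulrA _ _ v); apply: Kc.
have Jc0 j : J j -> j * c = 0.
  move=> Jj; have Jjc : J (j * c) by exact: (idealMl J_ideal).
  apply: J_semiprime => // u; apply: J_semiprime.
    exact: (idealMl J_ideal).
  move=> u'.
  have -> : j * c * u * (j * c) * u' * (j * c * u * (j * c)) =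
     j * (c * u * j * c * (u' * j) * c) * u * j * c by rewrite !mulrA.
  by rewrite cubc ?mulr0 ?mul0r //; exact: (idealMl J_ideal).
by apply: J_semiprime => // u; apply: Jc0; apply: (idealMr J_ideal).
Qed.

Lemma capelli_identity1 : capelli_identity J 1 -> forall x, J x -> x = 0.
Proof.
move=> C x Jx; apply: J_semiprime => // u.
have := C (fun=> x) (fun=> u * x) (fun=> Jx) (fun=> idealMl J_ideal u Jx).
rewrite /capelli (big_pred1 1%g) => [|s]; last first.
  by apply/esym/eqP/permP => i; rewrite !ord1.
by rewrite odd_perm1 mul1r big_ord1 mulrA.
Qed.

End CapelliDescent.

(** * Multilinear identities and nil ideals *)

#[local] Arguments iota : simpl never.

Lemma iota_rcons d : iota 0 d.+1 = rcons (iota 0 d) d.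
Proof. by rewrite -cats1 -addn1 iotaD. Qed.

Lemma perm_iota_last d w :
  perm_eq w (iota 0 d.+1) -> last 0%N w = d ->
  exists2 w', w = rcons w' d & perm_eq w' (iota 0 d).
Proof.
move=> pw; case/lastP: w pw => [|w' i] pw.
  by have := perm_size pw; rewrite size_iota.
rewrite last_rcons => id; subst i; exists w' => //.
by move: pw; rewrite iota_rcons -!cats1 perm_cat2r.
Qed.

Lemma perm_iota_nlast d w :
  perm_eq w (iota 0 d.+1) -> last 0%N w != d ->
  exists w1 i w2, [/\ w = w1 ++ [:: d, i & w2], (i < d)%N & d \notin w1].
Proof.
move=> pw; have dw : d \in w by rewrite (perm_mem pw) mem_iota /= ltnS.
have uw : uniq w by rewrite (perm_uniq pw) iota_uniq.
case/splitPr: dw uw pw => w1 [|i w2]; first by rewrite last_cat /= eqxx.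
rewrite cat_uniq /= => /and4P[_ dw1 diw2 _] pw _; exists w1, i, w2; split=> //.
  have : i \in iota 0 d.+1 by rewrite -(perm_mem pw) mem_cat !inE eqxx !orbT.
  rewrite mem_iota /= add0n ltnS leq_eqVlt => /orP[/eqP id|//].
  by rewrite id inE eqxx in diw2.
by move: dw1; rewrite negb_or => /andP[].
Qed.

Lemma sum_permutations_last (V : nmodType) d (F : seq nat -> V) :
  \sum_(w <- permutations (iota 0 d.+1)) F w =
  \sum_(w <- permutations (iota 0 d)) F (rcons w d) +
  \sum_(w <- permutations (iota 0 d.+1) | last 0%N w != d) F w.
Proof.
rewrite (bigID (fun w => last 0%N w == d)); congr (_ + _).
rewrite -big_filter -(big_map (fun w => rcons w d) xpredT).
apply: perm_big; apply: uniq_perm.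
- by rewrite filter_uniq ?permutations_uniq.
- by rewrite map_inj_uniq ?permutations_uniq // => w w' /rcons_inj[].
move=> w; rewrite mem_filter mem_permutations.
apply/andP/mapP => [[/eqP lw pw]|[w' + ->]].
  by have [w' -> pw'] := perm_iota_last pw lw; exists w'; rewrite ?mem_permutations.
by rewrite mem_permutations last_rcons eqxx iota_rcons -!cats1 perm_cat2r.
Qed.

Section MultilinearIdentity.
Variables (K : fieldType) (U : algType K).

Definition ml_eval (f : seq nat -> K) d (x : nat -> U) : U :=
  \sum_(w <- permutations (iota 0 d)) f w *: \prod_(i <- w) x i.

Definition ml_identity (J : set U) (f : seq nat -> K) d : Prop :=
  f (iota 0 d) != 0 /\ forall x, (forall i, J (x i)) -> ml_eval f d x = 0.

Variables (J : set U) (J_ideal : two_ideal J).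
Hypothesis J_semiprime : forall e, J e -> (forall u, e * u * e = 0) -> e = 0.

(* If [b ^+ k] is the first power of [b] killing [rho] on the left, then
   [a := b ^+ k.-1] satisfies [a * a * rho = 0], and substituting [a] for the
   last variable lowers the degree of the identity on the right ideal
   [a * rho]. *)
Lemma nil_right_ideal d (f : seq nat -> K) (rho : set U) :
  f (iota 0 d) != 0 ->
  rho `<=` J -> (forall x u, rho x -> rho (x * u)) ->
  (forall x, rho x -> exists n, x ^+ n = 0) ->
  (forall x z, (forall i, rho (x i)) -> rho z -> ml_eval f d x * z = 0) ->
  forall x, rho x -> x = 0.
Proof.
elim: d f rho => [|d IH] f rho f_neq0 rhoJ rhoM rho_nil rho_id x rx.
  have := rho_id (fun=> x) x (fun=> rx) rx.
  rewrite /ml_eval /= big_seq1 big_nil -scalerAl mul1r => /eqP.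
  by rewrite scaler_eq0 (negPf f_neq0) => /eqP.
apply: contrapT => x_neq0.
have [b [z0 [rb rz0 bz0]]] : exists b z0, [/\ rho b, rho z0 & b * z0 != 0].
  apply: contrapT => h; apply: x_neq0; apply: J_semiprime; first exact: rhoJ.
  move=> u; apply/eqP; apply: contrapT => /negP n0; apply: h.
  by exists (x * u), x; split=> //; exact: rhoM.
pose kills k := `[< forall z, rho z -> b ^+ k * z = 0 >].
have ex_k : exists k, kills k.
  have [n bn] := rho_nil _ rb; exists n; apply/asboolP => z _.
  by rewrite bn mul0r.
case: (ex_minnP ex_k) => k /asboolP kk k_min.
have k2 : (1 < k)%N.
  case: k kk {k_min} => [|[|//]] kk; case/eqP: bz0.
    by rewrite -[z0]mul1r (kk z0) ?mulr0.
  by have := kk z0 rz0; rewrite expr1.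
pose a := b ^+ k.-1.
have ra : rho a.
  have -> : a = b * b ^+ k.-2 by rewrite -exprS /a; case: (k) k2 => [|[]].
  exact: rhoM.
have aaz z : rho z -> a * a * z = 0.
  move=> rz; rewrite -exprD.
  have -> : (k.-1 + k.-1 = k.-2 + k)%N by case: (k) k2 => [|[]] //= n; rewrite addSnnS.
  by rewrite exprD -mulrA kk ?mulr0.
have [z1 rz1 az1] : exists2 z1, rho z1 & a * z1 != 0.
  apply: contrapT => h.
  have : kills k.-1.
    apply/asboolP => z rz; apply/eqP; apply: contrapT => /negP n0; apply: h.
    by exists z.
  by move/k_min; rewrite leqNgt prednK ?leqnn // ltnW.
case/eqP: az1; pose rho' := [set a * z | z in rho].
apply: (IH (fun w => f (rcons w d)) rho'); rewrite -?iota_rcons //.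
- by move=> _ [z rz <-]; apply/rhoJ/rhoM.
- by move=> _ u [z rz <-]; exists (z * u); [exact: rhoM | rewrite mulrA].
- by move=> _ [z rz <-]; apply: rho_nil; exact: rhoM.
- move=> y _ ry' [z rz <-].
  (* The last variable becomes [a]. In words ending in [d] it merges with the trailing factor into
     [a * z], an element of [rho']; this is why the hypothesis carries a factor on the right. *)
  pose y' i := if (i < d)%N then y i else a.
  have ry i : rho (y' i).
    rewrite /y'; case: ifP => // _.
    by have [z' rz' <-] := ry' i; exact: rhoM.
  rewrite -[RHS](rho_id y' z ry rz) /ml_eval sum_permutations_last mulrDl.
  rewrite [X in _ = _ + X]mulr_suml [X in _ = _ + X]big1_seq => [|w /andP[lw]].
    rewrite addr0 !mulr_suml big_seq [RHS]big_seq; apply: eq_bigr => w.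
    rewrite mem_permutations => /perm_mem pw.
    rewrite -!scalerAl; congr (_ *: _).
    rewrite -cats1 big_cat big_seq1 /= {2}/y' ltnn -mulrA; congr (_ * _).
    rewrite big_seq [RHS]big_seq; apply: eq_bigr => i iw.
    by move: iw; rewrite pw mem_iota /= add0n /y' => ->.
  rewrite mem_permutations => pw.
  (* In all other words [d] is followed by some [i < d], and [y i = a * r] creates the factor
     [a * a * r = 0]. *)
  have [w1 [i [w2 [-> ltid _]]]] := perm_iota_nlast pw lw.
  have [r rr yi] := ry' i.
  rewrite big_cat !big_cons /= /y' ltnn ltid -yi (mulrA a) (mulrA a) aaz //.
  by rewrite mul0r mulr0 scaler0 mul0r.
- by exists z1.
Qed.

Lemma nil_ideal_eq0 d f (N : set U) : ml_identity J f d ->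
  N `<=` J -> (forall x u, N x -> N (x * u)) ->
  (forall x, N x -> exists n, x ^+ n = 0) -> forall x, N x -> x = 0.
Proof.
move=> [f_neq0 fJ] NJ NM N_nil x Nx.
apply: (nil_right_ideal f_neq0 NJ NM N_nil _ Nx) => y z Ny _.
by rewrite fJ ?mul0r // => i; apply: NJ.
Qed.

End MultilinearIdentity.

(** * Maximal left ideals and quotient modules *)

Lemma Zorn_above (T : Type) (P : set (set T)) (L : set T) :
  P L ->
  (forall F : set (set T), F `<=` P -> F !=set0 -> total_on F subset ->
     P (\bigcup_(X in F) X)) ->
  exists M, [/\ P M, L `<=` M & forall B, M `<=` B -> P B -> B `<=` M].
Proof.
(* [set0] is adjoined to serve as the union of the empty chain. *)
move=> PL PF; pose Q X := X = set0 \/ (P X /\ L `<=` X).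
have [|A [QA Amax]] := @Zorn_bigcup T Q.
  move=> F FQ Ftot; pose G := F `&` [set X | X !=set0].
  have -> : \bigcup_(X in F) X = \bigcup_(X in G) X.
    apply/seteqP; split=> x [X]; last by case; exists X.
    by move=> FX Xx; exists X => //; split=> //; exists x.
  have [[X GX]|/forallNP G0] := pselect (G !=set0); last first.
    by left; rewrite -subset0 => x [X /G0].
  have GP Y : G Y -> P Y /\ L `<=` Y.
    by move=> [/FQ[->|//] [y]].
  right; split; last by move=> x Lx; exists X => //; exact: (GP _ GX).2.
  apply: PF; [by move=> Y /GP[]|by exists X|].
  by move=> Y Z [FY _] [FZ _]; exact: Ftot.
have [PA LA] : P A /\ L `<=` A.
  case: QA => // A0; have [L0|Ln] := eqVneq L set0.
    by rewrite A0 -L0; split.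
  exfalso; apply: (Amax L); last by right; split.
  by rewrite A0; split => // L0; case/eqP: Ln; rewrite -subset0.
exists A; split=> // B AB PB; apply: contrapT => BA; apply: (Amax B) => //.
by right; split=> //; apply: subset_trans AB.
Qed.

Definition left_ideal (B : nzRingType) (L : set B) : Prop :=
  [/\ L 0, forall x y, L x -> L y -> L (x + y) & forall a x, L x -> L (a * x)].

Definition maximal_left_ideal (B : nzRingType) (M : set B) : Prop :=
  [/\ left_ideal M, ~ M 1 &
      forall X, left_ideal X -> M `<=` X -> X `<=` M \/ X = setT].

Lemma ex_maximal_left_ideal (B : nzRingType) (L : set B) :
  left_ideal L -> ~ L 1 -> exists2 M, maximal_left_ideal M & L `<=` M.
Proof.
move=> Lid L1.
have [||M [[Mid M1] LM Mmax]] := @Zorn_above B (fun X => left_ideal X /\ ~ X 1) L.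
- by [].
- move=> F FP [X0 FX0] Ftot; split; last by move=> [X /FP[_]].
  split.
  + by exists X0 => //; have [[]] := FP _ FX0.
  + move=> x y [X FX Xx] [Y FY Yy].
    have [XY|YX] := Ftot _ _ FX FY.
      by exists Y => //; have [[_ + _] _] := FP _ FY; apply=> //; exact: XY.
    by exists X => //; have [[_ + _] _] := FP _ FX; apply=> //; exact: YX.
  + by move=> a x [X FX Xx]; exists X => //; have [[_ _ +] _] := FP _ FX; apply.
exists M => //; split=> // X Xid MX.
have [X1|X1] := pselect (X 1); last by left; exact: Mmax.
right; apply/seteqP; split=> // x _; rewrite -[x]mulr1.
by have [_ _] := Xid; apply.
Qed.

Record submodule (R : nzRingType) (V : lmodType R) := Submodule {
  submodule_set :> V -> Prop;
  submodule0 : submodule_set 0;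
  submoduleD : forall x y,
    submodule_set x -> submodule_set y -> submodule_set (x + y);
  submoduleZ : forall a x, submodule_set x -> submodule_set (a *: x) }.

Section Quotient.
Variables (R : nzRingType) (V : lmodType R) (W : submodule V).

Lemma submoduleN x : W x -> W (- x).
Proof. by move=> Wx; rewrite -scaleN1r; exact: submoduleZ. Qed.

Definition quot_rel (x y : V) : bool := `[< W (x - y) >].

Lemma quot_relP x y : reflect (W (x - y)) (quot_rel x y).
Proof. exact: asboolP. Qed.

Lemma quot_rel_refl : reflexive quot_rel.
Proof. by move=> x; apply/quot_relP; rewrite subrr; exact: submodule0. Qed.

Lemma quot_rel_sym : symmetric quot_rel.
Proof.
by move=> x y; apply/quot_relP/quot_relP => /submoduleN; rewrite opprB.
Qed.

Lemma quot_rel_trans : transitive quot_rel.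
Proof.
move=> y x z /quot_relP xy /quot_relP yz; apply/quot_relP.
by rewrite -(subrK y x) -addrA; exact: submoduleD.
Qed.

Canonical quot_equiv := EquivRel quot_rel quot_rel_refl quot_rel_sym quot_rel_trans.

Definition quot := {eq_quot quot_equiv}%qT.

HB.instance Definition _ := Choice.on quot.

Definition qproj (x : V) : quot := (\pi_({eq_quot quot_equiv}%qT) x)%qT.
Definition qrepr (x : quot) : V := generic_quotient.repr (x : {eq_quot quot_equiv}%qT).

Lemma qreprK x : qproj (qrepr x) = x. Proof. exact: reprK. Qed.

Lemma qprojP x y : qproj x = qproj y <-> W (x - y).
Proof.
split; last by move=> xy; apply/eqmodP/quot_relP.
by move=> /eqmodP/quot_relP.
Qed.

Lemma qprojK x : W (qrepr (qproj x) - x).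
Proof. by apply/qprojP; rewrite qreprK. Qed.

Lemma qproj_eq0 x : qproj x = qproj 0 <-> W x.
Proof. by rewrite qprojP subr0. Qed.

Let qadd (x y : quot) := qproj (qrepr x + qrepr y).
Let qopp (x : quot) := qproj (- qrepr x).
Let qscale a (x : quot) := qproj (a *: qrepr x).

Let qaddE x y : qadd (qproj x) (qproj y) = qproj (x + y).
Proof.
by apply/qprojP; rewrite opprD addrACA; apply: submoduleD; exact: qprojK.
Qed.

Let qoppE x : qopp (qproj x) = qproj (- x).
Proof. by apply/qprojP; rewrite -opprD; apply: submoduleN; exact: qprojK. Qed.

Let qscaleE a x : qscale a (qproj x) = qproj (a *: x).
Proof. by apply/qprojP; rewrite -scalerBr; apply: submoduleZ; exact: qprojK. Qed.

Let quotP (P : quot -> Prop) : (forall x, P (qproj x)) -> forall x, P x.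
Proof. by move=> H x; rewrite -(qreprK x). Qed.

Let qaddA : associative qadd.
Proof. by do 3!elim/quotP => ?; rewrite !qaddE addrA. Qed.
Let qaddC : commutative qadd.
Proof. by do 2!elim/quotP => ?; rewrite !qaddE addrC. Qed.
Let qadd0 : left_id (qproj 0) qadd.
Proof. by elim/quotP => ?; rewrite !qaddE add0r. Qed.
Let qaddN : left_inverse (qproj 0) qopp qadd.
Proof. by elim/quotP => ?; rewrite qoppE !qaddE addNr. Qed.

HB.instance Definition _ := GRing.isZmodule.Build quot qaddA qaddC qadd0 qaddN.

Let qscaleA a b x : qscale a (qscale b x) = qscale (a * b) x.
Proof. by elim/quotP: x => ?; rewrite !qscaleE scalerA. Qed.
Let qscale1 : left_id 1 qscale.
Proof. by elim/quotP => ?; rewrite !qscaleE scale1r. Qed.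
Let qscaleDr : right_distributive qscale +%R.
Proof.
by move=> a; do 2!elim/quotP => ?; rewrite [_ + _]qaddE !qscaleE [RHS]qaddE scalerDr.
Qed.
Let qscaleDl x : {morph qscale^~ x : a b / a + b}.
Proof. by elim/quotP: x => ? a b; rewrite !qscaleE [RHS]qaddE scalerDl. Qed.

HB.instance Definition _ := GRing.Zmodule_isLmodule.Build R quot
  qscaleA qscale1 qscaleDr qscaleDl.

Lemma qproj_is_linear : linear qproj.
Proof. by move=> a x y; rewrite -qaddE -qscaleE. Qed.

HB.instance Definition _ := GRing.isLinear.Build R V quot *:%R qproj qproj_is_linear.

Lemma qprojZ a x : qproj (a *: x) = a *: qproj x.
Proof. exact: linearZ_LR. Qed.

Lemma qproj0P x : qproj x = 0 <-> W x.
Proof. by rewrite -(linear0 qproj) qproj_eq0. Qed.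

Lemma quotW (P : quot -> Prop) : (forall x, P (qproj x)) -> forall x, P x.
Proof. exact: quotP. Qed.

End Quotient.

(** * Irreducible modules and density *)

Record endo_field (V : zmodType) := EndoField {
  ef_set :> (V -> V) -> Prop;
  ef_additive : forall f, ef_set f -> {morph f : x y / x + y};
  ef_comm : forall f g, ef_set f -> ef_set g -> forall v, f (g v) = g (f v);
  ef_zero : ef_set (fun=> 0);
  ef_one : ef_set id;
  ef_opp : forall f, ef_set f -> ef_set (fun v => - f v);
  ef_add : forall f g, ef_set f -> ef_set g -> ef_set (fun v => f v + g v);
  ef_mul : forall f g, ef_set f -> ef_set g -> ef_set (fun v => f (g v));
  ef_inv : forall f, ef_set f -> f <> (fun=> 0) ->
    exists2 g, ef_set g & forall v, g (f v) = v;
  ef_neq0 : exists v : V, v != 0 }.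

(** A copy of [V] on which [E] acts by scalars, kept apart from any module structure that [V]
    already has. *)
Definition ef_module (V : zmodType) (E : endo_field V) : Type := V.

Section EndoFieldType.
Variables (V : zmodType) (E : endo_field V).

Record ef_sort := EfSort { ef_fun : V -> V; ef_funP : E ef_fun }.

Lemma ef_ext (f g : ef_sort) : ef_fun f =1 ef_fun g -> f = g.
Proof.
case: f g => [f Ef] [g Eg] /= /funext fg; subst g.
by congr EfSort; exact: Prop_irrelevance.
Qed.

HB.instance Definition _ := gen_eqMixin ef_sort.
HB.instance Definition _ := gen_choiceMixin ef_sort.

Let zero := EfSort (ef_zero E).
Let one := EfSort (ef_one E).
Let opp (f : ef_sort) := EfSort (ef_opp (ef_funP f)).
Let add (f g : ef_sort) := EfSort (ef_add (ef_funP f) (ef_funP g)).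
Let mul (f g : ef_sort) := EfSort (ef_mul (ef_funP f) (ef_funP g)).

Let addA : associative add.
Proof. by move=> f g h; apply: ef_ext => v /=; rewrite addrA. Qed.
Let addC : commutative add.
Proof. by move=> f g; apply: ef_ext => v /=; rewrite addrC. Qed.
Let add0 : left_id zero add.
Proof. by move=> f; apply: ef_ext => v /=; rewrite add0r. Qed.
Let addN : left_inverse zero opp add.
Proof. by move=> f; apply: ef_ext => v /=; rewrite addNr. Qed.
HB.instance Definition _ := GRing.isZmodule.Build ef_sort addA addC add0 addN.

Let mulA : associative mul.
Proof. by move=> f g h; apply: ef_ext => v. Qed.
Let mulC : commutative mul.
Proof. by move=> f g; apply: ef_ext => v /=; exact: ef_comm (ef_funP f) (ef_funP g) v. Qed.
Let mul1 : left_id one mul.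
Proof. by move=> f; apply: ef_ext => v. Qed.
Let mulD : left_distributive mul add.
Proof. by move=> f g h; apply: ef_ext => v. Qed.
Let one_neq0 : one != zero.
Proof.
have [v v0] := ef_neq0 E; apply/eqP => e; case/eqP: v0.
exact: (congr1 (fun f => ef_fun f v) e).
Qed.
HB.instance Definition _ :=
  GRing.Zmodule_isComNzRing.Build ef_sort mulA mulC mul1 mulD one_neq0.

Let inv_ex (f : ef_sort) : exists g : ef_sort,
  (f != 0 -> g * f = 1) /\ (f = 0 -> g = 0).
Proof.
have [->|f0] := eqVneq f 0; first by exists 0.
have fn0 : ef_fun f <> (fun=> 0).
  by move=> e; case/eqP: f0; apply: ef_ext => v; rewrite e.
have [g Eg gf] := ef_inv (ef_funP f) fn0.
exists (EfSort Eg); split=> [_|f0']; first by apply: ef_ext => v; exact: gf.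
by rewrite f0' eqxx in f0.
Qed.

Let inv (f : ef_sort) := projT1 (cid (inv_ex f)).

Let mulV (f : ef_sort) : f != 0 -> inv f * f = 1.
Proof. by rewrite /inv; case: cid => g []. Qed.
Let inv0 : inv 0 = 0.
Proof. by rewrite /inv; case: cid => g [_ /=]; exact. Qed.
HB.instance Definition _ := GRing.ComNzRing_isField.Build ef_sort mulV inv0.

HB.instance Definition _ := GRing.Zmodule.on (ef_module E).

Let scale (f : ef_sort) (v : ef_module E) : ef_module E := ef_fun f v.
Let scaleA f g v : scale f (scale g v) = scale (f * g) v. Proof. by []. Qed.
Let scale1 : left_id 1 scale. Proof. by []. Qed.
Let scaleDr : right_distributive scale +%R.
Proof. by move=> f x y; exact: ef_additive (ef_funP f) x y. Qed.
Let scaleDl v : {morph scale^~ v : f g / f + g}. Proof. by []. Qed.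
HB.instance Definition _ := GRing.Zmodule_isLmodule.Build ef_sort (ef_module E)
  scaleA scale1 scaleDr scaleDl.

Lemma ef_scaleE (f : ef_sort) (v : ef_module E) : f *: v = ef_fun f v.
Proof. by []. Qed.

End EndoFieldType.

Section MaximalCommuting.
Variables (B : nzRingType) (V : lmodType B).

Definition blinear (f : V -> V) :=
  {morph f : x y / x + y} /\ forall a, {morph f : x / a *: x}.

Definition irreducible_module :=
  (exists v : V, v != 0) /\
  forall W : set V, W 0 -> (forall x y, W x -> W y -> W (x + y)) ->
    (forall (a : B) x, W x -> W (a *: x)) ->
    (forall x, W x -> x = 0) \/ forall x, W x.

Hypothesis irr : irreducible_module.

Lemma blinear0 f : blinear f -> f 0 = 0.
Proof. by move=> [_ fZ]; have := fZ 0 0; rewrite !scale0r. Qed.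

Lemma blinearN f v : blinear f -> f (- v) = - f v.
Proof. by move=> [_ fZ]; rewrite -scaleN1r fZ scaleN1r. Qed.

Lemma schur f : blinear f -> f <> (fun=> 0) ->
  exists2 g, blinear g & cancel f g /\ cancel g f.
Proof.
move=> fl fn0; have [fD fZ] := fl.
have finj x : f x = 0 -> x = 0.
  have [] := irr.2 [set x | f x = 0].
  - exact: blinear0.
  - by move=> a b /= fa fb; rewrite fD fa fb addr0.
  - by move=> a b /= fb; rewrite fZ fb scaler0.
  - by move=> h; exact: h.
  - by move=> h; case: fn0; apply/funext => x'; exact: h.
have fsurj y : exists x, f x = y.
  have [] := irr.2 [set y | exists x, f x = y].
  - by exists 0; exact: blinear0.
  - by move=> _ _ [x <-] [x' <-]; exists (x + x').
  - by move=> a _ [x <-]; exists (a *: x); rewrite fZ.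
  - by move=> h; case: fn0; apply/funext => x; apply: h; exists x.
  - exact.
have fI : injective f.
  move=> x x' e; apply/eqP; rewrite -subr_eq0; apply/eqP/finj.
  by rewrite fD blinearN // e subrr.
pose g y := projT1 (cid (fsurj y)).
have fg y : f (g y) = y by rewrite /g; case: cid.
exists g; last by split=> // x; apply: fI; rewrite fg.
split=> [x y|a x]; apply: fI; first by rewrite fD !fg.
by rewrite fZ !fg.
Qed.

(** The endomorphism ring is a division ring that may fail to commute, hence the passage to a
    maximal commuting subset. Maximality turns commuting with [E] into membership, which yields
    closure under the field operations, inverses coming from Schur's lemma. *)
Lemma ex_maximal_commuting : exists E : endo_field V,
  (forall f, E f -> blinear f) /\
  (forall f, blinear f -> (forall g, E g -> forall v, f (g v) = g (f v)) -> E f).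
Proof.
pose P (S : set (V -> V)) := (forall f, S f -> blinear f) /\
  forall f g, S f -> S g -> forall v, f (g v) = g (f v).
have [||S [[Sl Sc] _ Smax]] := @Zorn_above _ P set0.
- by split.
- move=> F FP _ Ftot; split=> [f [S /FP[Sl _]]|f g [S FS Sf] [T FT Tg]]; first exact: Sl.
  have [ST|TS] := Ftot _ _ FS FT.
    by have [_] := FP _ FT; apply=> //; exact: ST.
  by have [_] := FP _ FS; apply=> //; exact: TS.
have Sin f : blinear f -> (forall g, S g -> forall v, f (g v) = g (f v)) -> S f.
  move=> fl fc; apply: (Smax (S `|` [set f])); [by move=> ?; left| |by right].
  split=> [g [/Sl|->//]//|g h]; case=> [Sg|->]; case=> [Sh|->] v //.
  - exact: Sc Sg Sh v.
  - by rewrite fc.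
  - exact: fc.
unshelve eexists (@EndoField V S _ _ _ _ _ _ _ _ irr.1) => //.
- by move=> f /Sl[].
- apply: Sin => [|g /Sl/blinear0-> //]; split=> [x y|a x].
    by rewrite addr0.
  by rewrite scaler0.
- by apply: Sin => //; split.
- move=> f Sf; have [fD fZ] := Sl _ Sf; apply: Sin => [|g Sg v].
    by split=> [x y|a x]; rewrite ?fD ?opprD // fZ scalerN.
  by rewrite (Sc f g) // blinearN //; exact: Sl.
- move=> f g Sf Sg; have [fD fZ] := Sl _ Sf; have [gD gZ] := Sl _ Sg.
  apply: Sin => [|h Sh v].
    by split=> [x y|a x]; rewrite ?fD ?gD 1?addrACA // fZ gZ scalerDr.
  by rewrite (Sc f h) // (Sc g h) //; have [-> _] := Sl _ Sh.
- move=> f g Sf Sg; have [fD fZ] := Sl _ Sf; have [gD gZ] := Sl _ Sg.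
  apply: Sin => [|h Sh v]; last by rewrite (Sc g h) // (Sc f h).
  by split=> [x y|a x]; rewrite ?gD ?fD // gZ fZ.
- move=> f Sf fn0; have [g gl [fg gf]] := schur (Sl _ Sf) fn0.
  exists g => //; apply: Sin => // h Sh v.
  by rewrite -{1}(gf v) (Sc h f) // fg.
Qed.

End MaximalCommuting.

(** The input of the density theorem: [J] and the scalars together act irreducibly, and only scalars
    commute with both. [dr_scal] tells how the base field [K] acts, so that a nonzero coefficient of
    an identity remains nonzero over [dr_field]. *)
Record dense_rep (K : fieldType) (U : algType K) (J : set U) := DenseRep {
  dr_field : fieldType;
  dr_space : lmodType dr_field;
  dr_act : U -> dr_space -> dr_space;
  dr_scal : K -> dr_field;
  dr_actD : forall a, {morph dr_act a : v v' / v + v'};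
  dr_actZ : forall a (c : dr_field) v, dr_act a (c *: v) = c *: dr_act a v;
  dr_actDl : forall a b v, dr_act (a + b) v = dr_act a v + dr_act b v;
  dr_actM : forall a b v, dr_act (a * b) v = dr_act a (dr_act b v);
  dr_act1 : forall v, dr_act 1 v = v;
  dr_scalE : forall (c : K) a v, dr_act (c *: a) v = dr_scal c *: dr_act a v;
  dr_scal_neq0 : forall c, c != 0 -> dr_scal c != 0;
  dr_irr : forall W : set dr_space, W 0 ->
    (forall x y, W x -> W y -> W (x + y)) ->
    (forall (c : dr_field) x, W x -> W (c *: x)) ->
    (forall a x, J a -> W x -> W (dr_act a x)) ->
    (forall x, W x -> x = 0) \/ forall x, W x;
  dr_commutant : forall f : dr_space -> dr_space,
    {morph f : x y / x + y} ->
    (forall (c : dr_field) x, f (c *: x) = c *: f x) ->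
    (forall a x, J a -> f (dr_act a x) = dr_act a (f x)) ->
    exists c : dr_field, forall x, f x = c *: x }.

Section DenseRep.
Variables (K : fieldType) (U : algType K) (J : set U) (J_ideal : two_ideal J).

(* A maximal commuting set [E] of endomorphisms of an irreducible module is a
   field by Schur's lemma; once [E] is adjoined to the operators, the commutant
   is [E] itself, so that a density theorem holds over the field [E]. *)
Lemma poly_module_dense_rep (V : lmodType {poly U}) (w : U) :
  irreducible_module V -> J w -> (exists v : V, w%:P *: v != 0) ->
  exists D : dense_rep J, exists v : dr_space D, dr_act w v != 0.
Proof.
move=> irr Jw [v0 wv0].
have [E [El Ein]] := ex_maximal_commuting irr.
have central_lin (p : {poly U}) : (forall q, p * q = q * p) ->
    blinear (fun v : V => p *: v).
  move=> pC; split=> [x y|q x]; first by rewrite scalerDr.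
  by rewrite !scalerA pC.
have central_in (p : {poly U}) : (forall q, p * q = q * p) ->
    E (fun v : V => p *: v).
  move=> pC; apply: Ein; first exact: central_lin.
  by move=> g /El[_ gZ] v; rewrite gZ.
have XC i (q : {poly U}) : 'X^i * q = q * 'X^i by rewrite commr_polyXn.
have cC (c : K) (q : {poly U}) : (c%:A)%:P * q = q * (c%:A)%:P.
  by apply/polyP => i; rewrite coefCM coefMC -scalerAl mul1r -scalerAr mulr1.
have polyZ (p : {poly U}) (v : V) :
    p *: v = \sum_(i < size p) 'X^i *: ((p`_i)%:P *: v).
  rewrite -[in LHS](coefK p) poly_def scaler_suml; apply: eq_bigr => i _.
  by rewrite scalerA XC mul_polyC.
have Xin i : E (fun v : V => 'X^i *: v) by apply: central_in => q; exact: XC.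
have cin c : E (fun v : V => (c%:A)%:P *: v) by apply: central_in => q; exact: cC.
(* The vectors killed by [J] form a submodule, which is proper because [w] acts nontrivially. *)
have Zw (x : V) : (forall a, J a -> a%:P *: x = 0) -> x = 0.
  move=> Jx; have [] := irr.2 [set v : V | forall a, J a -> a%:P *: v = 0].
  - by move=> a _; rewrite scaler0.
  - by move=> u v Ju Jv a Ja; rewrite scalerDr Ju ?Jv ?addr0.
  - move=> p v Jv a Ja; rewrite scalerA polyZ big1 // => i _.
    by rewrite coefCM Jv ?scaler0 //; apply: idealMr J_ideal _ _ Ja.
  - by apply.
  - by move=> /(_ v0 w Jw) e; rewrite e eqxx in wv0.
have sumE (W : set V) (n : nat) (F : 'I_n -> V) : W 0 ->
    (forall x y, W x -> W y -> W (x + y)) -> (forall i, W (F i)) ->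
    W (\sum_i F i) by move=> W0 WD WF; exact: big_ind.
unshelve eexists (@DenseRep K U J (ef_sort E) (ef_module E)
  (fun a v => a%:P *: (v : V)) (fun c => EfSort (cin c)) _ _ _ _ _ _ _ _ _).
- by move=> a x y; exact: (@scalerDr _ V a%:P x y).
- by move=> a c v; have [_ cZ] := El _ (ef_funP c); rewrite !ef_scaleE cZ.
- by move=> a b v; rewrite /= polyCD; exact: (@scalerDl _ V v).
- by move=> a b v; rewrite /= polyCM; exact: (esym (@scalerA _ V _ _ v)).
- by move=> v; exact: (@scale1r _ V).
- move=> c a v; rewrite ef_scaleE /= scalerA -polyCM.
  by rewrite -scalerAl mul1r.
- move=> c c0; apply/eqP => e.
  have [v vn0] := irr.1; case/eqP: vn0.
  have : (c%:A)%:P *: v = 0 := congr1 (fun f => ef_fun f v) e.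
  move/(congr1 (fun x => ((c^-1)%:A)%:P *: x)).
  rewrite scaler0 scalerA -polyCM -scalerAl mul1r scalerA mulVf //.
  by rewrite !scale1r.
- move=> W W0 WD WZ WJ.
  have [] := irr.2 [set v : V | forall p : {poly U}, W (p *: v)].
  - by move=> p; rewrite scaler0.
  - by move=> x y Wx Wy p; rewrite scalerDr; exact: WD.
  - by move=> p x Wx q; rewrite scalerA.
  - move=> W1; left => x Wx; apply: Zw => a Ja; apply: W1 => p /=.
    rewrite scalerA polyZ; apply: sumE => // i.
    apply: (WZ (EfSort (Xin i))); rewrite coefMC; apply: WJ => //.
    exact: idealMl J_ideal _ _ Ja.
  - by move=> W1; right => x; have := W1 x 1; rewrite scale1r.
- move=> f fD fE fJ.
  (* The vectors on which [f] commutes with all polynomials form a submodule. It contains the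
     nonzero vector [w%:P *: v0], since the coefficients of [q * w%:P] lie in [J]. *)
  have fl : @blinear _ V f.
    split=> // p x; have [] := irr.2 [set v : V | forall p : {poly U}, f (p *: v) = p *: f v].
    - have f0 : f 0 = 0 by apply: (addrI (f 0)); rewrite -fD !addr0.
      by move=> q; rewrite scaler0 f0 scaler0.
    - by move=> y z fy fz q; rewrite scalerDr fD fy fz fD scalerDr.
    - by move=> q y fy r; rewrite scalerA fy -scalerA -fy.
    - move=> h; exfalso; case/eqP: wv0; apply: h => q /=.
      rewrite scalerA fJ // [in RHS]scalerA !polyZ.
      have f0 : f 0 = 0 by apply: (addrI (f 0)); rewrite -fD !addr0.
      rewrite (big_morph f fD f0); apply: eq_bigr => i _.
      rewrite (fE (EfSort (Xin i))) coefMC.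
      by rewrite fJ //; exact: idealMl J_ideal _ _ Jw.
    - by move=> h; exact: h.
  suff Ef : E f by exists (EfSort Ef) => x; rewrite ef_scaleE.
  by apply: Ein => // g Eg v; exact: (fE (EfSort Eg) v).
- by exists v0.
Qed.

Variable f : seq nat -> K.
Variable d : nat.

(* If [w] is nonzero then some [b] in the ideal generated by [w] is not
   nilpotent, so that [1 - b X] has no left inverse in [{poly U}]. *)
Lemma ex_dense_rep (w : U) :
  (forall e, J e -> (forall u, e * u * e = 0) -> e = 0) ->
  ml_identity J f d -> J w -> w != 0 ->
  exists D : dense_rep J, exists v : dr_space D, dr_act w v != 0.
Proof.
move=> J_semiprime Jf Jw w0.
pose N := [set x | exists s : seq (U * U), x = \sum_(p <- s) p.1 * w * p.2].
have NJ : N `<=` J.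
  move=> _ [s ->]; apply: (ideal_sum J_ideal) => p _.
  by apply: (idealMr J_ideal); apply: (idealMl J_ideal).
have NM x u : N x -> N (x * u).
  move=> [s ->]; exists [seq (p.1, p.2 * u) | p <- s].
  by rewrite big_map mulr_suml; apply: eq_bigr => p _; rewrite mulrA.
have [b [s bE] b_nil] : exists2 b, N b & forall n, b ^+ n != 0.
  apply: contrapT => h; case/eqP: w0.
  apply: (nil_ideal_eq0 J_semiprime Jf NJ NM).
    move=> x Nx; apply: contrapT => xn; apply: h; exists x => // n.
    by apply/eqP => e; apply: xn; exists n.
  by exists [:: (1, 1)]; rewrite big_seq1 mul1r mulr1.
pose L := [set p * (1 - b *: 'X) | p in [set: {poly U}]].
have [||M [Mid M1 Mmax] LM] := @ex_maximal_left_ideal {poly U} L.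
- split; first by exists 0; rewrite ?mul0r.
    by move=> _ _ [p _ <-] [q _ <-]; exists (p + q); rewrite ?mulrDl.
  by move=> q _ [p _ <-]; exists (q * p); rewrite ?mulrA.
- move=> [p _ pE].
  (* Comparing coefficients, a left inverse of [1 - b X] can only be the geometric series of [b X],
     which is not a polynomial when no power of [b] vanishes. *)
  have pc n : p`_n = b ^+ n.
    elim: n => [|n IH].
      have := congr1 (fun q : {poly U} => q`_0) pE.
      by rewrite mulrBr mulr1 -mul_polyC mulrA coefB coefMX subr0 coef1.
    have := congr1 (fun q : {poly U} => q`_n.+1) pE.
    rewrite mulrBr mulr1 -mul_polyC mulrA coefB coefMX coef1 /= coefMC IH.
    by move/eqP; rewrite subr_eq0 -exprSr => /eqP.
  by have := b_nil (size p); rewrite -pc nth_default ?eqxx.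
have [M0 MD MZ] := Mid.
pose S := @Submodule {poly U} {poly U}^o M M0 MD MZ.
apply: (@poly_module_dense_rep (quot S) w) => //.
  split; first by exists (qproj S 1); apply/eqP => /qproj0P.
  move=> W W0 WD WZ.
  have [||M'|M'] := Mmax [set p | W (qproj S p)].
  - split; first by rewrite /= linear0.
      by move=> x y Wx Wy /=; rewrite linearD; exact: WD.
    by move=> a x Wx /=; rewrite (qprojZ S a (x : {poly U}^o)); exact: WZ.
  - by move=> p Mp /=; rewrite (_ : qproj S p = 0) //; apply/qproj0P.
  - by left; elim/quotW => p Wp; apply/(@qproj0P _ _ S); exact: M'.
  - by right; elim/quotW => p; have : [set: {poly U}] p by []; rewrite -M'.
(* If [w] acted as 0, so would [b], which lies in the ideal it generates; then [b X] and [1 - b X]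
   would both be in [M]. *)
apply: contrapT => h; apply: M1.
have wV (v : quot S) : w%:P *: v = 0.
  by apply/eqP; apply: contrapT => /negP n0; apply: h; exists v.
have bV (v : quot S) : b%:P *: v = 0.
  rewrite bE rmorph_sum scaler_suml big1 // => p _.
  by rewrite /= !polyCM -!scalerA wV scaler0.
have MbX : M (b *: 'X).
  apply/(@qproj0P _ _ S); rewrite -mul_polyC.
  exact: etrans (qprojZ S b%:P ('X : {poly U}^o)) (bV _).
rewrite -(subrK (b *: 'X) 1); apply: (@submoduleD _ _ S) => //.
by apply: LM; exists 1; rewrite ?mul1r.
Qed.

End DenseRep.

(** * The density theorem and the dimension bound *)

Fixpoint in_span (F : fieldType) (V : lmodType F) (vs : seq V) (v : V) : Prop :=
  if vs is u :: vs' then exists c, in_span vs' (v - c *: u) else v = 0.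

Lemma in_span0 (F : fieldType) (V : lmodType F) (vs : seq V) : in_span vs 0.
Proof. by elim: vs => //= u vs IH; exists 0; rewrite scale0r subrr. Qed.

Lemma in_span_coord (F : fieldType) (V : lmodType F) (vs : seq V) v :
  in_span vs v -> exists c : 'I_(size vs) -> F, v = \sum_i c i *: vs`_i.
Proof.
elim: vs v => [v /= ->|u vs IH v [c /IH[c' E]]].
  by exists (fun=> 0); rewrite big_ord0.
exists (fun i : 'I_(size vs).+1 => if unlift ord0 i is Some j then c' j else c).
rewrite big_ord_recl unlift_none /= -[LHS](subrK (c *: u)) E addrC.
by congr (_ + _); apply: eq_bigr => i _; rewrite liftK.
Qed.

Section Density.
Variables (K : fieldType) (U : algType K) (J : set U) (J_ideal : two_ideal J).
Variable D : dense_rep J.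
Local Notation F := (dr_field D).
Local Notation V := (dr_space D).
Local Notation act := (@dr_act K U J D).

Hypothesis J_act : exists a, J a /\ exists v : V, act a v != 0.

Definition flinear (r : V -> V) :=
  {morph r : x y / x + y} /\ forall c, {morph r : x / c *: x}.

Lemma act_flinear a : flinear (act a).
Proof. by split=> [|c v]; [exact: dr_actD | exact: dr_actZ]. Qed.

Lemma flinear0 r : flinear r -> r 0 = 0.
Proof. by move=> [_ rZ]; have := rZ 0 0; rewrite !scale0r. Qed.

Lemma flinearN r v : flinear r -> r (- v) = - r v.
Proof. by move=> [_ rZ]; rewrite -scaleN1r rZ scaleN1r. Qed.

Lemma flinear_sum r (I : Type) (s : seq I) (P : pred I) (G : I -> V) :
  flinear r -> r (\sum_(i <- s | P i) G i) = \sum_(i <- s | P i) r (G i).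
Proof. by move=> rl; apply: big_morph; [exact: rl.1 | exact: flinear0]. Qed.

(** Scalars of [F] need not come from [U], so the operators given by [J] may fail to form an
    [F]-space; density is a statement about their [F]-span. *)
Definition span_op (r : V -> V) : Prop :=
  exists s : seq (F * U), (forall p, p \in s -> J p.2) /\
    forall v, r v = \sum_(p <- s) p.1 *: act p.2 v.

Lemma span_op_flinear r : span_op r -> flinear r.
Proof.
move=> [s [_ rE]]; split=> [x y|c x]; rewrite !rE.
  by rewrite -big_split; apply: eq_bigr => p _; rewrite dr_actD scalerDr.
rewrite scaler_sumr; apply: eq_bigr => p _.
by rewrite dr_actZ !scalerA mulrC.
Qed.

Lemma span_opJ a : J a -> span_op (act a).
Proof.
move=> Ja; exists [:: (1, a)]; split=> [p|v]; first by rewrite inE => /eqP->.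
by rewrite big_seq1 scale1r.
Qed.

Lemma span_op0 : span_op (fun=> 0).
Proof. by exists [::]; split=> // v; rewrite big_nil. Qed.

Lemma span_opD r r' : span_op r -> span_op r' -> span_op (fun v => r v + r' v).
Proof.
move=> [s [Js rE]] [s' [Js' rE']]; exists (s ++ s'); split=> [p|v].
  by rewrite mem_cat => /orP[/Js|/Js'].
by rewrite big_cat rE rE'.
Qed.

Lemma span_opZ c r : span_op r -> span_op (fun v => c *: r v).
Proof.
move=> [s [Js rE]]; exists [seq (c * p.1, p.2) | p <- s]; split=> [p /mapP[q /Js Jq -> //]|v].
by rewrite rE scaler_sumr big_map; apply: eq_bigr => p _; rewrite scalerA.
Qed.

Lemma span_opM a r : span_op r -> span_op (fun v => act a (r v)).
Proof.
move=> [s [Js rE]]; exists [seq (p.1, a * p.2) | p <- s]; split=> [p|v].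
  by move=> /mapP[q /Js Jq ->]; exact: idealMl J_ideal _ _ Jq.
rewrite rE (flinear_sum _ _ _ (act_flinear a)) big_map; apply: eq_bigr => p _.
by rewrite dr_actZ dr_actM.
Qed.

Lemma span_op_transitive (vs : seq V) (u : V) r :
  span_op r -> (forall x, x \in vs -> r x = 0) -> r u != 0 ->
  forall y, exists r', [/\ span_op r', forall x, x \in vs -> r' x = 0 & r' u = y].
Proof.
move=> rR rvs ru.
have [] := @dr_irr _ _ _ D [set y | exists r', [/\ span_op r',
   forall x, x \in vs -> r' x = 0 & r' u = y]].
- by exists (fun=> 0); split=> //; exact: span_op0.
- move=> _ _ [r1 [R1 v1 <-]] [r2 [R2 v2 <-]]; exists (fun v => r1 v + r2 v).
  by split=> [|x xv|//]; [exact: span_opD | rewrite v1 ?v2 ?addr0].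
- move=> c _ [r1 [R1 v1 <-]]; exists (fun v => c *: r1 v).
  by split=> [|x xv|//]; [exact: span_opZ | rewrite v1 ?scaler0].
- move=> a _ Ja [r1 [R1 v1 <-]]; exists (fun v => act a (r1 v)).
  split=> [|x xv|//]; first exact: span_opM.
  by rewrite v1 // flinear0 //; exact: act_flinear.
- move=> h; case/eqP: ru; apply: h; exists r; split=> //.
- by move=> h y; exact: h.
Qed.

Lemma span_op_in_span vs v r : flinear r ->
  (forall x, x \in vs -> r x = 0) -> in_span vs v -> r v = 0.
Proof.
move=> rl; elim: vs v => [v _ /= ->|u vs IH v rvs [c /IH E]]; first exact: flinear0.
rewrite -(subrK (c *: u) v) rl.1 E => [|x xv]; last first.
  by apply: rvs; rewrite inE xv orbT.
by rewrite rl.2 rvs ?inE ?eqxx // scaler0 addr0.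
Qed.

(** Jacobson's argument, by induction on [vs]. If every operator killing [vs] and [u] kills [v],
    then [r u |-> r v], for [r] killing [vs], is well defined and commutes with [J] and the scalars;
    it is a scalar [c], and [v - c *: u] lies in the span of [vs]. *)
Lemma density_nonzero vs v : ~ in_span vs v ->
  exists r, [/\ span_op r, forall x, x \in vs -> r x = 0 & r v != 0].
Proof.
elim: vs v => [v /= v0|u vs IH v vspan].
  have [a [Ja av]] : exists a, J a /\ act a v != 0.
    apply: contrapT => h.
    have [] := @dr_irr _ _ _ D [set x | forall a, J a -> act a x = 0].
    - by move=> a _; rewrite flinear0 //; exact: act_flinear.
    - by move=> x y xa ya a Ja; rewrite dr_actD xa ?ya ?addr0.
    - by move=> c x xa a Ja; rewrite dr_actZ xa ?scaler0.
    - by move=> b x Jb xa a Ja; rewrite -dr_actM xa //; exact: idealMl J_ideal _ _ Jb.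
    - move=> /(_ v) h'; apply: v0; apply: h' => a Ja; apply/eqP.
      by apply: contrapT => /negP n0; apply: h; exists a.
    - by move=> h'; have [a [Ja [x]]] := J_act; rewrite h' ?eqxx.
  by exists (act a); split=> //; exact: span_opJ.
apply: contrapT => h.
have hv r : span_op r -> (forall x, x \in vs -> r x = 0) -> r u = 0 -> r v = 0.
  move=> rR rvs ru; apply/eqP; apply: contrapT => /negP n0; apply: h.
  by exists r; split=> // x; rewrite inE => /orP[/eqP->|/rvs].
have [us|us] := pselect (in_span vs u).
  have [|r [rR rvs rv]] := IH v.
    by move=> vs'; apply: vspan; exists 0; rewrite scale0r subr0.
  case/eqP: rv; apply: hv => //.
  exact: span_op_in_span (span_op_flinear rR) rvs us.
have [r0 [r0R r0vs r0u]] := IH u us.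
have tr y := span_op_transitive r0R r0vs r0u y.
pose g y := projT1 (cid (tr y)).
have gP y : [/\ span_op (g y), forall x, x \in vs -> g y x = 0 & g y u = y].
  by rewrite /g; case: cid.
have gE y r : span_op r -> (forall x, x \in vs -> r x = 0) -> r u = y -> g y v = r v.
  move=> rR rvs ru; have [gR gvs gu] := gP y.
  suff : (fun v => g y v + (-1) *: r v) v = 0.
    by rewrite scaleN1r => /eqP; rewrite subr_eq0 => /eqP.
  apply: (hv (fun v => g y v + (-1) *: r v)).
  - by apply: span_opD => //; exact: span_opZ.
  - by move=> x xv; rewrite gvs ?rvs // scaler0 addr0.
  - by rewrite gu ru scaleN1r subrr.
have [|||c cE] := @dr_commutant _ _ _ D (fun y => g y v).
- move=> x y; have [xR xvs xu] := gP x; have [yR yvs yu] := gP y.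
  apply: (@gE _ (fun v => g x v + g y v)); rewrite ?xu ?yu //.
    exact: span_opD.
  by move=> z zv; rewrite xvs ?yvs ?addr0.
- move=> c x; have [xR xvs xu] := gP x.
  apply: (@gE _ (fun v => c *: g x v)); rewrite ?xu //; first exact: span_opZ.
  by move=> z zv; rewrite xvs ?scaler0.
- move=> a x Ja; have [xR xvs xu] := gP x.
  apply: (@gE _ (fun v => act a (g x v))); rewrite ?xu //; first exact: span_opM.
  by move=> z zv; rewrite xvs // flinear0 //; exact: act_flinear.
apply: vspan; exists c; apply: contrapT => /IH[r [rR rvs]] /eqP; apply.
have rl := span_op_flinear rR.
by rewrite rl.1 flinearN // rl.2 -cE (gE _ r) // subrr.
Qed.

Lemma density vs u y : ~ in_span vs u ->
  exists r, [/\ span_op r, forall x, x \in vs -> r x = 0 & r u = y].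
Proof.
move=> /density_nonzero[r [rR rvs ru]]; exact: span_op_transitive rR rvs ru y.
Qed.

Definition op_word (r : nat -> V -> V) (w : seq nat) (v : V) : V :=
  foldr r v w.

Lemma op_word_flinear r w : (forall i, flinear (r i)) -> flinear (op_word r w).
Proof.
move=> rl; elim: w => [|i w IH] /=; first by split.
by split=> [x y|c x]; rewrite /= ?IH.1 ?IH.2 ?(rl i).1 ?(rl i).2.
Qed.

(** Operators apply from the right end of a word. Starting at [v d], each must lower the index by
    exactly one, since [r i] kills the vectors beyond [v i.+1]; only the word [iota 0 d]
    survives. *)
Lemma staircase d (g : seq nat -> F) (r : nat -> V -> V) (v : nat -> V) :
  (forall i, flinear (r i)) ->
  (forall i, (i < d)%N -> r i (v i.+1) = v i) ->
  (forall i j, (i.+1 < j <= d)%N -> r i (v j) = 0) ->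
  \sum_(w <- permutations (iota 0 d)) g w *: op_word r w (v d) =
  g (iota 0 d) *: v 0%N.
Proof.
move=> rl; elim: d g => [|d IH] g rv rv0; first by rewrite big_seq1.
rewrite sum_permutations_last [X in _ + X]big1_seq ?addr0.
  rewrite iota_rcons -(IH (fun w => g (rcons w d))).
  - by apply: eq_bigr => w _; rewrite /op_word -cats1 foldr_cat /= rv.
  - by move=> i id; apply: rv; exact: ltnW.
  - by move=> i j /andP[ij jd]; apply: rv0; rewrite ij leqW.
move=> w /andP[lw]; rewrite mem_permutations => pw.
case/lastP: w lw pw => [|w i]; first by move=> _ /perm_size; rewrite size_iota.
rewrite last_rcons => id /perm_mem/(_ i); rewrite mem_rcons inE eqxx mem_iota /= add0n ltnS => /esym ile.
have ltid : (i < d)%N by rewrite ltn_neqAle id.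
rewrite /op_word -cats1 foldr_cat /= rv0 ?ltnS ?ltid ?leqnn //.
by rewrite -/(op_word r w 0) flinear0 ?scaler0 //; exact: op_word_flinear.
Qed.

Lemma op_word_act (x : nat -> U) w v :
  op_word (fun i => act (x i)) w v = act (\prod_(i <- w) x i) v.
Proof.
elim: w => [|i w IH] /=; first by rewrite big_nil dr_act1.
by rewrite big_cons dr_actM -IH.
Qed.

Lemma op_word_ext r r' w v : (forall i, i \in w -> r i = r' i) ->
  op_word r w v = op_word r' w v.
Proof.
elim: w => //= i w IH h; rewrite h ?inE ?eqxx // IH // => j jw.
by apply: h; rewrite inE jw orbT.
Qed.

Variables (f : seq nat -> K) (d : nat).
Hypothesis Jf : ml_identity J f d.

Let g w := dr_scal D (f w).

Lemma ml_identity_span_op r v : (forall i, span_op (r i)) ->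
  \sum_(w <- permutations (iota 0 d)) g w *: op_word r w v = 0.
Proof.
move=> rR.
(* The identity passes from [J] to its span by multilinearity, one variable at a time: those with
   index at least [k] are already given by elements of [J]. *)
suff H k : (k <= d)%N -> forall r : nat -> V -> V, (forall i, span_op (r i)) ->
    (forall i, (k <= i < d)%N -> exists2 a, J a & r i = act a) ->
    \sum_(w <- permutations (iota 0 d)) g w *: op_word r w v = 0.
  apply: (H d) => // i /andP[h1 h2]; exfalso.
  by have := leq_ltn_trans h1 h2; rewrite ltnn.
elim: k => [|k IH] kd {rR}r rR rk.
  have a0 : J 0 by have [] := J_ideal.
  have /choice[x xE] : forall i, exists a, J a /\ ((i < d)%N -> r i = act a).
    move=> i; case: (ltnP i d) => [id|_]; last by exists 0.
    by have [a Ja ra] := rk i id; exists a.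
  have := Jf.2 x (fun i => (xE i).1) => /(congr1 (fun a => act a v)).
  have act0 z : act 0 z = 0.
    by apply: (addrI (act 0 z)); rewrite -dr_actDl !addr0.
  rewrite act0 => E; rewrite -[RHS]E {E} /ml_eval.
  rewrite (big_morph (fun a => act a v) (fun a b => @dr_actDl _ _ _ D a b v) (act0 v)).
  rewrite big_seq [RHS]big_seq; apply: eq_bigr => w; rewrite mem_permutations => /perm_mem pw.
  rewrite dr_scalE -op_word_act; congr (_ *: _); apply: op_word_ext => i.
  by rewrite pw mem_iota /= add0n => id; rewrite (xE i).2.
have [s [Js rkE]] := rR k.
pose r' a i := if i == k then act a else r i.
have r'l a i : flinear (r' a i).
  by rewrite /r'; case: eqP => _; [exact: act_flinear | exact: span_op_flinear].
have E w : w \in permutations (iota 0 d) ->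
    op_word r w v = \sum_(p <- s) p.1 *: op_word (r' p.2) w v.
  rewrite mem_permutations => pw.
  have kw : k \in w by rewrite (perm_mem pw) mem_iota.
  have uw : uniq w by rewrite (perm_uniq pw) iota_uniq.
  case/splitPr: kw uw {pw} => w1 w2; rewrite cat_uniq /= => /and4P[_ + kw2 _].
  rewrite negb_or => /andP[kw1 _].
  rewrite /op_word foldr_cat /= rkE -!/(op_word _ _ _).
  rewrite (flinear_sum _ _ _ (op_word_flinear w1 (fun i => span_op_flinear (rR i)))).
  apply: eq_bigr => p _.
  have rl1 := op_word_flinear w1 (fun i => span_op_flinear (rR i)).
  rewrite rl1.2 foldr_cat /= {2}/r' eqxx -!/(op_word _ _ _); congr (_ *: _).
  have ext w' z : k \notin w' -> op_word r w' z = op_word (r' p.2) w' z.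
    move=> kw'; apply: op_word_ext => i iw'; rewrite /r'.
    by case: eqP => // ik; rewrite ik (negPf kw') in iw'.
  by rewrite -!ext.
rewrite big_seq; under eq_bigr => w wp do rewrite E // scaler_sumr.
rewrite -big_seq exchange_big /= big1_seq // => p /andP[_ /Js Jp].
under eq_bigr => w _ do rewrite scalerA mulrC -scalerA.
rewrite -scaler_sumr IH ?scaler0 //; first exact: ltnW.
  by move=> i; rewrite /r'; case: eqP => // _; exact: span_opJ.
move=> i /andP[ki id]; rewrite /r'; case: eqP => [_|/eqP ik]; first by exists p.2.
by apply: rk; rewrite id andbT ltn_neqAle eq_sym ik.
Qed.

(** Kaplansky's argument: with [d.+1] independent vectors, density would provide operators as in
    [staircase], on which the identity takes a nonzero value. *)
Lemma dense_rep_dim : exists2 vs : seq V, (size vs <= d)%N &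
  forall v, in_span vs v.
Proof.
apply: contrapT => h.
have nsp (vs : seq V) : exists v, (size vs <= d)%N -> ~ in_span vs v.
  apply: contrapT => /forallNP n; apply: h; exists vs => [|v]; last first.
    by apply: contrapT => nv; apply: (n v).
  by apply: contrapT => nd; apply: (n 0) => /nd.
have [pick pickP] := choice nsp.
pose L k := iter k (fun vs => pick vs :: vs) [::] : seq V.
pose e k := pick (L k).
have sL k : size (L k) = k by elim: k => //= k ->.
have eL k : (k <= d)%N -> ~ in_span (L k) (e k).
  by move=> kd; apply: pickP; rewrite sL.
have inL j k : (j < k)%N -> e j \in L k.
  elim: k => // k IH; rewrite ltnS leq_eqVlt inE => /orP[/eqP->|/IH->].
    by rewrite eqxx.
  by rewrite orbT.
(* The order is reversed so that the vectors to be killed by [r i] are those picked before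
   [v i.+1]. *)
pose v j := e (d - j)%N.
have /choice[r rP] : forall i, exists r, [/\ span_op r,
    (i < d)%N -> r (v i.+1) = v i & forall j, (i.+1 < j <= d)%N -> r (v j) = 0].
  move=> i; case: (ltnP i d) => [id|di]; last first.
    exists (fun=> 0); split=> //; exact: span_op0.
  have [|r [rR rL re]] := @density (L (d - i.+1)%N) (v i.+1) (v i).
    by apply: eL; exact: leq_subr.
  exists r; split=> // j /andP[ij jd]; apply: rL; apply: inL.
  by rewrite ltn_sub2l // (leq_trans ij).
have := @staircase d g r v (fun i => span_op_flinear (let: And3 h _ _ := rP i in h)).
rewrite ml_identity_span_op; last by move=> i; have [] := rP i.
move=> /(_ _ _)/esym E; have {}E : g (iota 0 d) *: v 0%N = 0.
  by apply: E => [i id|i j ijd]; have [_ h1 h2] := rP i; [exact: h1|exact: h2].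
have gn : g (iota 0 d) != 0 by apply: dr_scal_neq0; exact: Jf.1.
apply: (eL d (leqnn d)); rewrite -[e d]/(e d) -[X in e X]subn0 -/(v 0%N).
suff -> : v 0%N = 0 by exact: in_span0.
by move/eqP: E; rewrite scaler_eq0 (negPf gn) => /eqP.
Qed.

End Density.

(** * Semiprime ideals with a polynomial identity *)

Section CapelliVanishes.
Variables (K : fieldType) (U : algType K) (J : set U) (J_ideal : two_ideal J).
Variables (f : seq nat -> K) (d : nat).
Hypothesis Jf : ml_identity J f d.

Lemma operators_dependent (D : dense_rep J) m (x : 'I_m -> U) :
  (exists a, J a /\ exists v : dr_space D, dr_act a v != 0) ->
  (d * d < m)%N ->
  exists i0, exists c : 'I_m -> dr_field D, forall v : dr_space D,
    dr_act (x i0) v = \sum_(i | i != i0) c i *: dr_act (x i) v.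
Proof.
move=> J_act dm.
have [vs vsd vsS] := dense_rep_dim J_ideal J_act Jf.
set n := size vs in vsd.
have /choice[C CE] : forall ij : 'I_m * 'I_n, exists c : 'I_n -> dr_field D,
    dr_act (x ij.1) vs`_ij.2 = \sum_k c k *: vs`_k.
  by move=> [i j]; exact: in_span_coord (vsS _).
pose A := \matrix_(i < m) mxvec (\matrix_(j < n, k < n) C (i, j) k).
have : kermx A != 0.
  rewrite -mxrank_eq0 mxrank_ker -lt0n subn_gt0.
  apply: leq_ltn_trans (rank_leq_col A) _.
  by apply: leq_ltn_trans dm; exact: leq_mul.
move=> /rowV0Pn[l lA l0]; have {lA} lA : l *m A = 0 by apply/sub_kermxP.
have [i0 li0] : exists i0, l 0 i0 != 0.
  apply: contrapT => h; case/eqP: l0; apply/rowP => i; rewrite mxE.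
  by apply/eqP; apply: contrapT => /negP n0; apply: h; exists i.
have rel j : \sum_i l 0 i *: dr_act (x i) vs`_(j : 'I_n) = 0.
  under eq_bigr => i _ do rewrite (CE (i, j)) scaler_sumr.
  rewrite exchange_big /= big1 // => k _.
  under eq_bigr => i _ do rewrite scalerA.
  rewrite -scaler_suml [X in X *: _](_ : _ = 0) ?scale0r //.
  have := congr1 (fun M : 'rV_(n * n) => M 0 (mxvec_index j k)) lA.
  rewrite /= !mxE => E; rewrite -[RHS]E; apply: eq_bigr => i _.
  by rewrite mxE mxvecE mxE.
have relV v : \sum_i l 0 i *: dr_act (x i) v = 0.
  have [c ->] := in_span_coord (vsS v).
  under eq_bigr => i _.
    rewrite (flinear_sum _ _ _ (act_flinear D (x i))) scaler_sumr.
    under eq_bigr => j _ do rewrite dr_actZ scalerA mulrC -scalerA.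
    over.
  rewrite exchange_big /= big1 // => j _.
  by rewrite -scaler_sumr rel scaler0.
exists i0, (fun i => - (l 0 i / l 0 i0)) => v.
have /eqP := relV v; rewrite (bigD1 i0) //= addr_eq0 => /eqP E.
rewrite -[LHS]scale1r -(mulVf li0) -scalerA E scalerN scaler_sumr -sumrN.
by apply: eq_bigr => i _; rewrite scalerA mulrC scaleNr.
Qed.

Hypothesis J_semiprime : forall e, J e -> (forall u, e * u * e = 0) -> e = 0.

(* More operators than [dim End V] are linearly dependent over the commutant,
   and the Capelli polynomial is alternating. *)
Lemma semiprime_capelli_identity : capelli_identity J (d * d).+1.
Proof.
move=> x y Jx Jy; apply/eqP; apply: contrapT => /negP c0.
have Jc : J (capelli x y) by exact: (capelli_ideal J_ideal).
have [D [v cv]] := ex_dense_rep J_ideal J_semiprime Jf Jc c0.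
have J_act : exists a, J a /\ exists v : dr_space D, dr_act a v != 0.
  by exists (capelli x y); split=> //; exists v.
have [i0 [c cE]] := @operators_dependent D _ x J_act (ltnSn _).
case/eqP: cv.
have act0 (z : dr_space D) : dr_act 0 z = 0.
  by apply: (addrI (dr_act 0 z)); rewrite -dr_actDl !addr0.
have act_sum (I : Type) (r : seq I) (F : I -> U) (z : dr_space D) :
    dr_act (\sum_(i <- r) F i) z = \sum_(i <- r) dr_act (F i) z.
  by apply: (big_morph (fun a => dr_act a z)) => [a b|]; [exact: dr_actDl|].
transitivity (\sum_(i | i != i0) c i *: dr_act (capelli (upd x i0 (x i)) y) v); last first.
  by apply: big1 => i ii0; rewrite capelli_upd_eq0 // act0 scaler0.
rewrite -{1}(upd_id x i0) /capelli act_sum.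
under [RHS]eq_bigr => i _ do rewrite act_sum scaler_sumr.
rewrite [RHS]exchange_big; apply: eq_bigr => s _.
have [p [q [_ pq]]] := mono_upd J_ideal x i0 s Jy.
under [RHS]eq_bigr => i _ do rewrite pq.
rewrite pq !dr_actM cE.
rewrite !(flinear_sum _ _ _ (act_flinear D _)); apply: eq_bigr => i _.
by rewrite !dr_actM !dr_actZ.
Qed.

End CapelliVanishes.

Section RadicalVanishes.
Variables (K : fieldType) (U : algType K) (J : set U) (J_ideal : two_ideal J).
Hypothesis J_semiprime : forall e, J e -> (forall u, e * u * e = 0) -> e = 0.
Variables (f : seq nat -> K) (d : nat).
Hypothesis Jf : ml_identity J f d.
Hypothesis J_trace : forall m (x x' y : 'I_m.+1 -> U) (a b v : U),
  capelli_identity J m.+2 ->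
  (forall i, J (x i)) -> (forall i, J (x' i)) -> (forall i, J (y i)) ->
  J a -> capelli_trace x y a b * v * capelli x' y = 0.

Lemma semiprime_ideal_eq0 x : J x -> x = 0.
Proof.
apply: (capelli_identity1 J_ideal J_semiprime).
have := semiprime_capelli_identity J_ideal Jf J_semiprime.
elim: (d * d)%N => // m IH C; apply: IH; apply: (capelli_descent J_ideal J_semiprime C).
by move=> *; apply: J_trace.
Qed.

End RadicalVanishes.

(** * Multilinearization *)

Fixpoint words D L : seq (seq nat) :=
  if L is L'.+1 then [seq j :: u | j <- iota 0 D, u <- words D L'] else [:: [::]].

Lemma mem_words D L u :
  (u \in words D L) = (size u == L) && all (fun j => j < D)%N u.
Proof.
elim: L u => [|L IH] [|j u] //=.
  by apply/allpairsP => -[[j v] []].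
rewrite eqSS; apply/allpairsP/idP => [[[k v] /= [kD + [-> ->]]]|/and3P[sL jD uD]].
  by rewrite IH => /andP[-> ->]; move: kD; rewrite mem_iota /= add0n => ->.
by exists (j, u); rewrite /= IH sL uD mem_iota.
Qed.

Lemma words_uniq D L : uniq (words D L).
Proof.
elim: L => //= L IH; apply: allpairs_uniq => //; first exact: iota_uniq.
by move=> [j u] [j' u'] _ _ /= [-> ->].
Qed.

Definition words_le D := flatten [seq words D L | L <- iota 0 D.+1].

Lemma mem_words_le D u :
  (u \in words_le D) = (size u <= D)%N && all (fun j => j < D)%N u.
Proof.
apply/flatten_mapP/idP => [[L LD]|/andP[sD uD]].
  rewrite mem_words => /andP[/eqP -> ->]; rewrite andbT.
  by move: LD; rewrite mem_iota /= add0n ltnS.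
by exists (size u); rewrite ?mem_words ?eqxx // mem_iota /= add0n ltnS.
Qed.

Lemma words_le_uniq D : uniq (words_le D).
Proof.
rewrite /words_le; elim: (iota _ _) (iota_uniq 0 D.+1) => //= L s IH /andP[Ls us].
rewrite cat_uniq words_uniq IH // andbT /=; apply/hasPn => u /flatten_mapP[L' L's].
rewrite !mem_words => /andP[/eqP -> _]; apply/negP => /andP[/eqP e _].
by rewrite -e L's in Ls.
Qed.

Lemma words_le_permutations D :
  perm_eq [seq u <- words_le D | all (mem u) (iota 0 D)]
          (permutations (iota 0 D)).
Proof.
apply: uniq_perm; rewrite ?permutations_uniq ?filter_uniq ?words_le_uniq //.
move=> u; rewrite mem_filter mem_words_le mem_permutations.
apply/and3P/idP => [[/allP iu su uD]|pu].
  have su' : (size u <= size (iota 0 D))%N by rewrite size_iota.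
  have [_ iu'] := uniq_min_size (iota_uniq 0 D) iu su'.
  have uu := leq_size_uniq (iota_uniq 0 D) iu su'.
  apply: uniq_perm; rewrite ?iota_uniq // => x; by rewrite iu'.
split.
- by apply/allP => j; rewrite -(perm_mem pu).
- by rewrite (perm_size pu) size_iota.
- by apply/allP => j; rewrite (perm_mem pu) mem_iota /= add0n.
Qed.

Section Multilinearize.
Variables (K : fieldType) (U : algType K) (J : set U) (J_ideal : two_ideal J).

(* Take [w] of maximal length [D] among the words of [f], and substitute for
   [X_i] the sum of the [z j], [j < D], with [w_j = i]; inclusion-exclusion on
   the set of those [z j] that actually occur leaves the words using each [z j]
   exactly once. *)
Lemma multilinearize (S : seq (seq nat)) (f : seq nat -> K) (w0 : seq nat) :
  uniq S -> w0 \in S -> f w0 != 0 ->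
  (forall x, (forall i, J (x i)) -> \sum_(w <- S) f w *: \prod_(i <- w) x i = 0) ->
  exists g d, @ml_identity K U J g d.
Proof.
move=> uS w0S fw0 Jf; have [J0 JD _ _] := J_ideal.
have [w [wS fw wmax]] : exists w, [/\ w \in S, f w != 0 &
    forall v, v \in S -> f v != 0 -> (size v <= size w)%N].
  pose P n := has (fun v => (f v != 0) && (size v == n)) S.
  have [||_ /hasP[w wS /andP[fw /eqP <-]] wmax] := @ex_maxnP P (\max_(v <- S) size v).
  - by exists (size w0); apply/hasP; exists w0; rewrite ?fw0 ?eqxx.
  - by move=> n /hasP[v vS /andP[_ /eqP <-]]; exact: leq_bigmax_seq.
  by exists w; split=> // v vS fv; apply: wmax; apply/hasP; exists v; rewrite ?fv ?eqxx.
set D := size w in wmax.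
pose f' v := if v \in S then f v else 0.
(* [t] sends a word in the letters [z j] to the word of [f] from which it arises under the
   substitution; below, [P] selects the letters that are kept in the substitution. *)
pose t (u : seq nat) := [seq nth 0%N w j | j <- u].
exists (fun u => f' (t u)), D; split.
  rewrite /t -/D map_nth_iota0 // take_size /f' wS //.
move=> z Jz.
have prodE (P : pred nat) v :
    \prod_(i <- v) (\sum_(j <- iota 0 D | P j && (nth 0%N w j == i)) z j) =
    \sum_(u <- words D (size v) | all P u && (t u == v)) \prod_(j <- u) z j.
  elim: v => [|i v IH] /=; first by rewrite big_nil big_cons big_nil /= big_nil addr0.
  rewrite big_cons IH mulr_suml [RHS]big_mkcond big_allpairs_dep /=.
  under [RHS]eq_bigr => j _ do rewrite -big_mkcond /=.
  rewrite [RHS](bigID (fun j => P j && (nth 0%N w j == i))) /=.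
  rewrite [X in _ = _ + X]big1 => [|j Pj]; last first.
    apply: big1 => u; rewrite /= eqseq_cons -andbA => /and4P[Pj' _ e _].
    by rewrite Pj' e in Pj.
  rewrite addr0; apply: eq_bigr => j /andP[Pj ji]; rewrite mulr_sumr.
  apply: eq_big => [u|u _]; first by rewrite /= Pj eqseq_cons ji.
  by rewrite big_cons.
have base (P : pred nat) :
    \sum_(u <- words_le D | all P u) f' (t u) *: \prod_(j <- u) z j = 0.
  rewrite -[RHS](Jf (fun i => \sum_(j <- iota 0 D | P j && (nth 0%N w j == i)) z j)); last first.
    by move=> i; apply: ideal_sum.
  transitivity (\sum_(u <- words_le D | all P u)
     \sum_(v <- S | v == t u) f v *: \prod_(j <- u) z j).
    apply: eq_bigr => u _; rewrite -scaler_suml; congr (_ *: _).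
    rewrite /f'; case: ifP => tS; first by rewrite (big_rem _ tS) /= eqxx
      big1_seq ?addr0 // => v /andP[/eqP ->]; rewrite mem_rem_uniqF.
    by rewrite big1_seq // => v /andP[/eqP ->]; rewrite tS.
  rewrite (exchange_big_dep xpredT) //= big_seq [RHS]big_seq; apply: eq_bigr => v vS.
  rewrite prodE scaler_sumr.
  have [fv|fv] := eqVneq (f v) 0.
    by rewrite !big1 // => *; rewrite fv scale0r.
  rewrite -big_filter -[RHS]big_filter; apply: perm_big; apply: uniq_perm.
  - by rewrite filter_uniq ?words_le_uniq.
  - by rewrite filter_uniq ?words_uniq.
  move=> u; rewrite !mem_filter mem_words mem_words_le [v == _]eq_sym.
  case: (all P u) => //=; case: eqP => //= tu.
  have -> : size u = size v by rewrite -tu size_map.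
  by rewrite eqxx wmax.
(* Inclusion-exclusion, one letter at a time: the words using [k] are all words minus those avoiding
   it, and avoiding [k] amounts to shrinking [P]. *)
have step k (P : pred nat) : \sum_(u <- words_le D | all P u && all (mem u) (iota 0 k))
    f' (t u) *: \prod_(j <- u) z j = 0.
  elim: k P => [|k IH] P; first by rewrite -[RHS](base P); apply: eq_bigl => u; rewrite andbT.
  rewrite iota_rcons; under eq_bigl => u do rewrite all_rcons.
  have := IH P; rewrite (bigID (fun u => k \in u)) /=.
  rewrite [X in _ + X](_ : _ = 0) ?addr0; last first.
    rewrite -[RHS](IH (fun j => P j && (j != k))); apply: eq_bigl => u.
    rewrite andbAC; congr (_ && _); rewrite all_predI; congr (_ && _).
    by rewrite -has_pred1 -all_predC; apply: eq_all.
  move=> E; rewrite -[RHS]E; apply: eq_bigl => u.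
  by rewrite -andbA; congr (_ && _); rewrite andbC.
rewrite -[RHS](step D xpredT) /ml_eval -[RHS]big_filter.
rewrite -(perm_big _ (words_le_permutations D)); congr bigop.
by apply: eq_filter => u; rewrite all_predT.
Qed.

End Multilinearize.

(** * Quasi-nilpotent elements *)

Section ComplexModulus.
Variable R : realType.
Implicit Types c : R[i].

Definition cmod (c : R[i]) : R := complex.Re `|c|.

Lemma cmodE c : (cmod c)%:C = `|c|.
Proof. by rewrite /cmod RRe_real // ger0_real. Qed.

Lemma cmod_ge0 c : 0 <= cmod c.
Proof. by rewrite -lecR cmodE; exact: normr_ge0. Qed.

Lemma cmodM c c' : cmod (c * c') = cmod c * cmod c'.
Proof. by apply: complexI; rewrite rmorphM /= !cmodE normrM. Qed.

Lemma cmodD c c' : cmod (c + c') <= cmod c + cmod c'.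
Proof. by rewrite -lecR rmorphD /= !cmodE ler_normD. Qed.

Lemma cmodN c : cmod (- c) = cmod c.
Proof. by rewrite /cmod normrN. Qed.

Lemma cmodX c n : cmod (c ^+ n) = cmod c ^+ n.
Proof. by apply: complexI; rewrite rmorphXn /= !cmodE normrX. Qed.

Lemma cmod0 : cmod 0 = 0. Proof. by rewrite /cmod normr0. Qed.
Lemma cmod1 : cmod 1 = 1. Proof. by rewrite /cmod normr1. Qed.

Lemma cmod_eq0 c : cmod c = 0 -> c = 0.
Proof. by move=> c0; apply/eqP; rewrite -normr_eq0 -cmodE c0. Qed.

Lemma cmod_real (x : R) : 0 <= x -> cmod x%:C = x.
Proof. by move=> x0; apply: complexI; rewrite cmodE ger0_norm // ler0c. Qed.

Lemma cmod_Re c : `|complex.Re c| <= cmod c.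
Proof. by rewrite -lecR cmodE normc_ge_Re. Qed.

Lemma cmod_Im c : `|complex.Im c| <= cmod c.
Proof.
by case: c => x y; rewrite -lecR cmodE normc_def lecR /= -sqrtr_sqr ler_wsqrtr // lerDr sqr_ge0.
Qed.

Lemma cmod_le (x y : R) : cmod (x +i* y) <= `|x| + `|y|.
Proof.
have -> : (x +i* y) = x%:C + (0 +i* 1) * y%:C.
  by apply/eqP; rewrite eq_complex /=; apply/andP; split; apply/eqP; ring.
apply: le_trans (cmodD _ _) _; rewrite cmodM.
have nr (z : R) : cmod z%:C = `|z|.
  by rewrite /cmod normc_def /= expr0n addr0 sqrtr_sqr.
have -> : cmod (0 +i* 1) = 1 :> R.
  by rewrite /cmod normc_def /= expr0n expr1n add0r sqrtr1.
by rewrite !nr mul1r.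
Qed.

Lemma ex_root_minus1 n : exists2 w : R[i], w ^+ (2 ^ n) = -1 & cmod w = 1.
Proof.
have n0 : (0 < 2 ^ n)%N by rewrite expn_gt0.
exists ((2 ^ n)%N.-root (-1)); first by rewrite rootCK.
by rewrite /cmod norm_rootC normrN1 rootC1.
Qed.

End ComplexModulus.

Section SpectralRadius.
Variables (R : realType) (U : algType R[i]) (N : U -> R).
Hypothesis N_ge0 : forall x, 0 <= N x.
Hypothesis ND : forall x y, N (x + y) <= N x + N y.
Hypothesis NZ : forall c x, N (c *: x) = cmod c * N x.
Hypothesis NM : forall x y, N (x * y) <= N x * N y.

Lemma seminormN x : N (- x) = N x.
Proof. by rewrite -scaleN1r NZ cmodN cmod1 mul1r. Qed.

Lemma seminormB x y : N (x - y) <= N x + N y.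
Proof. by apply: le_trans (ND _ _) _; rewrite seminormN. Qed.

Lemma seminormX x n : (0 < n)%N -> N (x ^+ n) <= N x ^+ n.
Proof.
case: n => // n _; elim: n => [|n IH]; first by rewrite !expr1.
by rewrite exprS [leRHS]exprS; apply: le_trans (NM _ _) _; rewrite ler_wpM2l.
Qed.

Variables (a : U) (Res : R[i] -> U).
Hypothesis ResL : forall l, Res l * (1 - l *: a) = 1.
Hypothesis ResR : forall l, (1 - l *: a) * Res l = 1.

Lemma resolvent_identity l m : Res l - Res m = (l - m) *: (Res l * a * Res m).
Proof.
have -> : Res l - Res m = Res l * ((1 - m *: a) - (1 - l *: a)) * Res m.
  by rewrite mulrBr mulrBl ResL mul1r -mulrA ResR mulr1.
rewrite [X in _ * X * _](_ : _ = (l - m) *: a); last first.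
  by rewrite opprB addrC addrA subrK scalerBl.
by rewrite -scalerAr -scalerAl.
Qed.

Lemma resolvent_locally_bounded l : exists2 e : R, 0 < e &
  forall m, cmod (m - l) <= e -> N (Res m) <= 2 * N (Res l).
Proof.
pose k := N (a * Res l).
have k0 : 0 <= k by exact: N_ge0.
have k1 : 0 < 2 * (k + 1) by lra.
exists (2 * (k + 1))^-1; first by rewrite invr_gt0.
move=> m ml.
have : N (Res m) <= N (Res l) + cmod (m - l) * (N (Res m) * k).
  rewrite -{1}(subrK (Res l) (Res m)) addrC; apply: le_trans (ND _ _) _.
  rewrite lerD2l resolvent_identity NZ ler_wpM2l ?cmod_ge0 // -mulrA.
  exact: NM.
have : cmod (m - l) * (N (Res m) * k) <= 2^-1 * N (Res m).
  rewrite mulrCA mulrC ler_wpM2r //.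
  apply: (@le_trans _ _ ((2 * (k + 1))^-1 * k)); first by rewrite ler_wpM2r.
  rewrite mulrC ler_pdivrMr //; lra.
by lra.
Qed.

Lemma resolvent_bounded (r : R) : exists M : R, forall l, cmod l <= r -> N (Res l) <= M.
Proof.
have K : compact (`[-r, r]%classic `*` `[-r, r]%classic : set (R * R)).
  by apply: compact_setX; exact: segment_compact.
move/compact_near_coveringP: K => /(_ nat \oo (fun n z => N (Res (z.1 +i* z.2)) <= n%:R)).
case => [[x y] _|n _ nP].
  have [e e0 eP] := resolvent_locally_bounded (x +i* y).
  have [n nP] : exists n, 2 * N (Res (x +i* y)) <= n%:R.
    by exists (Num.truncn (2 * N (Res (x +i* y)))).+1; rewrite ltW // truncnS_gt.
  have e2 : 0 < e / 2 by rewrite divr_gt0.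
  near=> z k => /=.
  apply: (@le_trans _ _ n%:R); last first.
    by rewrite ler_nat; near: k; exists n.
  apply: le_trans nP; apply: eP.
  have -> : (z.1 +i* z.2) - (x +i* y) = (z.1 - x) +i* (z.2 - y) by [].
  apply: le_trans (cmod_le _ _) _.
  have h1 : `|z.1 - x| < e / 2.
    near: z; exists (ball x (e / 2), setT) => /=; first by split; [exact: nbhsx_ballx | exact: filterT].
    by move=> [u v] /= [+ _]; rewrite /ball /= distrC.
  have h2 : `|z.2 - y| < e / 2.
    near: z; exists (setT, ball y (e / 2)) => /=; first by split; [exact: filterT | exact: nbhsx_ballx].
    by move=> [u v] /= [_ +]; rewrite /ball /= distrC.
  by rewrite ltW //; lra.
exists n%:R => l lr; have := nP n (leqnn n) (complex.Re l, complex.Im l).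
have := cmod_Re l; have := cmod_Im l; rewrite !ler_norml => /andP[h1 h2] /andP[h3 h4].
rewrite /= !in_itv /=; case: l lr h1 h2 h3 h4 => x y /= lr h1 h2 h3 h4.
by apply; split; apply/andP; split; lra.
Unshelve. all: by end_near.
Qed.

(* With [w ^ (2 ^ n) = -1], the inverse of [1 - x ^ 2] for
   [x = (l a) ^ (2 ^ n)] is the average of the inverses of [1 - x] and
   [1 + x = 1 - (w l a) ^ (2 ^ n)]; averaging preserves the bound and the
   Lipschitz constant of the resolvent. *)
Lemma power_resolvent (r M : R) : (forall l, cmod l <= r -> N (Res l) <= M) ->
  forall n, exists G : R[i] -> U, [/\
    forall l, G l * (1 - (l *: a) ^+ (2 ^ n)) = 1,
    forall l, cmod l <= r -> N (G l) <= M &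
    forall l m, cmod l <= r -> cmod m <= r ->
      N (G l - G m) <= cmod (l - m) * (M * N a * M)].
Proof.
move=> MP; elim=> [|n [G [G1 GM GL]]].
  exists Res; split=> [l|//|l m lr mr]; first by rewrite expr1.
  have M0 : 0 <= M by apply: le_trans (MP _ lr).
  rewrite resolvent_identity NZ ler_wpM2l ?cmod_ge0 //.
  apply: le_trans (NM _ _) _; apply: ler_pM => //; last exact: MP.
  by apply: le_trans (NM _ _) _; apply: ler_pM => //; exact: MP.
have [w wn w1] := ex_root_minus1 R n.
have h2 : cmod (2^-1 : R[i]) = 2^-1.
  by rewrite -[X in cmod X](_ : (2^-1)%:C = _) ?cmod_real // fmorphV rmorph_nat.
have wr l : cmod (w * l) = cmod l by rewrite cmodM w1 mul1r.
have half (x y : R) : 2^-1 * (x + x) = x by lra.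
exists (fun l => 2^-1 *: (G l + G (w * l))); split=> [l|l lr|l m lr mr].
- set x := (l *: a) ^+ (2 ^ n).
  have e1 : G l * (1 - x) = 1 by exact: G1.
  have e2 : G (w * l) * (1 + x) = 1.
    by rewrite -[RHS](G1 (w * l)) -scalerA exprZn -/x wn scaleN1r opprK.
  rewrite expnS mulnC exprM -/x -scalerAl mulrDl.
  have f1 : 1 - x ^+ 2 = (1 - x) * (1 + x).
    by rewrite mulrBl mul1r mulrDr mulr1 expr2 opprD addrA addrK.
  have f2 : 1 - x ^+ 2 = (1 + x) * (1 - x).
    by rewrite mulrDl mul1r mulrBr mulr1 expr2 addrA subrK.
  rewrite {1}f1 f2 !mulrA e1 e2 !mul1r addrACA subrr addr0.
  have -> : 1 + 1 = (2%:R : R[i]) *: (1 : U) by rewrite scaler_nat.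
  by rewrite scalerA mulVf ?scale1r ?pnatr_eq0.
- rewrite NZ h2 -(half M M) ler_wpM2l ?invr_ge0 //.
  by apply: le_trans (ND _ _) _; apply: lerD; apply: GM; rewrite ?wr.
- rewrite -scalerBr NZ h2 -[leRHS](half _ 0) ler_wpM2l ?invr_ge0 //.
  rewrite opprD addrACA; apply: le_trans (ND _ _) _; apply: lerD; first exact: GL.
  by apply: le_trans (GL _ _ _ _) _; rewrite ?wr // -mulrBr wr.
Qed.

(** For positive [l], this forces the spectral radius of [a] to be at most [l^-1], without taking
    roots or limits. *)
Definition power_bounded (l : R) := exists C : R, forall n, l ^+ n * N (a ^+ n) <= C.

Lemma power_bounded_le (l m : R) : 0 <= m <= l -> power_bounded l -> power_bounded m.
Proof.
move=> /andP[m0 ml] [C CP]; exists C => n; apply: le_trans (CP n).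
by rewrite ler_wpM2r // lerXn2r // ?nnegrE // (le_trans m0).
Qed.

(** One good exponent [q] is enough: divide [n] by [q] and bound the finitely many remainders by
    their sum. *)
Lemma power_bounded1 (l : R) (q : nat) :
  0 <= l -> (0 < q)%N -> l ^+ q * N (a ^+ q) <= 1 -> power_bounded l.
Proof.
move=> l0 q0 lq.
pose C := \sum_(j < q) l ^+ j * N (a ^+ j).
have Cj j : (j < q)%N -> l ^+ j * N (a ^+ j) <= C.
  move=> jq; rewrite /C (bigD1 (Ordinal jq)) //= lerDl sumr_ge0 // => i _.
  by rewrite mulr_ge0 ?exprn_ge0.
exists C => n; rewrite (divn_eq n q) mulnC.
elim: (n %/ q)%N => [|k IH]; first by rewrite muln0 add0n Cj // ltn_mod.
apply: le_trans IH; rewrite mulnS -addnA !(exprD _ q).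
rewrite -[leRHS]mul1r.
have : N (a ^+ q * a ^+ (q * k + n %% q)) <= N (a ^+ q) * N (a ^+ (q * k + n %% q)) by exact: NM.
move=> h; apply: (@le_trans _ _ ((l ^+ q * N (a ^+ q)) *
  (l ^+ (q * k + n %% q) * N (a ^+ (q * k + n %% q))))).
  rewrite mulrACA ler_wpM2l // mulr_ge0 ?exprn_ge0 //.
by rewrite ler_wpM2r // mulr_ge0 ?exprn_ge0.
Qed.

(** Since [l' < l], some power [(l' a) ^+ q] is so small that [G l'] is within 1/4 of 1. The
    Lipschitz bound, which does not depend on [q], puts [G m] within 1/2 of 1; then
    [y = (G m - 1) - (G m - 1) * y] gives [N y <= 1]. *)
Lemma power_bounded_step (r M : R) : 1 <= M ->
  (forall l, cmod l <= r -> N (Res l) <= M) ->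
  forall l l' m : R, 0 <= l' < l -> l' <= m <= r ->
  (m - l') * (M * N a * M) <= 4^-1 -> power_bounded l -> power_bounded m.
Proof.
move=> M1 MP l l' m /andP[l'0 l'l] /andP[l'm mr] d [C CP].
have l0 : 0 < l by apply: le_lt_trans l'l.
have M0 : 0 < M by lra.
have m0 : 0 <= m by lra.
have [n nP] : exists n, l' ^+ (2 ^ n) * N (a ^+ (2 ^ n)) <= (4 * M)^-1.
  have q1 : `|l' / l| < 1 by rewrite ger0_norm ?divr_ge0 ?(ltW l0) // ltr_pdivrMr // mul1r.
  have : (C * (l' / l) ^+ n @[n --> \oo] --> C * 0).
    by apply: cvgM; [exact: cvg_cst | exact: cvg_expr].
  rewrite mulr0 => /cvgrPdist_le/(_ (4 * M)^-1)[|n _ nP]; first by rewrite invr_gt0; lra.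
  exists n; have n2 : (n <= 2 ^ n)%N by rewrite ltnW // ltn_expl.
  have := nP (2 ^ n)%N n2.
  rewrite sub0r normrN => /(le_trans (ler_norm _)); apply: le_trans.
  have -> : l' ^+ (2 ^ n) = (l' / l) ^+ (2 ^ n) * l ^+ (2 ^ n).
    by rewrite -exprMn divfK // gt_eqF.
  rewrite -mulrA mulrC ler_wpM2r ?exprn_ge0 ?divr_ge0 ?(ltW l0) //.
have [G [G1 GM GL]] := power_resolvent MP n.
set q := (2 ^ n)%N in nP G1.
have q0 : (0 < q)%N by rewrite expn_gt0.
apply: (power_bounded1 m0 q0).
have xE t : 0 <= t -> N ((t%:C *: a) ^+ q) = t ^+ q * N (a ^+ q).
  by move=> t0; rewrite exprZn NZ cmodX cmod_real.
rewrite -xE //; set y := (m%:C *: a) ^+ q.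
have l'r : cmod l'%:C <= r by rewrite cmod_real //; lra.
have mr' : cmod m%:C <= r by rewrite cmod_real.
have step1 : N (G l'%:C - 1) <= 4^-1.
  rewrite -(G1 l'%:C) mulrBr mulr1 opprB addrC subrK.
  apply: le_trans (NM _ _) _; rewrite xE //.
  apply: (@le_trans _ _ (M * (4 * M)^-1)).
    by apply: ler_pM => //; [rewrite mulr_ge0 ?exprn_ge0 | exact: GM].
  by rewrite invfM mulrCA divff ?mulr1 // gt_eqF.
have step2 : N (G m%:C - 1) <= 2^-1.
  have -> : G m%:C - 1 = (G m%:C - G l'%:C) + (G l'%:C - 1) by rewrite addrA subrK.
  apply: le_trans (ND _ _) _.
  have : N (G m%:C - G l'%:C) <= 4^-1.
    apply: le_trans (GL _ _ mr' l'r) _.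
    by rewrite -rmorphB /= cmod_real ?subr_ge0.
  by lra.
have yE : y = (G m%:C - 1) - (G m%:C - 1) * y.
  have e : G m%:C - G m%:C * y = 1 by rewrite -[RHS](G1 m%:C) mulrBr mulr1.
  by rewrite mulrBl mul1r opprB addrCA addrAC e subrr addr0.
have : N y <= 2^-1 + 2^-1 * N y.
  rewrite {1}yE; apply: le_trans (seminormB _ _) _; apply: lerD => //.
  by apply: le_trans (NM _ _) _; rewrite ler_wpM2r.
by lra.
Qed.

Lemma spectral_radius0 (r : R) : 0 <= r -> power_bounded r.
Proof.
move=> r0; have [M0 M0P] := resolvent_bounded r.
pose M := Num.max 1 M0.
have M1 : 1 <= M by rewrite le_max lexx.
have MP l : cmod l <= r -> N (Res l) <= M.
  by move=> /M0P h; rewrite le_max h orbT.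
pose L := M * N a * M.
have L0 : 0 <= L by rewrite !mulr_ge0 //; lra.
have Na0 : 0 < N a + 1 by rewrite ltr_wpDl.
pose l0 := (N a + 1)^-1.
have l00 : 0 < l0 by rewrite invr_gt0.
(* A step goes from [l - eta] to at most [l + eta], so [2 * eta * L <= 4^-1] is required;
   [eta <= l0] keeps [l - eta] nonnegative. As [eta] does not depend on [l], finitely many steps
   reach [r]. *)
pose eta := Num.min l0 (8 * (L + 1))^-1.
have L1 : 0 < 8 * (L + 1) by lra.
have eta0 : 0 < eta by rewrite lt_min l00 invr_gt0.
have etaL : 2 * eta * L <= 4^-1.
  have : eta <= (8 * (L + 1))^-1 by rewrite ge_min lexx orbT.
  move=> /(ler_wpM2r (ltW L1)); rewrite mulVf ?gt_eqF // => h.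
  by have : 0 <= eta * L; [rewrite mulr_ge0 // ltW | nra].
have etal0 : eta <= l0 by rewrite ge_min lexx.
have base : power_bounded l0.
  apply: (@power_bounded1 _ 1%N); rewrite ?(ltW l00) // !expr1.
  by rewrite /l0 mulrC ler_pdivrMr // mul1r lerDl.
have ind k m : 0 <= m <= r -> m <= l0 + k%:R * eta -> power_bounded m.
  elim: k m => [|k IH] m /andP[m0 mr] mk.
    by apply: power_bounded_le base; rewrite m0; lra.
  have [ml0|l0m] := leP m l0; first by apply: power_bounded_le base; rewrite m0.
  pose l := Num.max l0 (m - eta).
  have [ll0 lm] : l0 <= l /\ m - eta <= l by rewrite !le_max !lexx orbT.
  have lm' : l <= m by rewrite ge_max (ltW l0m); lra.
  have lk : l <= l0 + k%:R * eta.
    rewrite ge_max lerDl mulr_ge0 ?(ltW eta0) //=.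
    by move: mk; rewrite -natr1; lra.
  have Bl : power_bounded l by apply: IH => //; apply/andP; split; lra.
  apply: (power_bounded_step M1 MP (l := l) (l' := l - eta)) => //; last first.
  - apply: le_trans etaL; rewrite -/L ler_wpM2r //; lra.
  - by apply/andP; split; lra.
  - by apply/andP; split; lra.
have [k kP] : exists k, r / eta <= k%:R.
  by exists (Num.truncn (r / eta)).+1; rewrite ltW // truncnS_gt.
apply: (ind k); first by rewrite r0 lexx.
by move: kP; rewrite ler_pdivrMr //; lra.
Qed.

End SpectralRadius.

(** * Seminorms on Banach algebras *)

Section RealNorm.
Variables (R : realType) (V : normedModType R[i]).
Implicit Types x y : V.

Lemma rnormE x : (rnorm x)%:C = `|x|.
Proof. by rewrite /rnorm RRe_real // ger0_real. Qed.

Lemma rnorm_ge0 x : 0 <= rnorm x.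
Proof. by rewrite -lecR rnormE; exact: normr_ge0. Qed.

Lemma rnormD x y : rnorm (x + y) <= rnorm x + rnorm y.
Proof. by rewrite -lecR rmorphD /= !rnormE ler_normD. Qed.

Lemma rnormZ c x : rnorm (c *: x) = cmod c * rnorm x.
Proof. by apply: complexI; rewrite rmorphM /= cmodE !rnormE normrZ. Qed.

Lemma rnormN x : rnorm (- x) = rnorm x.
Proof. by rewrite /rnorm normrN. Qed.

Lemma rnormBC x y : rnorm (x - y) = rnorm (y - x).
Proof. by rewrite -rnormN opprB. Qed.

Lemma rnorm0 : rnorm (0 : V) = 0.
Proof. by rewrite /rnorm normr0. Qed.

Lemma rnorm_eq0 x : rnorm x = 0 -> x = 0.
Proof. by move=> x0; apply/eqP; rewrite -normr_eq0 -rnormE x0. Qed.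

Lemma ball_rnorm x (e : R) y : ball x e%:C y <-> rnorm (x - y) < e.
Proof. by rewrite -ball_normE /ball_ /= -rnormE ltcR. Qed.

Lemma gt0_complexE (e : R[i]) : 0 < e -> e = (complex.Re e)%:C.
Proof. by move=> e0; rewrite RRe_real // gtr0_real. Qed.

Lemma closure_rnorm (S : set V) x :
  closure S x <-> forall e : R, 0 < e -> exists2 s, S s & rnorm (x - s) < e.
Proof.
split=> [cx e e0|h B /nbhs_ballP[e /= e0 eB]].
  have eC : 0 < e%:C by rewrite ltcR.
  have [s [Ss /ball_rnorm xs]] := cx _ (nbhsx_ballx x _ eC).
  by exists s.
have e0' := e0; rewrite (gt0_complexE e0) ltcR in e0'.
have [s Ss xs] := h _ e0'; exists s; split=> //; apply: eB.
by rewrite (gt0_complexE e0); apply/ball_rnorm.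
Qed.

End RealNorm.

Section BanachAlgebra.
Variables (R : realType) (A : banachAlgType R).
Implicit Types a b x y : A.

Lemma rnormM x y : rnorm (bmul x y) <= rnorm x * rnorm y.
Proof. by rewrite -lecR rmorphM /= !rnormE ler_bmul. Qed.

Lemma bmulDl x y z : bmul (x + y) z = bmul x z + bmul y z.
Proof. by have := bmul_linearl 1 x y z; rewrite !scale1r. Qed.

Lemma bmulDr x y z : bmul z (x + y) = bmul z x + bmul z y.
Proof. by have := bmul_linearr 1 x y z; rewrite !scale1r. Qed.

Lemma bmul0 x : bmul 0 x = 0.
Proof. by apply: (addrI (bmul 0 x)); rewrite -bmulDl !addr0. Qed.

Lemma bmulr0 x : bmul x 0 = 0.
Proof. by apply: (addrI (bmul x 0)); rewrite -bmulDr !addr0. Qed.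

Lemma bmulZl c x y : bmul (c *: x) y = c *: bmul x y.
Proof. by have := bmul_linearl c x 0 y; rewrite bmul0 !addr0. Qed.

Lemma bmulZr c x y : bmul x (c *: y) = c *: bmul x y.
Proof. by have := bmul_linearr c y 0 x; rewrite bmulr0 !addr0. Qed.

Lemma bmulNl x y : bmul (- x) y = - bmul x y.
Proof. by rewrite -scaleN1r bmulZl scaleN1r. Qed.

Lemma bmulNr x y : bmul x (- y) = - bmul x y.
Proof. by rewrite -scaleN1r bmulZr scaleN1r. Qed.

Lemma bmulBl x y z : bmul (x - y) z = bmul x z - bmul y z.
Proof. by rewrite bmulDl bmulNl. Qed.

Lemma bmulBr x y z : bmul z (x - y) = bmul z x - bmul z y.
Proof. by rewrite bmulDr bmulNr. Qed.

(** With a unit the equation would read [(1 + y) * (1 - x) = 1]; the iterates are the partial sums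
    of [x + x^2 + ...]. *)
Lemma geometric_quasi_inverse x : rnorm x < 1 -> exists y, y = x + bmul y x.
Proof.
move=> x1; set q := rnorm x in x1; have q0 : 0 <= q by exact: rnorm_ge0.
pose y n := iter n (fun z => x + bmul z x) 0.
have yS n : y n.+1 = x + bmul (y n) x by [].
pose B := q / (1 - q).
have q1 : 0 < 1 - q by rewrite subr_gt0.
have BE : q + B * q = B by rewrite /B; field; rewrite gt_eqF.
have B0 : 0 <= B by rewrite divr_ge0 // ltW.
have yB n : rnorm (y n) <= B.
  elim: n => [|n IH]; first by rewrite rnorm0.
  rewrite yS; apply: le_trans (rnormD _ _) _; rewrite -BE lerD2l.
  by apply: le_trans (rnormM _ _) _; rewrite ler_wpM2r.
have yC n k : rnorm (y (n + k)%N - y n) <= B * q ^+ n.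
  elim: n => [|n IH]; first by rewrite subr0 mulr1.
  rewrite addSn !yS opprD addrACA subrr add0r -bmulBl.
  by apply: le_trans (rnormM _ _) _; rewrite exprSr mulrA ler_wpM2r.
have Bq : B * q ^+ n @[n --> \oo] --> 0.
  rewrite -[X in _ --> X](mulr0 B); apply: cvgM; [exact: cvg_cst | apply: cvg_expr].
  by rewrite ger0_norm.
have small (e : R) : 0 < e -> exists n, B * q ^+ n < e.
  move=> e0; have /cvgrPdist_lt/(_ e e0)[n _ nP] := Bq.
  by exists n; have := nP n (leqnn n); rewrite sub0r normrN => /(le_lt_trans (ler_norm _)).
have : cauchy (y @ \oo).
  apply: cauchy_exP => e e0; have e0' := e0; rewrite (gt0_complexE e0) ltcR in e0'.
  have [n nP] := small _ e0'; exists (y n); exists n => // m /= nm.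
  rewrite (gt0_complexE e0); apply/ball_rnorm; rewrite rnormBC -(subnKC nm).
  exact: le_lt_trans (yC _ _) nP.
move/cauchy_cvg/cvg_ex => [l yl]; exists l.
have yle (e : R) : 0 < e -> \forall n \near \oo, rnorm (l - y n) < e.
  move=> e0; have eC : 0 < e%:C by rewrite ltcR.
  have := yl _ (nbhsx_ballx l _ eC); rewrite /= !nbhs_simpl /=.
  by apply: filterS => n /ball_rnorm.
apply/eqP; rewrite -subr_eq0; apply/eqP/rnorm_eq0/eqP.
rewrite eq_le rnorm_ge0 andbT; apply/ler_addgt0Pr => e e0; rewrite add0r.
have e2 : 0 < e / 2 by rewrite divr_gt0.
have [n1 _ P1] := yle _ e2.
pose n := n1; have h1 := P1 n (leqnn n); have h2 := P1 n.+1 (leqW (leqnn n)).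
have -> : l - (x + bmul l x) = (l - y n.+1) + bmul (y n - l) x.
  by rewrite yS bmulBl !opprD !addrA subrK addrAC.
apply: le_trans (rnormD _ _) _; rewrite -[leRHS]addr0.
have h3 : rnorm (bmul (y n - l) x) <= rnorm (y n - l) * q by exact: rnormM.
have h4 : rnorm (y n - l) * q <= rnorm (y n - l) by rewrite ler_piMr ?rnorm_ge0 // ltW.
rewrite rnormBC in h4; move: h3; rewrite [X in _ <= X * q]rnormBC.
lra.
Qed.

Lemma closed_ideal_ext (I J : closed_ideal A) : I `<=>` J -> I = J.
Proof.
case: I J => [I Ii Ic] [J Ji Jc] /= /seteqP IJ; move: IJ Ii Ic Ji Jc => -> *.
by congr ClosedIdeal; exact: Prop_irrelevance.
Qed.

Section InfSeminorm.
Variables (D : set A) (cost : A -> A -> R).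
Hypothesis D0 : D 0.
Hypothesis DD : forall n m, D n -> D m -> D (n + m).
Hypothesis DZ : forall (c : R[i]) n, D n -> D (c *: n).
Hypothesis cost_ge0 : forall x n, 0 <= cost x n.
Hypothesis costD : forall x y n m, cost (x + y) (n + m) <= cost x n + cost y m.
Hypothesis costZ : forall (c : R[i]) x n, cost (c *: x) (c *: n) = cmod c * cost x n.
Hypothesis costM : forall x y n m, D n -> D m ->
  exists2 k, D k & cost (bmul x y) k <= cost x n * cost y m.
Hypothesis cost_le : forall x, cost x 0 <= rnorm x.

(** Serves twice: for the quotient norm, with cost [rnorm (x + n)], and for the norms that prove
    semiprimeness, with cost [q (x - n) + t * q n]. *)
Definition inf_cost a : R := inf [set cost a n | n in D].

Lemma inf_cost_has_inf a : has_inf [set cost a n | n in D].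
Proof.
by split; [exists (cost a 0), 0 | exists 0 => _ [n _ <-]; exact: cost_ge0].
Qed.

Lemma inf_cost_ge0 a : 0 <= inf_cost a.
Proof.
apply: lb_le_inf; first by have [] := inf_cost_has_inf a.
by move=> _ [n _ <-]; exact: cost_ge0.
Qed.

Lemma inf_cost_lb a n : D n -> inf_cost a <= cost a n.
Proof. by move=> Dn; apply: ge_inf; [exact: (inf_cost_has_inf a).2 | exists n]. Qed.

Lemma inf_cost_approx a e : 0 < e -> exists2 n, D n & cost a n < inf_cost a + e.
Proof.
move=> e0; have [_ [n Dn <-] h] := inf_adherent e0 (inf_cost_has_inf a).
by exists n.
Qed.

Lemma inf_cost_le a : inf_cost a <= rnorm a.
Proof. exact: le_trans (inf_cost_lb a D0) (cost_le a). Qed.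

Lemma inf_costD a b : inf_cost (a + b) <= inf_cost a + inf_cost b.
Proof.
apply/ler_addgt0Pr => e e0; have e2 : 0 < e / 2 by rewrite divr_gt0.
have [n Dn hn] := inf_cost_approx a e2.
have [m Dm hm] := inf_cost_approx b e2.
have := inf_cost_lb (a + b) (DD Dn Dm).
by have := costD a b n m; lra.
Qed.

Lemma inf_costZ c a : inf_cost (c *: a) = cmod c * inf_cost a.
Proof.
have le d b : inf_cost (d *: b) <= cmod d * inf_cost b.
  apply/ler_addgt0Pr => e e0.
  have d1 : 0 < cmod d + 1 by rewrite ltr_wpDl ?cmod_ge0.
  have e2 : 0 < e / (cmod d + 1) by rewrite divr_gt0.
  have [n Dn hn] := inf_cost_approx b e2.
  have := inf_cost_lb (d *: b) (DZ d Dn); rewrite costZ.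
  move/le_trans; apply; apply: (@le_trans _ _ (cmod d * (inf_cost b + e / (cmod d + 1)))).
    by rewrite ler_wpM2l ?cmod_ge0 // ltW.
  rewrite mulrDr lerD2l mulrCA -[leRHS]mulr1 ler_wpM2l ?(ltW e0) //.
  by rewrite ler_pdivrMr // mul1r lerDl.
apply/eqP; rewrite eq_le le /=.
have [->|c0] := eqVneq c 0; first by rewrite cmod0 mul0r inf_cost_ge0.
have cc : cmod c * cmod c^-1 = 1 by rewrite -cmodM mulfV // cmod1.
have := le c^-1 (c *: a); rewrite scalerA mulVf // scale1r.
by move/(ler_wpM2l (cmod_ge0 c)); rewrite mulrA cc mul1r.
Qed.

Lemma inf_costM a b : inf_cost (bmul a b) <= inf_cost a * inf_cost b.
Proof.
have key (e : R) : 0 < e -> inf_cost (bmul a b) <=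
    (inf_cost a + e) * (inf_cost b + e).
  move=> e0; have [n Dn hn] := inf_cost_approx a e0.
  have [m Dm hm] := inf_cost_approx b e0.
  have [k Dk hk] := costM a b Dn Dm.
  apply: le_trans (inf_cost_lb _ Dk) _; apply: le_trans hk _.
  by apply: ler_pM; rewrite ?cost_ge0 // ltW.
set u := inf_cost a in key *; set v := inf_cost b in key *.
have u0 : 0 <= u by exact: inf_cost_ge0.
have v0 : 0 <= v by exact: inf_cost_ge0.
apply/ler_addgt0Pr => e e0.
pose d := Num.min 1 (e / (u + v + 1)).
have uv : 0 < u + v + 1 by lra.
have d0 : 0 < d by rewrite lt_min ltr01 divr_gt0.
have d1 : d <= 1 by rewrite ge_min lexx.
have de : d * (u + v + 1) <= e.
  by rewrite -ler_pdivlMr // ge_min lexx orbT.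
apply: le_trans (key d d0) _.
have : d * d <= d by rewrite ler_piMr // ltW.
by nra.
Qed.

Definition inf_cost_seminorm : bseminorm A 1.
Proof.
refine (@BSeminorm R A 1 inf_cost inf_cost_ge0 inf_costD inf_costZ inf_costM _).
by move=> a; rewrite mul1r inf_cost_le.
Defined.

End InfSeminorm.

Section TwoSidedIdeal.
Variables (I : set A) (I_ideal : two_sided_ideal I).

Lemma tsi0 : I 0. Proof. by have [] := I_ideal. Qed.
Lemma tsiD x y : I x -> I y -> I (x + y).
Proof. by have [_ IL _ _] := I_ideal; move=> /(IL 1) h /h; rewrite scale1r. Qed.
Lemma tsiZ c x : I x -> I (c *: x).
Proof. by have [I0 IL _ _] := I_ideal; move=> Ix; rewrite -[_ *: _]addr0; exact: IL. Qed.
Lemma tsiN x : I x -> I (- x).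
Proof. by move=> Ix; rewrite -scaleN1r; exact: tsiZ. Qed.
Lemma tsiMl a x : I x -> I (bmul a x). Proof. by have [_ _ + _] := I_ideal; apply. Qed.
Lemma tsiMr a x : I x -> I (bmul x a). Proof. by have [_ _ _] := I_ideal; apply. Qed.

Definition quotient_seminorm : bseminorm A 1.
Proof.
refine (@inf_cost_seminorm I (fun x p => rnorm (x + p)) tsi0 tsiD tsiZ _ _ _ _ _).
- by move=> *; exact: rnorm_ge0.
- by move=> x y p q; rewrite addrACA rnormD.
- by move=> c x p; rewrite -scalerDr rnormZ.
- move=> x y p q Ip Iq; exists (bmul x q + bmul p (y + q)).
    by apply: tsiD; [exact: tsiMl | exact: tsiMr].
  apply: le_trans (rnormM _ _); rewrite [X in X <= _](_ : _ = rnorm (bmul (x + p) (y + q))) //.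
  by rewrite bmulDl (bmulDr y q x) addrA.
- by move=> x; rewrite addr0.
Defined.

Lemma quotient_seminormE a : quotient_seminorm a = quotient_norm a I.
Proof. by []. Qed.

Lemma quotient_norm_ge0 a : 0 <= quotient_norm a I.
Proof. by rewrite -quotient_seminormE seminorm_ge0. Qed.

Lemma quotient_norm_lb a p : I p -> quotient_norm a I <= rnorm (a + p).
Proof.
move=> Ip; apply: (@inf_cost_lb I (fun x p => rnorm (x + p)) tsi0 _ a p Ip) => *.
exact: rnorm_ge0.
Qed.

Lemma quotient_norm_approx a e : 0 < e ->
  exists2 p, I p & rnorm (a + p) < quotient_norm a I + e.
Proof.
move=> e0; apply: (@inf_cost_approx I (fun x p => rnorm (x + p)) tsi0 _ a e e0) => *.
exact: rnorm_ge0.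
Qed.

Lemma quotient_norm_eq0 a : closed I -> quotient_norm a I = 0 -> I a.
Proof.
move=> Icl a0; apply: Icl; apply/closure_rnorm => e e0.
have [p Ip] := quotient_norm_approx a e0; rewrite a0 add0r => h.
by exists (- p); [exact: tsiN | rewrite opprK].
Qed.

Lemma quotient_norm0 a : I a -> quotient_norm a I = 0.
Proof.
move=> Ia; apply/eqP; rewrite eq_le quotient_norm_ge0 andbT.
by have := quotient_norm_lb a (tsiN Ia); rewrite subrr rnorm0.
Qed.

End TwoSidedIdeal.

Lemma quotient_norm_anti (I J : set A) a : two_sided_ideal I -> two_sided_ideal J ->
  I `<=` J -> quotient_norm a J <= quotient_norm a I.
Proof.
move=> Ii Ji IJ; apply/ler_addgt0Pr => e e0.
have [p Ip hp] := quotient_norm_approx Ii a e0.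
by apply: le_trans (quotient_norm_lb Ji a (IJ _ Ip)) _; rewrite ltW.
Qed.

(** * Comparing seminorms under the Hausdorff hypothesis *)

Section Hausdorff.
Hypothesis tauH : hausdorff_space (closed_ideal A).

(** Compactness of the space of seminorms: each value stays in a compact segment, and the defining
    inequalities are closed conditions. *)
Lemma bseminorm_ultra_cvg (k : nat) (T : topologicalType) (G : set_system T)
    (rho : T -> bseminorm A k) : UltraFilter G ->
  exists r : bseminorm A k, forall x, rho t x @[t --> G] --> r x.
Proof.
move=> GU; have GP : ProperFilter G by exact: ultra_proper.
have /choice[l lP] x : exists y : R, rho t x @[t --> G] --> y.
  have := @segment_compact R 0 (k%:R * rnorm x).
  move=> /(_ (rho t x @[t --> G])) [].
    by apply: (@filterE _ G) => t /=; rewrite in_itv /= seminorm_ge0 seminorm_le.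
  move=> y [_ yc]; exists y => V /= Vy.
  have [//|nV] := in_ultra_setVsetC ((fun t => rho t x) @^-1` V) GU.
  by have [z [nVz Vz]] := yc (~` V) V nV Vy.
have le_lim (f g : T -> R) (u v : R) : f t @[t --> G] --> u -> g t @[t --> G] --> v ->
    (forall t, f t <= g t) -> u <= v.
  by move=> fu gv fg; apply: (ler_cvg_to fu gv); exact: (@filterE _ G _ _ fg).
have l_ge0 a : 0 <= l a.
  by apply: (le_lim (fun=> 0) _ _ _ (cvg_cst _) (lP a)) => t; exact: seminorm_ge0.
have lD a b : l (a + b) <= l a + l b.
  by apply: (le_lim _ _ _ _ (lP _) (cvgD (lP a) (lP b))) => t; exact: seminormD.
have lZ (c : R[i]) a : l (c *: a) = complex.Re `|c| * l a.
  apply/eqP; rewrite eq_le; apply/andP; split.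
    by apply: (le_lim _ _ _ _ (lP _) (cvgM (cvg_cst _) (lP a))) => t; rewrite seminormZ.
  by apply: (le_lim _ _ _ _ (cvgM (cvg_cst _) (lP a)) (lP _)) => t; rewrite seminormZ.
have lM a b : l (bmul a b) <= l a * l b.
  by apply: (le_lim _ _ _ _ (lP _) (cvgM (lP a) (lP b))) => t; exact: seminormM.
have l_le a : l a <= k%:R * rnorm a.
  by apply: (le_lim _ _ _ _ (lP a) (cvg_cst _)) => t; exact: seminorm_le.
by exists (BSeminorm l_ge0 lD lZ lM l_le).
Qed.

Lemma bseminorm_nbhs_cvg (k : nat) (T : Type) (G : set_system T)
    (rho : T -> bseminorm A k) (r : bseminorm A k) (W : set (bseminorm A k)) :
  Filter G -> (forall x, rho t x @[t --> G] --> r x) -> open W -> W r ->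
  G [set t | W (rho t)].
Proof.
move=> GF r_cvg [B Bop <-] Br.
have cvg_r := (@pointwise_cvgP A R ((fun t => rho t : A -> R) @ G) r _).2 r_cvg.
by apply: (cvg_r _ B); exact: open_nbhs_nbhs.
Qed.

(* The kernel map is continuous on the compact space of seminorms, so two
   limits of seminorms with equal kernels have equal kernels. *)
Lemma same_kernel_cvg0 (k : nat) (rho sig : nat -> bseminorm A k) w :
  (0 < k)%N -> (forall n x, rho n x = 0 <-> sig n x = 0) ->
  rho n w @[n --> \oo] --> 0 -> sig n w @[n --> \oo] --> 0.
Proof.
move=> k0 ker_eq rho0; apply/cvgrPdist_lt => e e0; apply: contrapT => nS.
pose S := [set n | e <= sig n w].
have WP : ProperFilter (within S \oo).
  apply: Build_ProperFilter_ex => P [n _ nP].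
  apply: contrapT => h; apply: nS; exists n => // m /= nm.
  rewrite sub0r normrN ger0_norm ?seminorm_ge0 // ltNge; apply/negP => Sm.
  by apply: h; exists m; apply: (nP m nm).
have [G [GU FG]] := ultraFilterLemma WP.
have GP : ProperFilter G by exact: ultra_proper.
have GS : G S by apply: FG; apply: (@filterE _ \oo) => n.
have Goo P : (\oo : set_system nat) P -> G P.
  by move=> ooP; apply: FG; move: ooP; apply: filterS => n Pn _.
have [r rP] := bseminorm_ultra_cvg rho GU.
have [s sP] := bseminorm_ultra_cvg sig GU.
have rw : r w = 0.
  apply: (cvg_unique (@Rhausdorff R) (rP w)).
  by apply: cvg_trans rho0 => V /= oV; exact: Goo.
have sw : e <= s w.
  by apply: (ler_cvg_to (cvg_cst e) (sP w)); exact: GS.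
have ker_rs : seminorm_ker r = seminorm_ker s.
  apply/eqP; apply: contrapT => /negP rs.
  move: tauH; rewrite open_hausdorff => /(_ _ _ rs)[[W1 W2] /= [/set_mem r1 /set_mem s2]].
  move=> [W1o W2o /eqP W0].
  have G1 := bseminorm_nbhs_cvg GP rP (W1o k k0) r1.
  have G2 := bseminorm_nbhs_cvg GP sP (W2o k k0) s2.
  have [n [/= n1 n2]] := @filter_ex _ G GP _ (filterI G1 G2).
  have : (W1 `&` W2) (seminorm_ker (rho n)).
    split=> //; rewrite (_ : seminorm_ker (rho n) = seminorm_ker (sig n)) //.
    by apply: closed_ideal_ext; split=> x /= /ker_eq.
  by rewrite W0.
have : (seminorm_ker s : set A) w by rewrite -ker_rs.
by move=> /= sw0; move: sw; rewrite sw0 leNgt e0.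
Qed.

End Hausdorff.
End BanachAlgebra.

(** * Seminorms with equal kernels *)

Section Ideals.
Variables (R : realType) (A : banachAlgType R).
Implicit Types a b x y : A.

Section SupSeminorm.
Variable S : set (closed_ideal A).
Hypothesis S0 : S !=set0.

Definition sup_norm a : R := sup [set quotient_norm a N | N in S].

Lemma sup_norm_has_sup a : has_sup [set quotient_norm a N | N in S].
Proof.
have [N SN] := S0; split; first by exists (quotient_norm a N), N.
exists (rnorm a) => _ [M _ <-].
have := seminorm_le (quotient_seminorm (ideal_two_sided M)) a.
by rewrite mul1r.
Qed.

Lemma sup_norm_ub a (N : closed_ideal A) : S N -> quotient_norm a N <= sup_norm a.
Proof. by move=> SN; apply: ub_le_sup; [exact: (sup_norm_has_sup a).2 | exists N]. Qed.

Lemma sup_norm_le a (u : R) :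
  (forall N : closed_ideal A, S N -> quotient_norm a N <= u) -> sup_norm a <= u.
Proof.
move=> h; apply: ge_sup; first by have [] := sup_norm_has_sup a.
by move=> _ [N SN <-]; exact: h.
Qed.

Lemma sup_norm_ge0 a : 0 <= sup_norm a.
Proof.
have [N SN] := S0; apply: le_trans (sup_norm_ub a SN).
exact: quotient_norm_ge0 (ideal_two_sided N) a.
Qed.

Definition sup_seminorm : bseminorm A 1.
Proof.
pose q (N : closed_ideal A) := quotient_seminorm (ideal_two_sided N).
refine (@BSeminorm R A 1 sup_norm sup_norm_ge0 _ _ _ _).
- move=> a b; apply: sup_norm_le => N SN; apply: le_trans (seminormD (q N) a b) _.
  by apply: lerD; exact: sup_norm_ub.
- move=> c a; have cZ (N : closed_ideal A) := seminormZ (q N) c a.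
  have [->|c0] := eqVneq c 0.
    apply/eqP; rewrite eq_le normr0 mul0r sup_norm_ge0 andbT.
    by apply: sup_norm_le => N _; rewrite -[quotient_norm _ _]/(q N (0 *: a)) seminormZ normr0 mul0r.
  have c1 : 0 < cmod c.
    by rewrite lt_neqAle cmod_ge0 andbT eq_sym; apply: contra c0 => /eqP/cmod_eq0->.
  apply/eqP; rewrite eq_le; apply/andP; split.
    apply: sup_norm_le => N SN; rewrite -[leLHS]/(q N (c *: a)) seminormZ.
    by rewrite ler_wpM2l ?cmod_ge0 // sup_norm_ub.
  rewrite -/(cmod c) -ler_pdivlMl //; apply: sup_norm_le => N SN.
  by rewrite ler_pdivlMl // -[leLHS]cZ sup_norm_ub.
- move=> a b; apply: sup_norm_le => N SN; apply: le_trans (seminormM (q N) a b) _.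
  by apply: ler_pM; rewrite ?seminorm_ge0 //; exact: sup_norm_ub.
- move=> a; apply: sup_norm_le => N SN; exact: seminorm_le (q N) a.
Defined.

Lemma sup_seminorm_ker a :
  sup_seminorm a = 0 <-> forall N : closed_ideal A, S N -> (N : set A) a.
Proof.
split=> [a0 N SN|aN].
  apply: (quotient_norm_eq0 (ideal_two_sided N) (ideal_closed (c := N))).
  apply/eqP; rewrite eq_le (quotient_norm_ge0 (ideal_two_sided N)) andbT.
  by rewrite -[leRHS]a0; exact: sup_norm_ub.
apply/eqP; rewrite eq_le sup_norm_ge0 andbT; apply: sup_norm_le => N SN.
by rewrite (quotient_norm0 (ideal_two_sided N)) //; exact: aN.
Qed.

End SupSeminorm.

Lemma closed_bigcap (T : Type) (S : set T) (f : T -> set A) :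
  (forall t, S t -> closed (f t)) -> closed (\bigcap_(t in S) f t).
Proof. by move=> fc; apply: closed_bigI. Qed.

Definition ideal_meet (S : set (closed_ideal A)) : closed_ideal A :=
  ClosedIdeal (bigcap_ideal S (fun N : closed_ideal A => ideal_two_sided N))
    (closed_bigcap (fun (N : closed_ideal A) _ => ideal_closed (c := N))).

Hypothesis tauH : hausdorff_space (closed_ideal A).

Lemma harmonic_cvg0 (u : nat -> R) : (forall n, 0 <= u n <= n.+1%:R^-1) ->
  u n @[n --> \oo] --> 0.
Proof.
move=> uh; apply: (@squeeze_cvgr _ _ _ _ (fun=> 0) (fun n => n.+1%:R^-1)).
- by apply: nearW => n; exact: uh.
- exact: cvg_cst.
- exact: cvg_harmonic.
Qed.

(* The supremum of the quotient norms over [S n] and the quotient norm of the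
   intersection of [S n] have the same kernel. *)
Lemma near_ideals_meet (S : nat -> set (closed_ideal A)) (P : closed_ideal A) a :
  (forall n (N : closed_ideal A), S n N -> quotient_norm a N <= n.+1%:R^-1) ->
  (forall n, S n !=set0) -> (forall n, ideal_meet (S n) `<=` P) -> (P : set A) a.
Proof.
move=> Sa S0 SP.
pose q (N : closed_ideal A) := quotient_seminorm (ideal_two_sided N).
have kerE n x : sup_seminorm (S0 n) x = 0 <-> q (ideal_meet (S n)) x = 0.
  rewrite sup_seminorm_ker; split=> [xN|x0 N SN].
    by apply: quotient_norm0 => //; exact: ideal_two_sided.
  have := quotient_norm_eq0 (ideal_two_sided (ideal_meet (S n)))
    (ideal_closed (c := ideal_meet (S n))) x0.
  exact.
have sup0 : sup_seminorm (S0 n) a @[n --> \oo] --> 0.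
  apply: harmonic_cvg0 => n; rewrite seminorm_ge0 /=.
  by apply: sup_norm_le => // N SN; exact: Sa.
have /cvgrPdist_lt h := same_kernel_cvg0 tauH (ltn0Sn 0) kerE sup0.
apply: (quotient_norm_eq0 (ideal_two_sided P) (ideal_closed (c := P))).
apply/eqP; rewrite eq_le quotient_norm_ge0 ?andbT; last exact: ideal_two_sided.
apply/ler_addgt0Pr => e e0; rewrite add0r.
have [n _ nP] := h e e0.
apply: le_trans (quotient_norm_anti _ _ _ (SP n)) _; try exact: ideal_two_sided.
have := nP n (leqnn n); rewrite sub0r normrN ger0_norm ?seminorm_ge0 //.
by move/ltW.
Qed.

Lemma closed_ideal_semiprime (I : set A) a : two_sided_ideal I -> closed I ->
  I (bmul a a) -> (forall b, I (bmul (bmul a b) a)) -> I a.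
Proof.
move=> Ii Ic aa aba.
(* The ideal generated by [I] and [a]. Its minimality reduces [D * D] in [I] to the generators, one
   factor at a time. *)
pose D := [set x | forall J, two_sided_ideal J -> I `<=` J -> J a -> J x].
have Di : two_sided_ideal D.
  split.
  - by move=> J Ji _ _; exact: tsi0.
  - by move=> c x y Dx Dy J Ji IJ Ja; apply: tsiD (tsiZ _ _ _) _ => //; [exact: Dx|exact: Dy].
  - by move=> b x Dx J Ji IJ Ja; apply: tsiMl => //; exact: Dx.
  - by move=> b x Dx J Ji IJ Ja; apply: tsiMr => //; exact: Dx.
have DD x y : D x -> D y -> I (bmul x y).
  have T1 z : D z -> I (bmul a z) /\ forall b, I (bmul (bmul a b) z).
    move=> /(_ [set z | I (bmul a z) /\ forall b, I (bmul (bmul a b) z)]); apply.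
    - split => /=.
      + by split=> [|b]; rewrite bmulr0; exact: tsi0.
      + move=> c u v [u1 u2] [v1 v2]; split=> [|b]; rewrite bmulDr bmulZr;
          apply: tsiD => //; exact: tsiZ.
      + move=> c u [u1 u2]; split=> [|b]; first by rewrite bmulA.
        by rewrite bmulA -(bmulA a b c).
      + by move=> c u [u1 u2]; split=> [|b]; rewrite bmulA; exact: tsiMr.
    - by move=> u Iu; split=> [|b]; exact: tsiMl.
    - by split.
  move=> Dx Dy; have := Dx [set x | forall y, D y -> I (bmul x y) /\ forall b, I (bmul (bmul x b) y)].
  move=> /(_ _ _ _)/(_ y Dy) h; apply: (fun p q r => (h p q r).1).
  - split => /=.
    + by move=> z _; split=> [|b]; rewrite ?bmul0; exact: tsi0.
    + move=> c u v u1 v1 z Dz; have [u2 u3] := u1 z Dz; have [v2 v3] := v1 z Dz.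
      split=> [|b]; rewrite ?(bmulDl (c *: u) v b) bmulDl ?bmulZl;
        apply: tsiD => //; exact: tsiZ.
    + move=> c u u1 z Dz; have [u2 u3] := u1 z Dz; split=> [|b].
        by rewrite -bmulA; exact: tsiMl.
      by rewrite -(bmulA c u b) -bmulA; exact: tsiMl.
    + move=> c u u1 z Dz; have [u2 u3] := u1 z Dz; split=> [|b] //.
      by rewrite -(bmulA u c b).
  - by move=> u Iu z Dz; split=> [|b]; [|apply: tsiMr => //]; exact: tsiMr.
  - by move=> z Dz; exact: T1.
have Da : D a by move=> J _ _.
have ID : I `<=` D by move=> x Ix J _ IJ _; exact: IJ.
pose q := quotient_seminorm Ii.
have q00 : q 0 = 0 := quotient_norm0 Ii (tsi0 Ii).
have qB x y : q x <= q (x - y) + q y by rewrite -{1}(subrK y x); exact: seminormD.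
pose cost (t : R) x n := q (x - n) + t * q n.
pose t (n : nat) : R := n.+1%:R^-1.
have t0 n : 0 <= t n by rewrite invr_ge0.
have /choice[p pE] : forall n, exists p : bseminorm A 1,
    forall x, p x = inf_cost D (cost (t n)) x.
  move=> n.
  unshelve eexists (@inf_cost_seminorm _ _ D (cost (t n)) _ _ _ _ _ _ _ _) => //.
  - exact: tsi0.
  - exact: tsiD.
  - exact: tsiZ.
  - by move=> x m; rewrite addr_ge0 ?mulr_ge0 ?seminorm_ge0.
  - move=> x y m k; rewrite /cost opprD (addrACA x) [leRHS]addrACA -mulrDr.
    by apply: lerD; [exact: seminormD | rewrite ler_wpM2l // seminormD].
  - by move=> c x m; rewrite /cost -scalerBr !seminormZ mulrDr mulrCA.
  (* This witness leaves exactly [(x - m) * (y - k)] as remainder, and its term [bmul m k] is in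
     [I], hence costs nothing. *)
  - move=> x y m k Dm Dk; exists (bmul m (y - k) + bmul (x - m) k + bmul m k).
      apply: (tsiD Di); last by apply: (tsiMr Di).
      by apply: (tsiD Di); [exact: (tsiMr Di) | exact: (tsiMl Di)].
    have mk0 : q (bmul m k) = 0 by apply: quotient_norm0 => //; exact: DD.
    have xyE : bmul x y = bmul (x - m) (y - k) +
        (bmul m (y - k) + bmul (x - m) k + bmul m k).
      have aux u v : bmul (u + m) (v + k) =
          bmul u v + (bmul m v + bmul u k + bmul m k).
        by rewrite bmulDl !bmulDr -!addrA; congr (_ + _); rewrite addrCA.
      by rewrite -aux !subrK.
    rewrite /cost {1}xyE addrK.
    have h1 := seminormM q (x - m) (y - k).
    have h2 := seminormM q m (y - k).
    have h3 := seminormM q (x - m) k.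
    have h4 := seminormD q (bmul m (y - k) + bmul (x - m) k) (bmul m k).
    have h5 := seminormD q (bmul m (y - k)) (bmul (x - m) k).
    rewrite mk0 addr0 in h4.
    have h6 : q (bmul m (y - k) + bmul (x - m) k + bmul m k) <= q m * q (y - k) + q (x - m) * q k by lra.
    have h7 : t n * q (bmul m (y - k) + bmul (x - m) k + bmul m k) <=
      t n * (q m * q (y - k) + q (x - m) * q k) by rewrite ler_wpM2l.
    have h8 : 0 <= t n * q m * (t n * q k) by rewrite !mulr_ge0 ?seminorm_ge0.
    lra.
  - move=> x; rewrite /cost subr0 q00 mulr0 addr0.
    by have := seminorm_le q x; rewrite mul1r.
have costge0 n x m : 0 <= cost (t n) x m.
  by rewrite addr_ge0 ?mulr_ge0 ?seminorm_ge0.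
have t1 n : t n <= 1 by rewrite invf_le1 // ler1n.
have p_ge n x : t n * q x <= p n x.
  rewrite pE; apply: lb_le_inf; first by exists (cost (t n) x 0), 0 => //; exact: tsi0.
  move=> _ [m _ <-]; rewrite /cost.
  have := qB x m; have := t1 n; have := t0 n; have := seminorm_ge0 q (x - m).
  by nra.
have p_le n x m : D m -> p n x <= cost (t n) x m.
  by move=> Dm; rewrite pE; apply: inf_cost_lb => //; exact: tsi0.
have kerE n x : p n x = 0 <-> q x = 0.
  split=> [p0|q0]; apply/eqP; rewrite eq_le seminorm_ge0 andbT.
    have := p_ge n x; rewrite p0 => h.
    by rewrite -(ler_pM2l (_ : 0 < t n)) ?mulr0 // invr_gt0 ltr0n.
  apply: le_trans (p_le n x 0 (tsi0 Di)) _.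
  by rewrite /cost subr0 q0 add0r q00 mulr0.
have p0 : p n a @[n --> \oo] --> 0.
  have : q a * t n @[n --> \oo] --> q a * 0 by apply: cvgM; [exact: cvg_cst | exact: cvg_harmonic].
  rewrite mulr0; apply: (@squeeze_cvgr _ _ _ _ (fun=> 0)); last exact: cvg_cst.
  apply: nearW => n; rewrite seminorm_ge0 /=; apply: le_trans (p_le n a a Da) _.
  by rewrite /cost subrr q00 add0r mulrC.
have := same_kernel_cvg0 tauH (ltn0Sn 0) kerE p0.
move=> /(cvg_unique (@Rhausdorff R) (cvg_cst (q a))) qa0.
have {}qa0 : quotient_norm a I = 0 by exact: qa0.
exact (quotient_norm_eq0 Ii Ic qa0).
Qed.

End Ideals.

(** * Trace operators and renorming *)

Section OperatorNorm.
Variables (R : realType) (U : lmodType R[i]) (T : Type) (D : set T).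
Variables (f : U -> T -> R) (g : T -> R) (N : U -> R).
Hypothesis f_ge0 : forall b t, 0 <= f b t.
Hypothesis g_ge0 : forall t, 0 <= g t.
Hypothesis fD : forall b b' t, f (b + b') t <= f b t + f b' t.
Hypothesis fZ : forall (c : R[i]) b t, f (c *: b) t = cmod c * f b t.
Hypothesis N_ge0 : forall b, 0 <= N b.
Hypothesis f_le : forall b t, D t -> f b t <= N b * g t.

(** The best constant is an infimum of admissible bounds rather than a supremum of quotients,
    because [g] may vanish. *)
Definition opnorm b : R := inf [set K | 0 <= K /\ forall t, D t -> f b t <= K * g t].

Lemma opnorm_has_inf b : has_inf [set K | 0 <= K /\ forall t, D t -> f b t <= K * g t].
Proof.
split; last by exists 0 => K [].
by exists (N b); split=> // t; exact: f_le.
Qed.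

Lemma opnorm_ge0 b : 0 <= opnorm b.
Proof.
by apply: lb_le_inf; [have [] := opnorm_has_inf b | move=> K []].
Qed.

Lemma opnorm_le b K : 0 <= K -> (forall t, D t -> f b t <= K * g t) -> opnorm b <= K.
Proof. by move=> K0 h; apply: ge_inf; [exact: (opnorm_has_inf b).2 | ]. Qed.

Lemma opnorm_leN b : opnorm b <= N b.
Proof. by apply: opnorm_le => // t; exact: f_le. Qed.

Lemma opnormP b t : D t -> f b t <= opnorm b * g t.
Proof.
move=> Dt; apply/ler_addgt0Pr => e e0.
have g1 : 0 < g t + 1 by rewrite ltr_wpDl.
have e1 : 0 < e / (g t + 1) by rewrite divr_gt0.
have [K [K0 KP] hK] := inf_adherent e1 (opnorm_has_inf b).
apply: le_trans (KP t Dt) _.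
apply: (@le_trans _ _ ((opnorm b + e / (g t + 1)) * g t)); first by rewrite ler_wpM2r // ltW.
rewrite mulrDl lerD2l mulrAC ler_pdivrMr // ler_wpM2l ?(ltW e0) //.
by rewrite lerDl.
Qed.

Lemma opnormD b b' : opnorm (b + b') <= opnorm b + opnorm b'.
Proof.
apply: opnorm_le; first by rewrite addr_ge0 ?opnorm_ge0.
move=> t Dt; apply: le_trans (fD _ _ _) _; rewrite mulrDl.
by apply: lerD; exact: opnormP.
Qed.

Lemma opnormZ c b : opnorm (c *: b) = cmod c * opnorm b.
Proof.
have le d a : opnorm (d *: a) <= cmod d * opnorm a.
  apply: opnorm_le; first by rewrite mulr_ge0 ?cmod_ge0 ?opnorm_ge0.
  by move=> t Dt; rewrite fZ -mulrA ler_wpM2l ?cmod_ge0 // opnormP.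
apply/eqP; rewrite eq_le le /=.
have [->|c0] := eqVneq c 0; first by rewrite cmod0 mul0r opnorm_ge0.
have cc : cmod c * cmod c^-1 = 1 by rewrite -cmodM mulfV // cmod1.
have := le c^-1 (c *: b); rewrite scalerA mulVf // scale1r.
by move/(ler_wpM2l (cmod_ge0 c)); rewrite mulrA cc mul1r.
Qed.

Lemma opnorm_eq0 b : opnorm b = 0 <-> forall t, D t -> f b t = 0.
Proof.
split=> [b0 t Dt|b0]; apply/eqP; rewrite eq_le ?f_ge0 ?opnorm_ge0 andbT.
  by have := opnormP b Dt; rewrite b0 mul0r.
by apply: opnorm_le => // t Dt; rewrite b0 // mul0r.
Qed.

End OperatorNorm.

Section TraceSeminorms.
Variables (R : realType) (U : algType R[i]) (N : U -> R).
Hypothesis N_ge0 : forall x, 0 <= N x.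
Hypothesis ND : forall x y, N (x + y) <= N x + N y.
Hypothesis NZ : forall c x, N (c *: x) = cmod c * N x.
Hypothesis NM : forall x y, N (x * y) <= N x * N y.
Hypothesis N1 : N 1 <= 1.
Hypothesis N_eq0 : forall x, N x = 0 -> x = 0.

Let N0 : N 0 = 0.
Proof. by rewrite -(scale0r (0 : U)) NZ cmod0 mul0r. Qed.

Let NX x n : N (x ^+ n) <= N x ^+ n.
Proof. by case: n => [|n]; [rewrite !expr0 | exact: seminormX]. Qed.

Lemma seminorm_sum (I : Type) (s : seq I) (P : pred I) (F : I -> U) :
  N (\sum_(i <- s | P i) F i) <= \sum_(i <- s | P i) N (F i).
Proof.
elim/big_rec2: _ => [|i x y _ h]; first by rewrite N0.
by apply: le_trans (ND _ _) _; rewrite lerD2l.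
Qed.

Lemma seminorm_prod (I : Type) (s : seq I) (F : I -> U) :
  N (\prod_(i <- s) F i) <= \prod_(i <- s) N (F i).
Proof.
elim: s => [|i s IH]; first by rewrite !big_nil.
by rewrite !big_cons; apply: le_trans (NM _ _) _; rewrite ler_wpM2l.
Qed.

Variables (J : set U) (J_ideal : two_ideal J) (a b : U).
Hypothesis Ja : J a.
Hypothesis a_quasinilpotent : forall r : R, 0 <= r -> power_bounded N a r.

(* An equivalent weight for which [x |-> a * x * b] has norm at most [r^-1]. *)
Definition weight (r : R) (x : U) : R :=
  sup [set r ^+ k * N (a ^+ k * x * b ^+ k) | k in [set: nat]].

Lemma weight_has_sup r x : 0 <= r ->
  has_sup [set r ^+ k * N (a ^+ k * x * b ^+ k) | k in [set: nat]].
Proof.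
move=> r0; split; first by exists (r ^+ 0 * N (a ^+ 0 * x * b ^+ 0)), 0%N.
have rb0 : 0 <= r * N b by rewrite mulr_ge0.
have [C CP] := a_quasinilpotent rb0.
exists (C * N x) => _ [k _ <-].
have h1 : N (a ^+ k * x * b ^+ k) <= N (a ^+ k) * N x * N b ^+ k.
  apply: le_trans (NM _ _) _; apply: ler_pM => //; exact: NM.
apply: (@le_trans _ _ ((r * N b) ^+ k * N (a ^+ k) * N x)); last by rewrite ler_wpM2r.
rewrite exprMn; apply: le_trans (ler_wpM2l (exprn_ge0 k r0) h1) _.
by rewrite le_eqVlt; apply/orP; left; apply/eqP; ring.
Qed.

Lemma weight_ub r x k : 0 <= r -> r ^+ k * N (a ^+ k * x * b ^+ k) <= weight r x.
Proof. by move=> r0; apply: ub_le_sup; [exact: (weight_has_sup x r0).2 | exists k]. Qed.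

Lemma le_weight r x : 0 <= r -> N x <= weight r x.
Proof. by move=> /(weight_ub x 0); rewrite !expr0 !mul1r mulr1. Qed.

Lemma weight_ge0 r x : 0 <= r -> 0 <= weight r x.
Proof. by move=> r0; exact: le_trans (N_ge0 x) (le_weight x r0). Qed.

Lemma weight_contract r x : 0 < r -> weight r (a * x * b) <= r^-1 * weight r x.
Proof.
move=> r0; apply: ge_sup; first by have [] := weight_has_sup (a * x * b) (ltW r0).
move=> _ [k _ <-]; rewrite ler_pdivlMl // [r * (_ * _)]mulrA -exprS.
have -> : a ^+ k * (a * x * b) * b ^+ k = a ^+ k.+1 * x * b ^+ k.+1.
  by rewrite exprSr exprS !mulrA.
exact: weight_ub (ltW r0).
Qed.

Variables (m : nat) (y : 'I_m.+1 -> U).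
Hypothesis Jy : forall i, J (y i).
Hypothesis capJ : capelli_identity J m.+2.

Let D := [set x : 'I_m.+1 -> U | forall i, J (x i)].

Lemma capelli_norm_le : exists2 C : R, 0 <= C &
  forall x : 'I_m.+1 -> U, N (capelli x y) <= C * \prod_i N (x i).
Proof.
exists (\sum_(s : 'S_m.+1) \prod_i N (y i)).
  by apply: sumr_ge0 => s _; apply: prodr_ge0.
move=> x; apply: le_trans (seminorm_sum _ _ _) _.
rewrite mulr_suml; apply: ler_sum => s _.
have sgn : N ((-1) ^+ s : U) <= 1.
  by case: (s : bool); rewrite ?expr1 ?expr0 // (seminormN NZ).
apply: le_trans (NM _ _) _; rewrite -[leRHS]mul1r; apply: ler_pM => //.
apply: le_trans (seminorm_prod _ _) _.
apply: (@le_trans _ _ (\prod_(i < m.+1) (N (x (s i)) * N (y i)))).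
  by apply: ler_prod => i _; rewrite N_ge0 NM.
by rewrite big_split /= mulrC [X in _ <= _ * X](reindex_inj (@perm_inj _ s)).
Qed.

(** [p n v] is the norm of [x |-> v * capelli x y] against the product of the weights, and [q n u]
    the norm of left multiplication by [u] against [p n]. Hence [q n <= N] whatever the weights, and
    the kernel does not depend on [n]. After [capelli_traceC], each of the [m.+1] terms has one
    entry [a * x' k * b], which gains the factor [n.+1%:R^-1]. *)
Lemma trace_seminorms : exists q : nat -> U -> R, [/\
  [/\ forall n u, 0 <= q n u, forall n u v, q n (u + v) <= q n u + q n v,
      forall n c u, q n (c *: u) = cmod c * q n u,
      forall n u v, q n (u * v) <= q n u * q n v & forall n u, q n u <= N u],
  forall n u, q n u = 0 <-> forall v x, D x -> u * v * capelli x y = 0 &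
  forall x, D x -> exists K, forall n,
    q n (capelli_trace x y a b) <= K * n.+1%:R^-1].
Proof.
have [C C0 CP] := capelli_norm_le.
pose r (n : nat) : R := n.+1%:R.
have r0 n : 0 < r n by rewrite ltr0n.
pose g n (x : 'I_m.+1 -> U) := \prod_i weight (r n) (x i).
have g0 n x : 0 <= g n x by apply: prodr_ge0 => i _; exact: weight_ge0 (ltW (r0 n)).
pose f (v : U) (x : 'I_m.+1 -> U) := N (v * capelli x y).
pose p n := opnorm D f (g n).
have f0 v x : 0 <= f v x by exact: N_ge0.
have fD v v' x : f (v + v') x <= f v x + f v' x by rewrite /f mulrDl.
have fZ (c : R[i]) v x : f (c *: v) x = cmod c * f v x by rewrite /f -scalerAl NZ.
pose N' v := N v * C.
have N'0 v : 0 <= N' v by rewrite mulr_ge0.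
have fle n v x : D x -> f v x <= N' v * g n x.
  move=> _; apply: le_trans (NM _ _) _; rewrite -mulrA ler_wpM2l //.
  apply: le_trans (CP x) _; rewrite ler_wpM2l //; apply: ler_prod => i _.
  by rewrite N_ge0 le_weight // ltW.
have p0 n v : 0 <= p n v by exact: opnorm_ge0 N'0 (fle n) v.
have pP n v x : D x -> f v x <= p n v * g n x.
  exact: (opnormP (g0 n) N'0 (fle n)).
have pM n u v : p n (u * v) <= N u * p n v.
  apply: (opnorm_le N'0 (fle n)); first by rewrite mulr_ge0.
  move=> x Dx; rewrite /f -mulrA; apply: le_trans (NM _ _) _.
  by rewrite -mulrA ler_wpM2l // pP.
pose h n (u v : U) := p n (u * v).
have h0 n u v : 0 <= h n u v by exact: p0.
have hD n u u' v : h n (u + u') v <= h n u v + h n u' v.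
  by rewrite /h mulrDl; exact: (opnormD (g0 n) fD N'0 (fle n)).
have hZ n (c : R[i]) u v : h n (c *: u) v = cmod c * h n u v.
  by rewrite /h -scalerAl; exact: (opnormZ (g0 n) fZ N'0 (fle n)).
have hle n u v : [set: U] v -> h n u v <= N u * p n v by move=> _; exact: pM.
pose q n := opnorm [set: U] (h n) (p n).
have qP n u v : h n u v <= q n u * p n v.
  exact: (opnormP (p0 n) N_ge0 (hle n)).
have q0 n u : 0 <= q n u by exact: opnorm_ge0 N_ge0 (hle n) u.
exists q; split.
- split=> [//|n u v|n c u|n u v|n u].
  + exact: (opnormD (p0 n) (hD n) N_ge0 (hle n)).
  + exact: (opnormZ (p0 n) (hZ n) N_ge0 (hle n)).
  + apply: (opnorm_le N_ge0 (hle n)); first by rewrite mulr_ge0.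
    move=> w _; rewrite /h -mulrA; apply: le_trans (qP n u (v * w)) _.
    by rewrite -mulrA ler_wpM2l //; exact: qP.
  + exact: (opnorm_leN N_ge0 (hle n)).
- move=> n u; rewrite /q (opnorm_eq0 (h0 n) (p0 n) N_ge0 (hle n)).
  split=> [hu v x Dx|uv v _].
    have := hu v Logic.I; rewrite /h /p (opnorm_eq0 f0 (g0 n) N'0 (fle n)).
    by move=> /(_ x Dx) /N_eq0.
  by rewrite /h /p (opnorm_eq0 f0 (g0 n) N'0 (fle n)) => x Dx; rewrite /f uv.
move=> x Dx; exists (N (capelli x y) * m.+1%:R) => n.
apply: (opnorm_le N_ge0 (hle n)); first by rewrite !mulr_ge0 // invr_ge0.
move=> v _; apply: (opnorm_le N'0 (fle n)).
  by rewrite !mulr_ge0 // invr_ge0.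
move=> x' Dx'; rewrite /f (capelli_traceC J_ideal _ _ _ capJ) //.
rewrite -mulrA; apply: le_trans (NM _ _) _; rewrite -!mulrA ler_wpM2l //.
rewrite /capelli_trace mulr_sumr; apply: le_trans (seminorm_sum _ _ _) _.
apply: (@le_trans _ _ (\sum_(i < m.+1) (r n)^-1 * (p n v * g n x'))); last first.
  rewrite sumr_const card_ord -[leLHS]mulr_natl.
  exact: lexx.
apply: ler_sum => k _.
have Dk : D (upd x' k (a * x' k * b)).
  apply: upd_ideal => //; apply: (idealMr J_ideal); exact: (idealMr J_ideal).
apply: le_trans (pP n v _ Dk) _; rewrite mulrCA ler_wpM2l //.
rewrite /g (bigD1 k) //= [in leRHS](bigD1 k) //= updE eqxx mulrA.
rewrite [X in _ * X <= _](eq_bigr (fun i => weight (r n) (x' i))); last first.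
  by move=> i ik; rewrite updE (negPf ik).
rewrite ler_wpM2r ?weight_contract //.
by apply: prodr_ge0 => i _; exact: weight_ge0 (ltW (r0 n)).
Qed.

End TraceSeminorms.

(** * Unitization of a quotient *)

Section QuotientUnitization.
Variables (R : realType) (A : banachAlgType R) (I : closed_ideal A).
Let Ii := ideal_two_sided I.

Definition ideal_submodule : submodule A :=
  @Submodule R[i] A (I : set A) (tsi0 Ii) (fun x y => @tsiD _ _ _ Ii x y)
    (fun c x => @tsiZ _ _ _ Ii c x).

Local Notation Q := (quot ideal_submodule).
Local Notation pr := (qproj ideal_submodule).

Definition qmul (x y : Q) : Q := pr (bmul (qrepr x) (qrepr y)).

Lemma qmulE x y : qmul (pr x) (pr y) = pr (bmul x y).
Proof.
apply/qprojP => /=; set x' := qrepr _; set y' := qrepr _.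
have xx : (I : set A) (x' - x) := qprojK ideal_submodule x.
have yy : (I : set A) (y' - y) := qprojK ideal_submodule y.
have -> : bmul x' y' - bmul x y = bmul x' (y' - y) + bmul (x' - x) y.
  by rewrite bmulBr bmulBl addrA subrK.
by apply: (tsiD Ii); [exact: tsiMl | exact: tsiMr].
Qed.

Lemma qmulA : associative qmul.
Proof. by do 3!elim/quotW => ?; rewrite !qmulE bmulA. Qed.

Lemma qmulDl x y z : qmul (x + y) z = qmul x z + qmul y z.
Proof.
elim/quotW: x => x; elim/quotW: y => y; elim/quotW: z => z.
by rewrite -linearD !qmulE bmulDl linearD.
Qed.

Lemma qmulDr x y z : qmul z (x + y) = qmul z x + qmul z y.
Proof.
elim/quotW: x => x; elim/quotW: y => y; elim/quotW: z => z.
by rewrite -linearD !qmulE bmulDr linearD.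
Qed.

Lemma qmulZl c x y : qmul (c *: x) y = c *: qmul x y.
Proof.
elim/quotW: x => x; elim/quotW: y => y.
by rewrite -qprojZ !qmulE bmulZl qprojZ.
Qed.

Lemma qmulZr c x y : qmul x (c *: y) = c *: qmul x y.
Proof.
elim/quotW: x => x; elim/quotW: y => y.
by rewrite -qprojZ !qmulE bmulZr qprojZ.
Qed.

Definition unitz : Type := (R[i]^o * Q)%type.

HB.instance Definition _ := GRing.Lmodule.copy unitz (R[i]^o * Q)%type.

Definition umul (u v : unitz) : unitz :=
  (u.1 * v.1, (u.1 : R[i]) *: v.2 + (v.1 : R[i]) *: u.2 + qmul u.2 v.2).
Definition uone : unitz := (1, 0).

Lemma umulDl : left_distributive umul +%R.
Proof.
move=> [l x] [m y] [n z]; congr (_, _); rewrite /= ?mulrDl //.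
by rewrite scalerDl scalerDr qmulDl [RHS]addrACA; congr (_ + _); rewrite addrACA.
Qed.

Lemma umulDr : right_distributive umul +%R.
Proof.
move=> [l x] [m y] [n z]; congr (_, _); rewrite /= ?mulrDr //.
by rewrite scalerDl scalerDr qmulDr [RHS]addrACA; congr (_ + _); rewrite addrACA.
Qed.

Lemma qmul0 x : qmul x 0 = 0.
Proof. by have := qmulZr 0 x 0; rewrite !scale0r. Qed.

Lemma q0mul x : qmul 0 x = 0.
Proof. by have := qmulZl 0 0 x; rewrite !scale0r. Qed.

Lemma umul1 : left_id uone umul.
Proof. by move=> [l x]; rewrite /umul /= mul1r scale1r scaler0 q0mul !addr0. Qed.

Lemma umulr1 : right_id uone umul.
Proof. by move=> [l x]; rewrite /umul /= mulr1 scale1r scaler0 qmul0 add0r addr0. Qed.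

Lemma umulA : associative umul.
Proof.
move=> [l x] [m y] [n z]; congr (_, _); rewrite /= ?mulrA //.
rewrite !scalerDr !scalerA !qmulDl !qmulDr !qmulZl !qmulZr qmulA.
rewrite (mulrC n m) (mulrC n l) -!addrA; congr (_ + (_ + _)).
rewrite addrCA; congr (_ + _); rewrite [RHS]addrCA; congr (_ + _).
exact: addrCA.
Qed.

Lemma uone_neq0 : uone != 0.
Proof. by apply/eqP => -[/eqP]; rewrite oner_eq0. Qed.

HB.instance Definition _ := GRing.Zmodule_isNzRing.Build unitz
  umulA umul1 umulr1 umulDl umulDr uone_neq0.

Lemma uscaleAl (c : R[i]) (u v : unitz) : c *: (u * v) = (c *: u) * v.
Proof.
case: u v => [l x] [m y]; congr (_, _) => /=; first exact: mulrA.
by rewrite !scalerDr !scalerA qmulZl (mulrC c m).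
Qed.
HB.instance Definition _ := GRing.Lmodule_isLalgebra.Build R[i] unitz uscaleAl.

Lemma uscaleAr (c : R[i]) (u v : unitz) : c *: (u * v) = u * (c *: v).
Proof.
case: u v => [l x] [m y]; congr (_, _) => /=; first exact: mulrCA.
by rewrite !scalerDr !scalerA qmulZr (mulrC c l).
Qed.
HB.instance Definition _ := GRing.Lalgebra_isAlgebra.Build R[i] unitz uscaleAr.

Definition uinj (a : A) : unitz := (0, pr a).

Lemma uinjM a b : uinj (bmul a b) = uinj a * uinj b.
Proof. by congr (_, _); rewrite /= ?mulr0 // !scale0r !add0r qmulE. Qed.

Lemma uinjD a b : uinj (a + b) = uinj a + uinj b.
Proof. by congr (_, _); rewrite /= ?addr0 // linearD. Qed.

Lemma uinjZ c a : uinj (c *: a) = c *: uinj a.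
Proof. by congr (_, _); [exact: esym (mulr0 _) | exact: qprojZ]. Qed.

Lemma uinj_eq0 a : uinj a = 0 <-> (I : set A) a.
Proof.
split=> [[] /(@qproj0P _ _ ideal_submodule) //|Ia].
by congr (_, _); apply/qproj0P.
Qed.

Lemma unitzE l a : l%:A + uinj a = (l, pr a) :> unitz.
Proof.
have -> : l%:A = (l, 0) :> unitz.
  by congr (_, _); [exact: mulr1 | exact: scaler0].
by congr (_, _); [exact: addr0 | exact: add0r].
Qed.

Lemma unitzP (u : unitz) : exists l a, u = l%:A + uinj a.
Proof. by case: u => l; elim/quotW => a; exists l, a; rewrite unitzE. Qed.

Definition unorm (u : unitz) : R := cmod u.1 + quotient_norm (qrepr u.2) I.

Lemma quotient_norm_proj a : quotient_norm (qrepr (pr a)) I = quotient_norm a I.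
Proof.
have sub x y : (I : set A) (x - y) -> quotient_norm x I <= quotient_norm y I.
  move=> xy; have := seminormD (quotient_seminorm Ii) (x - y) y.
  by rewrite subrK !quotient_seminormE (quotient_norm0 Ii xy) add0r.
have h : (I : set A) (qrepr (pr a) - a) := qprojK ideal_submodule a.
apply/eqP; rewrite eq_le !sub //.
by rewrite -opprB; exact: tsiN.
Qed.

Lemma unormE l a : unorm (l%:A + uinj a) = cmod l + quotient_norm a I.
Proof.
by rewrite unitzE /unorm quotient_norm_proj.
Qed.

Lemma unorm_inj a : unorm (uinj a) = quotient_norm a I.
Proof. by rewrite /unorm /= cmod0 add0r quotient_norm_proj. Qed.

Let q := quotient_seminorm Ii.

Lemma unorm_ge0 u : 0 <= unorm u.
Proof. by rewrite addr_ge0 ?cmod_ge0 ?quotient_norm_ge0. Qed.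

Lemma unormD u v : unorm (u + v) <= unorm u + unorm v.
Proof.
have [l [a ->]] := unitzP u; have [m [b ->]] := unitzP v.
rewrite addrACA -scalerDl -uinjD !unormE addrACA; apply: lerD; first exact: cmodD.
exact: seminormD q a b.
Qed.

Lemma unormZ c u : unorm (c *: u) = cmod c * unorm u.
Proof.
have [l [a ->]] := unitzP u.
rewrite scalerDr scalerA -uinjZ !unormE cmodM mulrDr; congr (_ + _).
exact: seminormZ q c a.
Qed.

Lemma unormM u v : unorm (u * v) <= unorm u * unorm v.
Proof.
have [l [a ->]] := unitzP u; have [m [b ->]] := unitzP v.
have -> : (l%:A + uinj a) * (m%:A + uinj b) =
    (l * m)%:A + uinj (l *: b + m *: a + bmul a b).
  rewrite mulrDl !mulrDr -!scalerAl !mul1r -scalerAr mulr1.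
  by rewrite !uinjD !uinjZ uinjM scalerA -!addrA.
rewrite !unormE cmodM mulrDl !mulrDr -!addrA lerD2l addrA.
have h1 := seminormD q (l *: b + m *: a) (bmul a b).
have h2 := seminormD q (l *: b) (m *: a).
have h3 := seminormM q a b.
have h4 := seminormZ q l b; have h5 := seminormZ q m a.
rewrite !quotient_seminormE in h1 h2 h3 h4 h5.
rewrite /cmod (mulrC (quotient_norm a I) (complex.Re _)) addrA; lra.
Qed.

Lemma unorm1 : unorm 1 <= 1.
Proof.
have -> : 1 = 1%:A + uinj 0 :> unitz.
  by rewrite scale1r (uinj_eq0 0).2 ?addr0 //; exact: tsi0.
by rewrite unormE cmod1 (quotient_norm0 Ii (tsi0 Ii)) addr0.
Qed.

Lemma unorm_eq0 u : unorm u = 0 -> u = 0.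
Proof.
have [l [a ->]] := unitzP u; rewrite unormE => /eqP.
rewrite paddr_eq0 ?cmod_ge0 ?quotient_norm_ge0 // => /andP[/eqP/cmod_eq0-> /eqP a0].
rewrite scale0r add0r; apply/uinj_eq0.
exact (quotient_norm_eq0 Ii (ideal_closed (c := I)) a0).
Qed.

End QuotientUnitization.

(** * Closed ideals are semisimple *)

Section PrimitiveQuotient.
Variables (R : realType) (A : banachAlgType R) (I : closed_ideal A).
Local Notation U := (unitz I).
Local Notation j := (@uinj R A I).
Variables (M : set U) (M_max : maximal_left_ideal M).

Let Mid : left_ideal M. Proof. by have [] := M_max. Qed.

Let MZ (c : R[i]) x : M x -> M (c *: x).
Proof. by have [_ _ h] := Mid; move/(h (c%:A)); rewrite -scalerAl mul1r. Qed.

Let S : submodule U :=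
  @Submodule R[i] U M (let: And3 h _ _ := Mid in h)
    (let: And3 _ h _ := Mid in h) MZ.

Definition left_action (b : A) (v : quot S) : quot S := qproj S (j b * qrepr v).

Lemma left_actionE b u : left_action b (qproj S u) = qproj S (j b * u).
Proof.
apply/qprojP => /=; rewrite -mulrBr; have [_ _] := Mid; apply.
exact: (qprojK S u).
Qed.

Lemma left_action_is_linear b : linear (left_action b).
Proof.
move=> c x y; elim/quotW: x => x; elim/quotW: y => y.
rewrite -qprojZ -linearD !left_actionE mulrDr -scalerAr.
exact: qproj_is_linear.
Qed.

HB.instance Definition _ b :=
  GRing.isLinear.Build R[i] (quot S) (quot S) *:%R (left_action b)
    (left_action_is_linear b).

(** [U] is spanned by 1 and the image of [A], so the [A]-invariant subspaces of [U / M] come from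
    left ideals above [M]. The hypothesis says that [a] sends the class of [l] to that of 1, which
    keeps [a] out of the annihilator. *)
Lemma maximal_left_ideal_primitive (a : A) (l : R[i]) : M (1 - l *: j a) ->
  exists P : set A, [/\ primitive_ideal P, I `<=` P & ~ P a].
Proof.
move=> Ma; pose pi (b : A) : {linear quot S -> quot S} := left_action b.
have piE b u : pi b (qproj S u) = qproj S (j b * u) := left_actionE b u.
have one_neq0 : qproj S 1 != 0.
  by apply/eqP => /(@qproj0P _ _ S) M1; have [_ + _] := M_max; apply.
have pia : pi a (qproj S l%:A) = qproj S 1.
  rewrite piE -scalerAr mulr1; apply/qprojP => /=.
  have [_ _] := Mid => /(_ (-1) _ Ma).
  by rewrite mulN1r opprB.
exists [set b | forall v, pi b v = 0]; split.
- exists (quot S), pi; split=> //.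
  + split=> [c b b' v|b b' v]; elim/quotW: v => u.
      rewrite !piE uinjD uinjZ mulrDl -scalerAl; exact: qproj_is_linear.
    by rewrite (piE b' u) !piE uinjM mulrA.
  + split; first by exists a, (qproj S l%:A); rewrite pia.
    move=> W [W0 WL Wpi].
    have WD x y : W x -> W y -> W (x + y).
      by move=> Wx Wy; rewrite -[x]scale1r; exact: WL.
    have WZ c x : W x -> W (c *: x).
      by move=> Wx; rewrite -[_ *: _]addr0; exact: WL.
    have [_ _ Mmax] := M_max.
    have [||M'|M'] := Mmax [set u | W (qproj S u)].
    * split; first by rewrite /= linear0.
        by move=> x y Wx Wy /=; rewrite linearD; exact: WD.
      move=> u x Wx /=; have [c [b ->]] := unitzP u.
      rewrite mulrDl -scalerAl mul1r qproj_is_linear -piE.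
      by apply: WD; [exact: WZ | exact: Wpi].
    * by move=> u Mu /=; rewrite (_ : qproj S u = 0) //; apply/qproj0P.
    * left; apply/seteqP; split=> [v|_ -> //].
      by elim/quotW: v => u Wu; apply/(@qproj0P _ _ S); exact: M'.
    * right; apply/seteqP; split=> // v _; elim/quotW: v => u.
      by have : [set: U] u by []; rewrite -M'.
- move=> b Ib v; elim/quotW: v => u.
  by rewrite piE (uinj_eq0 _ _).2 // mul0r linear0.
- by move=> /(_ (qproj S l%:A)); rewrite pia => e; rewrite e eqxx in one_neq0.
Qed.

End PrimitiveQuotient.

Section ClosedIdealsSemisimple.
Variables (R : realType) (A : banachAlgType R).
Hypothesis A_PI : PI_algebra A.
Hypothesis tauH : hausdorff_space (closed_ideal A).
Variable I : closed_ideal A.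
Local Notation U := (unitz I).
Local Notation j := (@uinj R A I).

Definition primitive_hull : set A :=
  [set a | forall P : set A, primitive_ideal P -> I `<=` P -> P a].

Let J : set U := j @` primitive_hull.

Let prim_ideal (P : set A) (PP : primitive_ideal P) : two_sided_ideal P :=
  (primitive_prime PP).1.

Let hullD x y : primitive_hull x -> primitive_hull y -> primitive_hull (x + y).
Proof. by move=> hx hy P PP IP; apply: (tsiD (prim_ideal PP)); [exact: hx | exact: hy]. Qed.

Let hullZ c x : primitive_hull x -> primitive_hull (c *: x).
Proof. by move=> hx P PP IP; apply: (tsiZ (prim_ideal PP)); exact: hx. Qed.

Let J_ideal : two_ideal J.
Proof.
split.
- exists 0; first by move=> P PP IP; exact: (tsi0 (prim_ideal PP)).
  by apply/uinj_eq0; exact: (tsi0 (ideal_two_sided I)).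
- by move=> _ _ [x hx <-] [y hy <-]; exists (x + y); [exact: hullD | rewrite uinjD].
- move=> u _ [x hx <-]; have [c [b ->]] := unitzP u.
  exists (c *: x + bmul b x); last by rewrite mulrDl -scalerAl mul1r uinjD uinjZ uinjM.
  apply: hullD; first exact: hullZ.
  by move=> P PP IP; apply: (tsiMl (prim_ideal PP)); exact: hx.
- move=> u _ [x hx <-]; have [c [b ->]] := unitzP u.
  exists (c *: x + bmul x b); last by rewrite mulrDr -scalerAr mulr1 uinjD uinjZ uinjM.
  apply: hullD; first exact: hullZ.
  by move=> P PP IP; apply: (tsiMr (prim_ideal PP)); exact: hx.
Qed.

(** Otherwise a maximal left ideal contains [1 - l *: z], and some primitive ideal above [I] misses
    the preimage of [z]. *)
Let J_left_inverse (z : U) (l : R[i]) : J z -> exists b, b * (1 - l *: z) = 1.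
Proof.
move=> [a ha <-]; apply: contrapT => h.
pose L := [set b * (1 - l *: j a) | b in [set: U]].
have [||M M_max LM] := @ex_maximal_left_ideal U L.
- split; first by exists 0; rewrite ?mul0r.
    by move=> _ _ [p _ <-] [q _ <-]; exists (p + q); rewrite ?mulrDl.
  by move=> q _ [p _ <-]; exists (q * p); rewrite ?mulrA.
- by move=> [b _ b1]; apply: h; exists b.
have [|P [PP IP Pa]] := @maximal_left_ideal_primitive R A I M M_max a l.
  by apply: LM; exists 1; rewrite ?mul1r.
by apply: Pa; exact: ha.
Qed.

(* A left inverse of [1 - l z], [z] in the ideal [J], is again of that form, so
   it has a left inverse too. *)
Let J_inverse (z : U) (l : R[i]) : J z ->
  exists b, b * (1 - l *: z) = 1 /\ (1 - l *: z) * b = 1.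
Proof.
move=> Jz; have [b b1] := J_left_inverse l Jz; exists b; split=> //.
have bE : b = 1 - (-1) *: (b * (l *: z)).
  by apply/eqP; rewrite scaleN1r opprK -subr_eq -[X in _ == X]b1 mulrBr mulr1.
have Jlz : J (l *: z) by rewrite -[z]mul1r scalerAl; exact: idealMl.
have [c] := J_left_inverse (-1) (idealMl J_ideal b Jlz); rewrite -bE => cb.
suff cE : c = 1 - l *: z by rewrite -cE.
by rewrite -[LHS]mulr1 -[X in c * X]b1 mulrA cb mul1r.
Qed.

Let N := @unorm R A I.

Let J_quasinilpotent (z : U) : J z -> forall r : R, 0 <= r -> power_bounded N z r.
Proof.
move=> Jz r r0.
have /choice[Res ResP] : forall l, exists b, b * (1 - l *: z) = 1 /\ (1 - l *: z) * b = 1.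
  by move=> l; exact: J_inverse.
exact: (spectral_radius0 (@unorm_ge0 R A I) (@unormD R A I) (@unormZ R A I)
  (@unormM R A I) (fun l => (ResP l).1) (fun l => (ResP l).2) r0).
Qed.

Let J_semiprime e : J e -> (forall u, e * u * e = 0) -> e = 0.
Proof.
move=> [a _ <-] aua; apply/uinj_eq0.
apply: (closed_ideal_semiprime tauH (ideal_two_sided I) (ideal_closed (c := I))).
  by apply/uinj_eq0; have := aua 1; rewrite mulr1 uinjM.
by move=> b; apply/uinj_eq0; rewrite !uinjM aua.
Qed.

Let J_trace m (x x' y : 'I_m.+1 -> U) (a b v : U) :
  capelli_identity J m.+2 ->
  (forall i, J (x i)) -> (forall i, J (x' i)) -> (forall i, J (y i)) ->
  J a -> capelli_trace x y a b * v * capelli x' y = 0.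
Proof.
move=> C Jx Jx' Jy Ja.
have [q [[q0 qD qZ qM qN] qker qtr]] :=
  trace_seminorms (@unorm_ge0 R A I) (@unormD R A I) (@unormZ R A I)
  (@unormM R A I) (@unorm1 R A I) (@unorm_eq0 R A I) J_ideal b Ja
  (J_quasinilpotent Ja) Jy C.
have [K KP] := qtr x Jx.
(* The trace lies in [J], so it comes from an element of [A], where the seminorms can be compared;
   the second sequence will be constantly [rho 0]. *)
have [w _ wE] : J (capelli_trace x y a b).
  apply: (ideal_sum J_ideal) => i _; exact: (capelli_ideal J_ideal).
have rho_le n c : q n (j c) <= 1%:R * rnorm c.
  rewrite mul1r; apply: le_trans (qN n _) _; rewrite unorm_inj.
  by have := seminorm_le (quotient_seminorm (ideal_two_sided I)) c; rewrite mul1r.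
have rhoD n c c' : q n (j (c + c')) <= q n (j c) + q n (j c') by rewrite uinjD.
have rhoZ n (l : R[i]) c : q n (j (l *: c)) = complex.Re `|l| * q n (j c).
  by rewrite uinjZ qZ.
have rhoM n c c' : q n (j (bmul c c')) <= q n (j c) * q n (j c') by rewrite uinjM.
pose rho n : bseminorm A 1 :=
  BSeminorm (fun c => q0 n (j c)) (rhoD n) (rhoZ n) (rhoM n) (rho_le n).
have kerE n c : rho n c = 0 <-> rho 0%N c = 0.
  by rewrite /= !qker.
have rho0 : rho n w @[n --> \oo] --> 0.
  have : K * n.+1%:R^-1 @[n --> \oo] --> K * 0 by apply: cvgM; [exact: cvg_cst | exact: cvg_harmonic].
  rewrite mulr0; apply: (@squeeze_cvgr _ _ _ _ (fun=> 0)); last exact: cvg_cst.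
  by apply: nearW => n; rewrite /= q0 wE KP.
have := same_kernel_cvg0 tauH (ltn0Sn 0) kerE rho0.
move=> /(cvg_unique (@Rhausdorff R) (cvg_cst (rho 0%N w))) /=.
by rewrite wE => /qker; apply.
Qed.

Lemma word_eval_uinj (a : nat -> A) (w : seq nat) : w != [::] ->
  j (word_eval a w) = \prod_(i <- w) j (a i).
Proof.
case: w => // i w _ /=; rewrite big_cons.
elim: w (a i) => [|k w IH] z; first by rewrite big_nil mulr1.
by rewrite /= IH uinjM big_cons mulrA.
Qed.

Let J_multilinear : exists f d, @ml_identity R[i] U J f d.
Proof.
have [f [f0 [w0 fw0] fA]] := A_PI.
apply: (multilinearize J_ideal (S := finsupp f) (f := f) (w0 := w0)) => [||//|x Jx].
- exact: fset_uniq.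
- by rewrite mem_finsupp.
have /choice[a aP] : forall i, exists a, j a = x i by move=> i; have [a _ <-] := Jx i; exists a.
have j0 : j 0 = 0 by apply/uinj_eq0; exact: (tsi0 (ideal_two_sided I)).
have := congr1 j (fA a); rewrite j0 => E; rewrite -[RHS]E {E}.
rewrite (big_morph j (@uinjD R A I) j0); apply: eq_bigr => w _.
rewrite uinjZ; have [->|w_neq0] := eqVneq w [::]; first by rewrite f0 !scale0r.
by rewrite word_eval_uinj //; congr (_ *: _); apply: eq_bigr => i _; rewrite aP.
Qed.

Lemma primitive_hull_sub : primitive_hull `<=` I.
Proof.
move=> a ha; apply/uinj_eq0.
have [f [d Jf]] := J_multilinear.
by apply: (semiprime_ideal_eq0 J_ideal J_semiprime Jf J_trace); exists a.
Qed.

End ClosedIdealsSemisimple.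

(** * The lattice of closed ideals *)

Section IdealClosure.
Variables (R : realType) (A : banachAlgType R).

(* If [x] is a limit of the annihilator of [v] and [x v != 0], then some
   [b x - b l] has norm less than 1 and fixes [v]; this contradicts its
   quasi-invertibility. *)
Lemma primitive_closed (P : set A) : primitive_ideal P -> closed P.
Proof.
move=> [V [pi [[piL piM] [[a0 [v0 av0]] pi_irr] ->]]] x clx v.
have piD b c w : pi (b + c) w = pi b w + pi c w.
  by have := piL 1 b c w; rewrite !scale1r.
have pi0 w : pi 0 w = 0 by apply: (addrI (pi 0 w)); rewrite -piD !addr0.
have piZ (l : R[i]) b w : pi (l *: b) w = l *: pi b w.
  by have := piL l b 0 w; rewrite pi0 !addr0.
have piB b c w : pi (b - c) w = pi b w - pi c w.
  by have := piZ (-1) c w; rewrite !scaleN1r piD => ->.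
have trans u w : u != 0 -> exists b, pi b u = w.
  move=> u0; have [|W0|WT] := pi_irr [set z | exists b, pi b u = z]; last first.
  - by have : [set: V] w by []; rewrite -WT.
  - have [|Z0|ZT] := pi_irr [set z | forall b, pi b z = 0].
    + split=> [b|c y z hy hz b|a z hz b]; first by rewrite linear0.
        by rewrite linearD linearZ /= hy hz scaler0 addr0.
      by rewrite hz linear0.
    + have : [set z | forall b, pi b z = 0] u.
        by move=> b; have : [set z | exists b, pi b u = z] (pi b u); [exists b | rewrite W0].
      by rewrite Z0 => /= ue; rewrite ue eqxx in u0.
    + by have : [set z | forall b, pi b z = 0] v0; [rewrite ZT | move=> /(_ a0) e; rewrite e eqxx in av0].
  - split; first by exists 0; rewrite pi0.
      by move=> c _ _ [b <-] [b' <-]; exists (c *: b + b'); rewrite piL.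
    by move=> a _ [b <-]; exists (bmul a b); rewrite piM.
apply/eqP; apply: contrapT => /negP xv.
have v_neq0 : v != 0 by apply: contra xv => /eqP ->; rewrite linear0.
have [b bxv] := trans _ v xv.
have b1 : 0 < rnorm b + 1 by rewrite ltr_wpDl ?rnorm_ge0.
have [l lv xl] : exists2 s, (forall w, pi s w = 0) & rnorm (x - s) < (rnorm b + 1)^-1.
  by apply: ((closure_rnorm _ _).1 clx); rewrite invr_gt0.
have z1 : rnorm (bmul b (x - l)) < 1.
  apply: le_lt_trans (rnormM _ _) _.
  apply: (@le_lt_trans _ _ (rnorm b * (rnorm b + 1)^-1)).
    by rewrite ler_wpM2l ?rnorm_ge0 // ltW.
  by rewrite ltr_pdivrMr // mul1r ltrDl.
have [y yE] := geometric_quasi_inverse z1.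
have zv : pi (bmul b (x - l)) v = v by rewrite piM piB lv subr0.
case/eqP: v_neq0; apply: (addrI (pi y v)); rewrite addr0 [RHS](congr1 (fun t => pi t v) yE).
by rewrite piD zv piM zv addrC.
Qed.

Lemma ideal_closure (I : set A) : two_sided_ideal I -> two_sided_ideal (closure I).
Proof.
move=> Ii; split.
- by apply: subset_closure; exact: tsi0.
- move=> c x y /closure_rnorm hx /closure_rnorm hy; apply/closure_rnorm => e e0.
  have e2 : 0 < e / 2 by rewrite divr_gt0.
  have c1 : 0 < cmod c + 1 by rewrite ltr_wpDl ?cmod_ge0.
  have e3 : 0 < e / 2 / (cmod c + 1) by rewrite divr_gt0.
  have [s Is xs] := hx _ e3; have [t It yt] := hy _ e2.
  exists (c *: s + t); first by apply: (tsiD Ii) => //; exact: tsiZ.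
  have -> : c *: x + y - (c *: s + t) = c *: (x - s) + (y - t).
    by rewrite scalerBr opprD addrACA.
  apply: le_lt_trans (rnormD _ _) _; rewrite rnormZ.
  have : cmod c * rnorm (x - s) <= e / 2.
    apply: (@le_trans _ _ ((cmod c + 1) * rnorm (x - s))).
      by rewrite ler_wpM2r ?rnorm_ge0 // lerDl.
    by rewrite mulrC -ler_pdivlMr // ltW.
  by lra.
- move=> a x /closure_rnorm hx; apply/closure_rnorm => e e0.
  have a1 : 0 < rnorm a + 1 by rewrite ltr_wpDl ?rnorm_ge0.
  have e1 : 0 < e / (rnorm a + 1) by rewrite divr_gt0.
  have [s Is xs] := hx _ e1; exists (bmul a s); first exact: tsiMl.
  rewrite -bmulBr; apply: le_lt_trans (rnormM _ _) _.
  apply: (@le_lt_trans _ _ ((rnorm a + 1) * rnorm (x - s))).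
    by rewrite ler_wpM2r ?rnorm_ge0 // lerDl.
  by rewrite mulrC -ltr_pdivlMr.
- move=> a x /closure_rnorm hx; apply/closure_rnorm => e e0.
  have a1 : 0 < rnorm a + 1 by rewrite ltr_wpDl ?rnorm_ge0.
  have e1 : 0 < e / (rnorm a + 1) by rewrite divr_gt0.
  have [s Is xs] := hx _ e1; exists (bmul s a); first exact: tsiMr.
  rewrite -bmulBl; apply: le_lt_trans (rnormM _ _) _.
  apply: (@le_lt_trans _ _ (rnorm (x - s) * (rnorm a + 1))).
    by rewrite ler_wpM2l ?rnorm_ge0 // lerDl.
  by rewrite -ltr_pdivlMr.
Qed.

Definition closed_hull (I : set A) (Ii : two_sided_ideal I) : closed_ideal A :=
  ClosedIdeal (ideal_closure Ii) (@closed_closure _ I).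

Lemma closure_bmul (S T : set A) (M : closed_ideal A) :
  (forall x y, S x -> T y -> (M : set A) (bmul x y)) ->
  forall x y, closure S x -> closure T y -> (M : set A) (bmul x y).
Proof.
move=> STM x y /closure_rnorm hx /closure_rnorm hy.
apply: ideal_closed; apply/closure_rnorm => e e0.
have y1 : 0 < rnorm y + 1 by rewrite ltr_wpDl ?rnorm_ge0.
have e1 : 0 < e / 2 / (rnorm y + 1) by rewrite !divr_gt0.
have [s Ss xs] := hx _ e1.
have s1 : 0 < rnorm s + 1 by rewrite ltr_wpDl ?rnorm_ge0.
have e2 : 0 < e / 2 / (rnorm s + 1) by rewrite !divr_gt0.
have [t Tt yt] := hy _ e2.
exists (bmul s t); first exact: STM.
have -> : bmul x y - bmul s t = bmul (x - s) y + bmul s (y - t).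
  by rewrite bmulBl bmulBr addrA subrK.
apply: le_lt_trans (rnormD _ _) _.
have h1 : rnorm (bmul (x - s) y) <= e / 2.
  apply: le_trans (rnormM _ _) _.
  apply: (@le_trans _ _ (rnorm (x - s) * (rnorm y + 1))).
    by rewrite ler_wpM2l ?rnorm_ge0 // lerDl.
  by rewrite -ler_pdivlMr // ltW.
have h2 : rnorm (bmul s (y - t)) < e / 2.
  apply: le_lt_trans (rnormM _ _) _.
  apply: (@le_lt_trans _ _ ((rnorm s + 1) * rnorm (y - t))).
    by rewrite ler_wpM2r ?rnorm_ge0 // lerDl.
  by rewrite mulrC -ltr_pdivlMr.
by lra.
Qed.

(** * The way-below relation between closed ideals *)

Definition directed_sets (D : set (set A)) : Prop :=
  D !=set0 /\ forall X Y, D X -> D Y -> exists Z, [/\ D Z, X `<=` Z & Y `<=` Z].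

Lemma directed_union_ideal (D : set (set A)) : directed_sets D ->
  (forall X, D X -> two_sided_ideal X) -> two_sided_ideal (\bigcup_(X in D) X).
Proof.
move=> [[X0 DX0] dirD] Di; split.
- by exists X0 => //; exact: (tsi0 (Di _ DX0)).
- move=> c x y [X DX Xx] [Y DY Yy]; have [Z [DZ XZ YZ]] := dirD _ _ DX DY.
  by exists Z => //; apply: (tsiD (Di _ DZ)); [apply: (tsiZ (Di _ DZ)); exact: XZ | exact: YZ].
- by move=> a x [X DX Xx]; exists X => //; exact: (tsiMl (Di _ DX)).
- by move=> a x [X DX Xx]; exists X => //; exact: (tsiMr (Di _ DX)).
Qed.

Lemma ideal_sum_ideal (I J : set A) : two_sided_ideal I -> two_sided_ideal J ->
  two_sided_ideal [set z | exists x y, [/\ I x, J y & z = x + y]].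
Proof.
move=> Ii Ji; split.
- by exists 0, 0; split; [exact: tsi0 | exact: tsi0 | rewrite addr0].
- move=> c _ _ [x [y [Ix Jy ->]]] [x' [y' [Ix' Jy' ->]]].
  exists (c *: x + x'), (c *: y + y'); split.
  + by apply: (tsiD Ii) => //; exact: tsiZ.
  + by apply: (tsiD Ji) => //; exact: tsiZ.
  + by rewrite scalerDr addrACA.
- move=> a _ [x [y [Ix Jy ->]]]; exists (bmul a x), (bmul a y).
  by split; [exact: tsiMl | exact: tsiMl | rewrite bmulDr].
- move=> a _ [x [y [Ix Jy ->]]]; exists (bmul x a), (bmul y a).
  by split; [exact: tsiMr | exact: tsiMr | rewrite bmulDl].
Qed.

(* The supremum of a directed family in [Id(A)] is the closure of its union. *)
Definition way_below (X Y : closed_ideal A) : Prop :=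
  forall D : set (set A), directed_sets D ->
    (forall Z, D Z -> two_sided_ideal Z /\ closed Z) ->
    Y `<=` closure (\bigcup_(Z in D) Z) -> exists2 Z, D Z & X `<=` Z.

Lemma way_below_sub X Y : way_below X Y -> X `<=` Y.
Proof.
move=> /(_ [set (Y : set A)])[].
- by split; [exists (Y : set A) | move=> _ _ -> ->; exists (Y : set A); split].
- by move=> _ ->; split; [exact: ideal_two_sided | exact: ideal_closed].
- by move=> x Yx; apply: subset_closure; exists (Y : set A).
- by move=> _ ->.
Qed.

Lemma way_below_mono (X X' Y Y' : closed_ideal A) :
  X `<=` X' -> way_below X' Y' -> Y' `<=` Y -> way_below X Y.
Proof.
move=> XX' wb Y'Y D Ddir Di YD.
have [Z DZ X'Z] := wb D Ddir Di (subset_trans Y'Y YD).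
by exists Z => //; exact: subset_trans X'Z.
Qed.

Lemma way_below_join (X1 X2 Y : closed_ideal A) : way_below X1 Y -> way_below X2 Y ->
  exists X : closed_ideal A, [/\ way_below X Y, X1 `<=` X & X2 `<=` X].
Proof.
move=> w1 w2; exists (ideal_meet [set N : closed_ideal A | X1 `<=` N /\ X2 `<=` N]).
split; last by move=> x Xx N [_]; exact.
  move=> D Ddir Di YD.
  have [Z1 DZ1 XZ1] := w1 D Ddir Di YD; have [Z2 DZ2 XZ2] := w2 D Ddir Di YD.
  have [Z [DZ Z1Z Z2Z]] := Ddir.2 _ _ DZ1 DZ2; exists Z => // x xN.
  have [Zi Zc] := Di _ DZ; apply: (xN (ClosedIdeal Zi Zc)).
  by split; [exact: subset_trans Z1Z | exact: subset_trans Z2Z].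
by move=> x Xx N [h _]; exact: h.
Qed.

Lemma way_below_bot (Y : closed_ideal A) :
  way_below (ideal_meet [set: closed_ideal A]) Y.
Proof.
move=> D [[Z DZ] _] Di _; exists Z => // x xN.
by have [Zi Zc] := Di _ DZ; exact: (xN (ClosedIdeal Zi Zc)).
Qed.

Hypothesis tauH : hausdorff_space (closed_ideal A).

(** For [a] in [Y], the meet of all closed ideals at distance at most 1/(n+1) from [a] is way below
    [Y]: a directed family whose closed union contains [a] has a member that close. If all these
    meets were inside [P], so would be [a]. *)
Lemma way_below_approx (Y P : closed_ideal A) : ~ (Y `<=` P) ->
  exists X : closed_ideal A, way_below X Y /\ ~ (X `<=` P).
Proof.
move=> /existsNP[a /not_implyP[Ya Pa]]; apply: contrapT => /forallNP h.
apply: Pa; pose S (n : nat) := [set N : closed_ideal A | quotient_norm a N <= n.+1%:R^-1].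
apply: (@near_ideals_meet R A tauH S) => [n N //|n|n].
  exists Y; rewrite /S /= (quotient_norm0 (ideal_two_sided Y) Ya).
  by rewrite invr_ge0.
apply: contrapT => nP; apply: (h (ideal_meet (S n))); split=> // D Ddir Di YD.
have n0 : 0 < (n.+1%:R^-1 : R) by rewrite invr_gt0.
have [s [Z DZ Zs] as_] := (closure_rnorm _ _).1 (YD _ Ya) _ n0.
exists Z => // x xS; have [Zi Zc] := Di _ DZ.
apply: (xS (ClosedIdeal Zi Zc)) => /=; apply: le_trans (ltW as_).
exact: (quotient_norm_lb Zi a (tsiN Zi Zs)).
Qed.

(** The ideals way below something way below [Y] form a directed family, whose closed union contains
    [Y] by two approximations; [X] is thus inside one of them. *)
Lemma way_below_interpolate (X Y : closed_ideal A) : way_below X Y ->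
  exists Z, way_below X Z /\ way_below Z Y.
Proof.
move=> XY; pose D := [set W : set A | exists W' Z : closed_ideal A,
  [/\ W = W', way_below W' Z & way_below Z Y]].
have Di W : D W -> two_sided_ideal W /\ closed W.
  by move=> [W' [Z [-> _ _]]]; split; [exact: ideal_two_sided | exact: ideal_closed].
have Ddir : directed_sets D.
  pose bot := ideal_meet [set: closed_ideal A]; split.
    exists (bot : set A), bot, bot.
    by split=> //; exact: way_below_bot.
  move=> _ _ [W1 [Z1 [-> w1 z1]]] [W2 [Z2 [-> w2 z2]]].
  have [Z [wZ Z1Z Z2Z]] := way_below_join z1 z2.
  have [||W [wW W1W W2W]] := @way_below_join W1 W2 Z.
  - exact: way_below_mono w1 Z1Z.
  - exact: way_below_mono w2 Z2Z.
  by exists W; split=> //; exists W, Z.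
have Dui := directed_union_ideal Ddir (fun W h => (Di W h).1).
pose P := closed_hull Dui.
have YP : Y `<=` P.
  apply: contrapT => /way_below_approx[Z [ZY /way_below_approx[W [WZ nWP]]]].
  by apply: nWP => x Wx; apply: subset_closure; exists (W : set A) => //; exists W, Z.
have [_ [W [Z [-> WZ ZY]]] XW] := XY D Ddir Di YP.
by exists Z; split=> //; exact: way_below_mono XW WZ _.
Qed.

End IdealClosure.

(** * Spectral synthesis *)

Section Synthesis.
Variables (R : realType) (A : banachAlgType R).
Hypothesis A_PI : PI_algebra A.
Hypothesis tauH : hausdorff_space (closed_ideal A).

Lemma closed_ideal_primitive_hull (I : closed_ideal A) x :
  (forall P : Prim A, I `<=` P -> (P : set A) x) -> (I : set A) x.
Proof.
move=> h; apply: (primitive_hull_sub A_PI tauH) => P PP IP.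
exact: (h (MkPrim PP)).
Qed.

Lemma prim_closed (P : Prim A) : closed (P : set A).
Proof. exact: primitive_closed (prim_primitive P). Qed.

Lemma prim_ideal (P : Prim A) : two_sided_ideal P.
Proof. exact: (primitive_prime (prim_primitive P)).1. Qed.

(** If the lower limit is 0, the indices with quotient norm below 1/(n+1) are cofinal for each [n].
    An intersection of ideals over a cofinal set of indices lies in every hull-kernel limit, so
    [near_ideals_meet] applies. *)
Lemma hausdorff_lower_bounded_nets : lower_bounded_nets A.
Proof.
move=> D le P_ P a [D0 le_refl le_trans_ le_dir] P_cvg Pa; rewrite lt0e.
pose u d := (quotient_norm a (P_ d))%:E.
have u0 d : (0 <= u d)%E by rewrite lee_fin quotient_norm_ge0 //; exact: prim_ideal.
have [d0] := D0.
have lim0 : (0 <= net_liminf le u)%E.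
  apply: le_trans (ereal_sup_ubound _); last by exists d0.
  by apply: le_ereal_inf_tmp => _ [e _ <-].
rewrite lim0 andbT; apply/negP => /eqP lim_eq0; apply: Pa.
have inf0 d : ereal_inf [set u e | e in [set e | le d e]] = 0%E.
  apply/eqP; rewrite eq_le; apply/andP; split.
    by rewrite -lim_eq0; apply: ereal_sup_ubound; exists d.
  by apply: le_ereal_inf_tmp => _ [e _ <-].
have small n d : exists e, le d e /\ quotient_norm a (P_ e) < n.+1%:R^-1.
  apply: contrapT => h.
  have : (n.+1%:R^-1%:E <= ereal_inf [set u e | e in [set e | le d e]])%E.
    apply: le_ereal_inf_tmp => _ [e de <-]; rewrite lee_fin leNgt; apply/negP => lt.
    by apply: h; exists e.
  by rewrite inf0 lee_fin leNgt invr_gt0 ltr0n.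
pose toI (Q : Prim A) := ClosedIdeal (prim_ideal Q) (@prim_closed Q).
pose S n := [set N | exists e, N = toI (P_ e) /\ quotient_norm a (P_ e) < n.+1%:R^-1].
apply: (@near_ideals_meet R A tauH S (toI P) a).
- by move=> n N [e [-> /ltW]].
- by move=> n; have [e [_ h]] := small n d0; exists (toI (P_ e)), e.
move=> n /= x xS; apply: contrapT => Px.
pose U := [set Q : Prim A | ~ (Q : set A) x].
have Uop : open U.
  move=> Q hQ /= Qx; apply: Qx; apply: hQ => /= T TU.
  by apply: contrapT => Tx; apply: TU.
have [d dP] : tails le (P_ @^-1` U) by apply: P_cvg; exact: open_nbhs_nbhs.
have [e [de h]] := small n d; apply: (dP e de).
by apply: (xS (toI (P_ e))); exists e.
Qed.

Lemma prim_support_open (I : closed_ideal A) : open (prim_support I).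
Proof.
have op : hk_open (@prim_set _ A) (prim_support I).
  move=> P hP nIP; apply: nIP; apply: subset_trans hP => x Ix Q nQ.
  by apply: contrapT => Qx; apply: nQ => /(_ x Ix).
exact: op.
Qed.

Lemma pi_prim_support_lattice_iso : prim_support_lattice_iso A.
Proof.
have mono (I J : closed_ideal A) : I `<=` J <-> prim_support I `<=` prim_support J.
  split=> [IJ P nIP JP|sup x Ix]; first by apply: nIP; exact: subset_trans IJ JP.
  apply: closed_ideal_primitive_hull => P JP; apply: contrapT => Px.
  by apply: (sup P) => // /(_ x Ix).
split=> //; split.
- by move=> I _; exact: prim_support_open.
- move=> I J _ _ IJ; apply: closed_ideal_ext; split.
    by apply/mono; rewrite IJ.
  by apply/mono; rewrite IJ.
- move=> V Vop.
  pose K := ClosedIdeal (bigcap_ideal (~` V) prim_ideal)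
    (closed_bigcap (fun (P : Prim A) (_ : (~` V) P) => @prim_closed P)).
  exists K => //; apply/seteqP; split=> P.
    by move=> nKP; apply: contrapT => nVP; apply: nKP => x; exact.
  by move=> VP KP; exact: (Vop P KP).
Qed.

Lemma prims_ideal (Q : Prims A) : two_sided_ideal Q.
Proof. exact: (prims_prime Q).1. Qed.

Lemma prims_closed (Q : Prims A) : closed (Q : set A).
Proof.
have [S SP ->] := prims_semisimple Q.
by apply: (closed_bigcap (f := id)) => P /SP; exact: primitive_closed.
Qed.

Definition prims_meet (S : set (Prims A)) : closed_ideal A :=
  ClosedIdeal (bigcap_ideal S prims_ideal)
    (closed_bigcap (fun (Q : Prims A) (_ : S Q) => @prims_closed Q)).

Definition prims_closed_ideal (Q : Prims A) : closed_ideal A :=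
  ClosedIdeal (prims_ideal Q) (@prims_closed Q).

Section WayBelowSequence.
Variable I : nat -> closed_ideal A.
Hypothesis I_decr : forall n, way_below (I n.+1) (I n).

Let I_le n m : (n <= m)%N -> I m `<=` I n.
Proof.
elim: m => [|m IH]; first by rewrite leqn0 => /eqP ->.
rewrite leq_eqVlt => /orP[/eqP -> //|/IH h].
by move=> x /(way_below_sub (@I_decr m)) /h.
Qed.

(* A closed ideal containing no [I n] lies in a maximal ideal with the same
   property, and such an ideal is prime because closed ideals are semiprime. *)
Lemma ex_prims_avoiding (N : closed_ideal A) : (forall n, ~ (I n `<=` N)) ->
  exists Q : Prims A, N `<=` Q /\ forall n, ~ (I n `<=` Q).
Proof.
move=> nIN.
(* The condition bears on the closure of [X], which itself need not be closed: unions of chains then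
   stay in the family, and maximality makes [M] closed. *)
pose Pr (X : set A) := two_sided_ideal X /\ forall n, ~ (I n `<=` closure X).
have [||M [[Mi nIM] NM Mmax]] := @Zorn_above A Pr N.
- split; first exact: ideal_two_sided.
  by move=> n h; apply: (nIN n) => x /h; exact: ideal_closed.
- move=> F FP [X0 FX0] Ftot.
  have Fdir : directed_sets F.
    split; first by exists X0.
    move=> X Y FX FY; have [XY|YX] := Ftot _ _ FX FY; first by exists Y; split.
    by exists X; split.
  split; first by apply: directed_union_ideal => // X /FP[].
  move=> n InF.
  (* If [I n] were in the closed union of the chain, then [I n.+1], being way below [I n], would be
     in the closure of one member. *)
  have [|||_ [X FX <-] IX] := @I_decr n [set closure X | X in F].
  - split; first by exists (closure X0), X0.
    move=> _ _ [X FX <-] [Y FY <-]; have [Z [FZ XZ YZ]] := Fdir.2 _ _ FX FY.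
    by exists (closure Z); split; [exists Z | exact: closureS | exact: closureS].
  - move=> _ [X FX <-]; split; last exact: closed_closure.
    by apply: ideal_closure; exact: (FP _ FX).1.
  - apply: subset_trans InF _; apply: closureS => x [X FX Xx].
    by exists (closure X); [exists X | exact: subset_closure].
  - by have [_ /(_ n.+1)] := FP _ FX; apply.
have Mc : closed M.
  apply: (Mmax (closure M)); first exact: subset_closure.
  split; first exact: ideal_closure.
  by move=> n; rewrite -(closure_id _).1 //; exact: closed_closure.
pose M' := ClosedIdeal Mi Mc.
have nIM' n : ~ (I n `<=` M) by move=> h; apply: (nIM n) => x /h; exact: subset_closure.
pose sumM (X : set A) := [set z | exists x y, [/\ M x, X y & z = x + y]].
have big (X : set A) : two_sided_ideal X -> ~ (X `<=` M) ->
    exists n, I n `<=` closure (sumM X).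
  move=> Xi nXM; apply: contrapT => /forallNP h; apply: nXM => x Xx.
  apply: (Mmax (sumM X)).
  - by move=> y My; exists y, 0; split=> //; [exact: tsi0 | rewrite addr0].
  - by split=> //; exact: ideal_sum_ideal.
  - by exists 0, x; split=> //; [exact: tsi0 | rewrite add0r].
have M_proper : M <> setT by move=> MT; apply: (nIM' 0%N); rewrite MT.
have M_semisimple : semisimple_ideal M.
  exists [set P | primitive_ideal P /\ M `<=` P]; first by move=> P [].
  apply/seteqP; split=> [x Mx P [_]|x hx]; first exact.
  apply: (@closed_ideal_primitive_hull M') => P MP; apply: (hx P).
  by split=> //; exact: prim_primitive.
have M_prime : prime_ideal M.
  split=> // X Y Xi Yi XYM.
  have [|nX] := pselect (X `<=` M); [by left | right].
  apply: contrapT => nY.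
  have [n nP] := big X Xi nX; have [m mP] := big Y Yi nY.
  apply: (nIM' (maxn n m)) => x Ix.
  (* [M + X] and [M + Y] multiply into [M], and so do their closures; thus the square of
     [I (maxn n m)] lies in [M]. *)
  have prod y z : (I (maxn n m) : set A) y -> (I (maxn n m) : set A) z -> M (bmul y z).
    move=> Iy Iz.
    apply: (@closure_bmul R A (sumM X) (sumM Y) M' _ y z).
    - move=> _ _ [u [v [Mu Xv ->]]] [u' [v' [Mu' Yv' ->]]] /=.
      rewrite bmulDl; apply: (tsiD Mi); first exact: tsiMr.
      by rewrite bmulDr; apply: (tsiD Mi); [exact: tsiMl | exact: XYM].
    - by apply: nP; apply: I_le Iy; rewrite leq_maxl.
    - by apply: mP; apply: I_le Iz; rewrite leq_maxr.
  apply: (closed_ideal_semiprime tauH Mi Mc); first exact: prod.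
  move=> b; apply: prod => //; exact: (tsiMr (ideal_two_sided _)).
by exists (MkPrims M_proper M_semisimple M_prime).
Qed.

(** The meets over the members of a filter form a directed family with closed union [N]. If [N]
    contained some [I n], one meet would contain [I n.+1], and so would a point of the set; hence
    [N] lies in an avoiding prime, which is a cluster point. *)
Lemma compact_avoiding :
  compact [set Q : Prims A | forall n, ~ (I n `<=` Q)].
Proof.
move=> F FF FK.
pose D := [set X | exists2 S, F S & X = prims_meet S :> set A].
have Ddir : directed_sets D.
  split; first by exists (prims_meet setT), setT => //; exact: filterT.
  move=> _ _ [S FS ->] [T FT ->]; exists (prims_meet (S `&` T)); split.
  - by exists (S `&` T) => //; exact: filterI.
  - by move=> x xS Q [SQ _]; exact: xS.
  - by move=> x xT Q [_ TQ]; exact: xT.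
have Di X : D X -> two_sided_ideal X /\ closed X.
  by move=> [S _ ->]; split; [exact: ideal_two_sided | exact: ideal_closed].
pose N := closed_hull (directed_union_ideal Ddir (fun X h => (Di X h).1)).
have [[n In]|/forallNP nIN] := pselect (exists n, I n `<=` N).
  have [_ [S FS ->] IS] := I_decr Ddir Di In.
  have [Q [SQ KQ]] := @filter_ex _ F _ _ (filterI FS FK).
  by exfalso; apply: (KQ n.+1) => x /IS; exact.
have [Q [NQ KQ]] := ex_prims_avoiding nIN.
exists Q; split=> // S V FS; rewrite nbhsE => -[B [Bop BQ] BV].
apply: contrapT => SV0; apply: (Bop Q) BQ => x xB.
apply: NQ; apply: subset_closure; exists (prims_meet S); first by exists S.
move=> T ST; apply: xB => BT; apply: SV0.
by exists T; split=> //; exact: BV.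
Qed.

End WayBelowSequence.

(** Interpolating repeatedly between [X] and [Y] keeps every [I n] above [X]. The compact set thus
    contains the open set of primes not above [X], and lies in [B] since [I 0] is [Y]. *)
Lemma prims_compact_nbhs_bases : has_compact_nbhs_bases (Prims A).
Proof.
move=> P V; rewrite nbhsE => -[B [Bop BP] BV].
pose Y := prims_meet (~` B).
have nYP : ~ (Y `<=` prims_closed_ideal P) by move=> YP; exact: (Bop P YP).
have [X [XY nXP]] := way_below_approx tauH nYP.
have /choice[g gP] : forall Z : closed_ideal A, exists Z' : closed_ideal A,
    way_below X Z -> way_below X Z' /\ way_below Z' Z.
  move=> Z; have [XZ|nXZ] := pselect (way_below X Z); last by exists Z.
  by have [Z' h] := way_below_interpolate tauH XZ; exists Z'.
pose I n := iter n g Y.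
have XI n : way_below X (I n) by elim: n => [//|n /gP[]].
have I_decr n : way_below (I n.+1) (I n) by have [] := gP _ (XI n).
exists [set Q : Prims A | forall n, ~ (I n `<=` Q)]; split.
- pose X' := [set Q : Prims A | ~ (X `<=` Q)].
  have X'op : hk_open (@prims_set _ A) X'.
    move=> Q hQ /= nXQ; apply: nXQ; apply: subset_trans hQ => x Xx T nT.
    by apply: contrapT => Tx; apply: nT => /(_ x Xx).
  exists X'; first by split; [exact: X'op | exact: nXP].
  move=> Q nXQ n IQ; apply: nXQ; apply: subset_trans IQ.
  exact: (way_below_sub (@XI n)).
- exact: compact_avoiding.
- move=> Q /(_ 0%N) nYQ; apply: BV; apply: contrapT => nBQ; apply: nYQ => x.
  by apply.
Qed.

End Synthesis.

Theorem corollary1p18 (R : realType) (A : banachAlgType R) :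
  PI_algebra A -> hausdorff_space (closed_ideal A) -> spectral_synthesis A.
Proof.
move=> A_PI tauH; split.
- exact: prims_compact_nbhs_bases.
- exact: hausdorff_lower_bounded_nets.
- exact: pi_prim_support_lattice_iso.
Qed.
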